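(* Let $\Omega\subset\mathbb{R}^2$ be a bounded domain, with coordinates $(x,z)$. Let $\varepsilon_n>0$ with $\varepsilon_n\searrow0$, and let $\{u_n\}\subset H^1(\Omega)$ with $\partial_x^2u_n\in L^2(\Omega)$ for every $n$ be such that $$\partial_xu_n\to\partial_xu \ \text{ in } L^3(\Omega)\quad\text{and}\quad \partial_zu_n\to\partial_zu\ \text{ in } L^{3/2}(\Omega)$$ for some $u\in H^1(\Omega)$ with $\nabla u=(\partial_xu,\partial_zu)\in L^\infty(\Omega;\mathbb{R}^2)\cap BV(\Omega;\mathbb{R}^2)$. Then $$\liminf_{n\to\infty}E_{\varepsilon_n}(u_n)\ \ge\ \int_{J_{\nabla u}}\big|(\Sigma(\nabla u^+)-\Sigma(\nabla u^-))\cdot\nu\big|\,d\mathcal{H}^1 .$$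
   Context: For $\varepsilon>0$ and $u\in H^1(\Omega)$ with $\partial_x^2u\in L^2(\Omega)$, $$E_\varepsilon(u)=\frac12\int_\Omega\left\{\frac{1}{\varepsilon}\Big(\partial_z u-\tfrac12(\partial_x u)^2\Big)^2+\varepsilon(\partial_x^2u)^2\right\}dx\,dz,$$ with the convention $E_\varepsilon(u)=+\infty$ if $\int_\Omega(\partial_zu-\frac12(\partial_xu)^2)^2\,dx\,dz=\infty$. The vector field $\Sigma:\mathbb{R}^2\to\mathbb{R}^2$ is $\Sigma(m)=\left(m_1m_2-\frac16m_1^3,\,-\frac12m_1^2\right)$. For $\nabla u\in BV(\Omega;\mathbb{R}^2)$, $J_{\nabla u}$ denotes its (countably 1-rectifiable) jump set, $\nu$ a unit normal to $J_{\nabla u}$ (orthogonal to the approximate tangent space), and $\nabla u^\pm$ the one-sided traces of $\nabla u$ on $J_{\nabla u}$, so that the jump part of $D(\nabla u)$ is $(\nabla u^+-\nabla u^-)\otimes\nu\,\mathcal{H}^1$ restricted to $J_{\nabla u}$; $\mathcal{H}^1$ is one-dimensional Hausdorff measure. *)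

(* Defs.v *)
From HB Require Import structures.
From mathcomp Require Import all_boot all_order all_algebra.
From mathcomp Require Import all_classical all_reals all_analysis.
From mathcomp Require Import ring lra.

Set Implicit Arguments.
Unset Strict Implicit.
Unset Printing Implicit Defensive.
Import Order.TTheory GRing.Theory Num.Theory.
Import numFieldNormedType.Exports.

Local Open Scope classical_set_scope.
Local Open Scope ring_scope.

(* Points (x, z) of the plane are pairs.  The library's norm on R * R is the
   max norm: it is only used for topological notions (open, compact, bounded,
   derivable); the Euclidean norm is [enorm]. *)
Section Plane.
Context {R : realType}.
Implicit Types (p q : R * R) (A B X : set (R * R)).

Definition ex : R * R := (1, 0).
Definition ez : R * R := (0, 1).

Definition dotp p q : R := p.1 * q.1 + p.2 * q.2.
Definition enorm p : R := Num.sqrt (dotp p p).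

Definition leb2 :
    {measure set (measurableTypeR R * measurableTypeR R) -> \bar R} :=
  (@lebesgue_measure R \x @lebesgue_measure R)%E.

Definition bounded_domain (Om : set (R * R)) :=
  [/\ open Om, connected Om, Om !=set0 & bounded_set Om].

End Plane.

Section HausdorffMeasure.
Context {R : realType}.
Implicit Types (p q : R * R) (A B X : set (R * R)) (r s d : R).

(* The leading 0 makes the diameter of the empty set 0 instead of -oo. *)
Definition ediam A : \bar R :=
  maxe 0%E (ereal_sup [set (enorm (pq.1 - pq.2))%:E | pq in A `*` A]).

Definition delta_cover d A (U : (set (R * R))^nat) :=
  A `<=` \bigcup_i U i /\ forall i, (ediam (U i) <= d%:E)%E.

Definition hausdorff1_delta d A : \bar R :=
  ereal_inf [set (\sum_(i <oo) ediam (U i))%E | U in delta_cover d A].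

(* In dimension one the normalising constant omega_1 / 2 is 1. *)
Definition hausdorff1 A : \bar R :=
  ereal_sup [set hausdorff1_delta d A | d in [set d | 0 < d]].

(* [hausdorff1] is an outer measure and, Borel sets being Caratheodory
   measurable, a measure on the Borel sigma-algebra of the plane. *)

Lemma ediam_ge0 A : (0 <= ediam A)%E.
Proof. by rewrite /ediam le_max lexx. Qed.

Lemma ediam0 : ediam set0 = 0%E.
Proof.
rewrite /ediam (_ : [set _ | _ in _] = set0) ?ereal_sup0 ?maxNye//.
by rewrite -subset0 => ? [? []].
Qed.

Lemma le_ediam A B : A `<=` B -> (ediam A <= ediam B)%E.
Proof.
move=> AB; rewrite /ediam ge_max !le_max lexx/=; apply/orP; right.
apply: ereal_sup_le => _ [[p q] [Ap Aq] <-]; exists (p, q) => //.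
by split; exact: AB.
Qed.

Lemma ediam_ge A p q : A p -> A q -> ((enorm (p - q))%:E <= ediam A)%E.
Proof.
move=> Ap Aq; rewrite /ediam le_max; apply/orP; right.
by apply: ereal_sup_ubound; exists (p, q).
Qed.

Lemma hausdorff1_delta_ge0 d A : (0 <= hausdorff1_delta d A)%E.
Proof.
apply: le_ereal_inf_tmp => _ [U _ <-]; apply: nneseries_ge0 => i _ _.
exact: ediam_ge0.
Qed.

Lemma le_hausdorff1_delta d A B :
  A `<=` B -> (hausdorff1_delta d A <= hausdorff1_delta d B)%E.
Proof.
move=> AB; apply: ereal_inf_le_tmp => _ [U [BU dU] <-]; exists U => //.
by split => //; exact: subset_trans BU.
Qed.

Lemma hausdorff1_delta_anti d r A : d <= r ->
  (hausdorff1_delta r A <= hausdorff1_delta d A)%E.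
Proof.
move=> dr; apply: ereal_inf_le_tmp => _ [U [AU dU] <-]; exists U => //.
by split => // i; rewrite (le_trans (dU i))// lee_fin.
Qed.

Lemma hausdorff1_delta0 d : 0 < d -> hausdorff1_delta d set0 = 0%E.
Proof.
move=> d0; apply/eqP; rewrite eq_le hausdorff1_delta_ge0 andbT.
apply: ereal_inf_lbound; exists (fun=> set0).
  by split=> // i; rewrite ediam0 lee_fin ltW.
by apply: eseries0 => i _ _; exact: ediam0.
Qed.

Lemma hausdorff1_delta_sigma_subadditive d :
  sigma_subadditive (hausdorff1_delta d).
Proof.
set mu := hausdorff1_delta d; move=> A.
have [[i ioo]|] := pselect (exists i, mu (A i) = +oo)%E.
  rewrite (eseries_pinfty _ _ ioo) ?leey// => n _.
  by rewrite -ltNye (lt_le_trans _ (hausdorff1_delta_ge0 _ _)).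
rewrite -forallNE => Aoo.
suff add2e (e : {posnum R}) :
    (mu (\bigcup_n A n) <= \sum_(i <oo) mu (A i) + e%:num%:E)%E.
  by apply/lee_addgt0Pr => _/posnumP[].
rewrite (le_trans _ (epsilon_trick _ _ _))//; last first.
  by move=> n; exact: hausdorff1_delta_ge0.
pose P n (B : (set (R * R))^nat) := delta_cover d (A n) B /\
  (\sum_(k <oo) ediam (B k) <= mu (A n) + (e%:num / (2 ^ n.+1)%:R)%:E)%E.
have [G PG] : {G : ((set (R * R))^nat)^nat & forall n, P n (G n)}.
  apply: (@choice _ _ P) => n; rewrite /P /mu /hausdorff1_delta.
  set S := (X in ereal_inf X); move infS : (ereal_inf S) => iS.
  case: iS infS => [r Sr|Soo|Soo].
  - have en1 : (0 < e%:num / (2 ^ n.+1)%:R)%R by [].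
    have /(lb_ereal_inf_adherent en1) : ereal_inf S \is a fin_num by rewrite Sr.
    move=> [x [B AnB muBx] xS].
    by exists B; split => //; rewrite muBx -Sr; exact/ltW.
  - by have := Aoo n; rewrite /mu /hausdorff1_delta -/S Soo.
  - suff : lbound S 0%E by move/le_ereal_inf_tmp; rewrite Soo.
    move=> /= _ [B AnB <-]; apply: nneseries_ge0 => i _ _.
    exact: ediam_ge0.
have muG_ge0 x : (0 <= (ediam \o uncurry G) x)%E by exact: ediam_ge0.
apply: (@le_trans _ _ (\esum_(i in setT) (ediam \o uncurry G) i)).
  rewrite /mu; apply: ereal_inf_lbound => /=.
  have /card_esym/ppcard_eqP[f] := card_nat2.
  exists (uncurry G \o f).
    split => [|i]; last by rewrite /= /uncurry; case: (f i) => a b; exact: (PG a).1.2.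
    apply: (@subset_trans _  (\bigcup_n \bigcup_k G n k)) => [t [i _]|].
      by move=> Ait; have [j _ ?] := (PG i).1.1 _ Ait; exists i => //; exists j.
    move=> t [i _ [j _ Bijt]]; exists (f^-1%FUN (i, j)) => //=.
    by rewrite invK ?inE.
  rewrite -(esum_pred_image (ediam \o uncurry G) _ xpredT) ?[fun=> _]set_true//.
  by rewrite image_eq.
rewrite (_ : esum _ _ = \sum_(i <oo) \sum_(j <oo ) ediam (G i j))%E; last first.
  pose J : nat -> set (nat * nat) := fun i => [set (i, j) | j in setT].
  rewrite (_ : setT = \bigcup_k J k); last first.
    by rewrite predeqE => -[a b]; split => // _; exists a => //; exists b.
  rewrite esum_bigcupT /=; last 2 first.
    - apply/trivIsetP => i j _ _ ij.
      rewrite predeqE => -[n m] /=; split => //= -[] [_] _ [<-{n} _].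
      by move=> [m' _] [] /esym/eqP; rewrite (negbTE ij).
    - by move=> /= [n m]; exact: ediam_ge0.
  rewrite -(image_id [set: nat]) -fun_true esum_pred_image//; last first.
    by move=> n _; apply: esum_ge0 => ? _; exact: ediam_ge0.
  apply: eq_eseriesr => /= j _.
  rewrite -(esum_pred_image (ediam \o uncurry G) (pair j) predT)//=; last first.
    by move=> ? ? _ _; exact: (@can_inj _ _ _ snd).
    by move=> n _; exact: ediam_ge0.
  by congr esum; rewrite predeqE => -[a b]; split; move=> [i _ <-]; exists i.
apply: lee_lim.
- apply: is_cvg_nneseries => n *.
  by apply: nneseries_ge0 => m *; exact: (muG_ge0 (n, m)).
- apply: is_cvg_nneseries => n *; apply: adde_ge0 => //.
  exact: hausdorff1_delta_ge0.
- by near=> n; apply: lee_sum => i _; exact: (PG i).2.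
Unshelve. all: by end_near. Qed.

Lemma hausdorff1_delta_le d A : 0 < d ->
  (hausdorff1_delta d A <= hausdorff1 A)%E.
Proof. by move=> d0; apply: ereal_sup_ubound; exists d. Qed.

Lemma hausdorff10 : hausdorff1 set0 = 0%E.
Proof.
apply/eqP; rewrite eq_le; apply/andP; split.
  by apply: ge_ereal_sup => _ [d /= d0 <-]; rewrite hausdorff1_delta0.
by rewrite -(hausdorff1_delta0 ltr01); exact: hausdorff1_delta_le.
Qed.

Lemma hausdorff1_ge0 A : (0 <= hausdorff1 A)%E.
Proof.
by apply: le_trans (hausdorff1_delta_le A ltr01); exact: hausdorff1_delta_ge0.
Qed.

Lemma le_hausdorff1 : {homo hausdorff1 : A B / A `<=` B >-> (A <= B)%E}.
Proof.
move=> A B AB; apply: ge_ereal_sup => _ [d /= d0 <-].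
by apply: le_trans (hausdorff1_delta_le B d0); exact: le_hausdorff1_delta.
Qed.

Lemma hausdorff1_sigma_subadditive : sigma_subadditive hausdorff1.
Proof.
move=> F; apply: ge_ereal_sup => _ [d /= d0 <-].
apply: le_trans (hausdorff1_delta_sigma_subadditive _ _) _.
apply: lee_nneseries => i _; first by move=> _; exact: hausdorff1_delta_ge0.
exact: hausdorff1_delta_le.
Qed.

HB.instance Definition _ := isOuterMeasure.Build R (R * R)%type hausdorff1
  hausdorff10 hausdorff1_ge0 le_hausdorff1 hausdorff1_sigma_subadditive.

Lemma hausdorff1_delta_separated (l : R * R -> R) d a b A B :
  (forall p q, `|l p - l q| <= enorm (p - q)) -> d < b - a ->
  (forall p, A p -> l p <= a) -> (forall q, B q -> b <= l q) ->
  (hausdorff1_delta d A + hausdorff1_delta d B <=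
   hausdorff1_delta d (A `|` B))%E.
Proof.
move=> llip dab Aa Bb; apply: le_ereal_inf_tmp => _ [U [ABU dU] <-].
apply: (@le_trans _ _ (\sum_(i <oo) ediam (U i `&` A) +
                       \sum_(i <oo) ediam (U i `&` B))%E).
  apply: leeD; apply: ereal_inf_lbound.
    exists (fun i => U i `&` A) => //; split => [p Ap|i]; last first.
      by apply: le_trans (dU i); exact: le_ediam.
    by have [i _ Uip] := ABU p (or_introl Ap); exists i.
  exists (fun i => U i `&` B) => //; split => [p Bp|i]; last first.
    by apply: le_trans (dU i); exact: le_ediam.
  by have [i _ Uip] := ABU p (or_intror Bp); exists i.
rewrite -nneseriesD; try by move=> i _ _; exact: ediam_ge0.
apply: lee_nneseries => i _.
  by move=> _; apply: adde_ge0; exact: ediam_ge0.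
have [[p [Uip Ap]]|UA0] := pselect (U i `&` A !=set0); last first.
  have -> : U i `&` A = set0 by apply/seteqP; split => // p Up; case: UA0; exists p.
  by rewrite ediam0 add0e; exact: le_ediam.
have -> : U i `&` B = set0.
  rewrite -subset0 => q [Uiq Bq].
  have := le_trans (ediam_ge Uip Uiq) (dU i); rewrite lee_fin.
  have := llip p q; have := Aa _ Ap; have := Bb _ Bq.
  have := ler_norm (l q - l p); rewrite distrC; lra.
by rewrite ediam0 adde0; exact: le_ediam.
Qed.

Lemma hausdorff1_separated (l : R * R -> R) a b A B :
  (forall p q, `|l p - l q| <= enorm (p - q)) -> a < b ->
  (forall p, A p -> l p <= a) -> (forall q, B q -> b <= l q) ->
  (hausdorff1 A + hausdorff1 B <= hausdorff1 (A `|` B))%E.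
Proof.
move=> llip ab Aa Bb.
have [->|/eqP Hoo] := pselect (hausdorff1 (A `|` B) = +oo%E).
  by rewrite leey.
have fH C : C `<=` A `|` B -> hausdorff1 C \is a fin_num.
  move=> CAB; rewrite ge0_fin_numE ?hausdorff1_ge0//.
  by rewrite (le_lt_trans (le_hausdorff1 CAB))// ltey.
have fd C d : 0 < d -> C `<=` A `|` B -> hausdorff1_delta d C \is a fin_num.
  move=> d0 CAB; rewrite ge0_fin_numE ?hausdorff1_delta_ge0//.
  rewrite (le_lt_trans (hausdorff1_delta_le C d0))//.
  by rewrite -ge0_fin_numE ?hausdorff1_ge0// fH.
have sub d1 d2 : 0 < d1 -> 0 < d2 ->
    (hausdorff1_delta d1 A + hausdorff1_delta d2 B <= hausdorff1 (A `|` B))%E.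
  move=> d10 d20; pose d := Num.min (Num.min d1 d2) ((b - a) / 2).
  have d0 : 0 < d by rewrite !lt_min d10 d20/=; lra.
  have dd1 : d <= d1 by rewrite !ge_min lexx.
  have dd2 : d <= d2 by rewrite !ge_min lexx orbT.
  have dab : d < b - a.
    by apply: (@le_lt_trans _ _ ((b - a) / 2)); [rewrite ge_min lexx orbT|lra].
  apply: (@le_trans _ _ (hausdorff1_delta d A + hausdorff1_delta d B)%E).
    by apply: leeD; exact: hausdorff1_delta_anti.
  apply: le_trans (hausdorff1_delta_le _ d0).
  exact: (@hausdorff1_delta_separated l d a b).
rewrite -leeBrDr ?fH//; apply: ge_ereal_sup => _ [d1 /= d10 <-].
rewrite leeBrDr ?fH// addeC -leeBrDr ?fd//.
apply: ge_ereal_sup => _ [d2 /= d20 <-].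
by rewrite leeBrDr ?fd// addeC sub.
Qed.

Lemma caratheodory_hausdorff1_le (l : R * R -> R) a :
  (forall p q, `|l p - l q| <= enorm (p - q)) ->
  hausdorff1.-caratheodory [set p | l p <= a].
Proof.
move=> llip; apply: le_caratheodory_measurable => X /=.
set A := [set p | l p <= a].
have [->|/eqP Hoo] := pselect (hausdorff1 X = +oo%E); first by rewrite leey.
have HX : hausdorff1 X \is a fin_num.
  by rewrite ge0_fin_numE ?hausdorff1_ge0// ltey.
pose t (k : nat) : R := a + k.+1%:R^-1.
have tdec k : t k.+1 < t k.
  by rewrite /t ltrD2l ltf_pV2 ?posrE ?ltr0n// ltr_nat.
have ta k : a < t k by rewrite /t ltrDl invr_gt0 ltr0n.
pose D (k : nat) := X `&` [set p | t k.+2 < l p /\ l p <= t k.+1].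
have shells c n : (\sum_(k < n) hausdorff1 (D (k.*2 + c)%N) <=
    hausdorff1 (X `&` [set p | (t (n.*2 + c)%N <= l p)%R]))%E.
  elim: n => [|n IHn]; first by rewrite big_ord0; exact: hausdorff1_ge0.
  rewrite big_ord_recr/=; apply: (le_trans (leeD2r _ IHn)).
  rewrite addeC; apply: le_trans.
    apply: (@hausdorff1_separated l (t (n.*2 + c).+1) (t (n.*2 + c)%N)) => //.
    - by move=> p [_ /= []].
    - by move=> q [_].
  apply: le_hausdorff1 => p [[Xp /= [lp _]]|[Xp /= lp]]; split => //=.
    by rewrite ltW.
  apply: le_trans lp; apply: ltW; apply: lt_trans (tdec _) ; exact: tdec.
have shellsX c n : (\sum_(k < n) hausdorff1 (D (k.*2 + c)%N) <= hausdorff1 X)%E.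
  by apply: le_trans (shells c n) _; apply: le_hausdorff1 => p [].
have sumD : (\sum_(0 <= k <oo) hausdorff1 (D k) < +oo)%E.
  apply: (@le_lt_trans _ _ (hausdorff1 X + hausdorff1 X)%E); last first.
    by rewrite -ge0_fin_numE ?fin_numD ?HX// adde_ge0 ?hausdorff1_ge0.
  apply: lime_le; first by apply: is_cvg_nneseries => ? _ _; exact: hausdorff1_ge0.
  near=> n; rewrite big_mkord.
  have parity m : (\sum_(k < m.*2) hausdorff1 (D k) =
      \sum_(k < m) hausdorff1 (D (k.*2 + 0)%N) +
      \sum_(k < m) hausdorff1 (D (k.*2 + 1)%N))%E.
    elim: m => [|m IHm]; first by rewrite !big_ord0 adde0.
    rewrite doubleS !big_ord_recr/= IHm addn0 addn1 -!addeA; congr (_ + _)%E.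
    by rewrite addeCA.
  apply: (@le_trans _ _ (\sum_(k < n.*2) hausdorff1 (D k))%E).
    rewrite -!(big_mkord xpredT (hausdorff1 \o D)).
    apply: lee_sum_nneg_natr => [k _ _|]; first exact: hausdorff1_ge0.
    by rewrite -addnn leq_addr.
  by rewrite parity; apply: leeD; exact: shellsX.
have /= tail := nneseries_tail_cvg sumD (fun k _ => hausdorff1_ge0 (D k)).
apply/lee_addgt0Pr => e e0.
have [N _ /(_ N (leqnn N)) tailN] : \forall N \near \oo,
    (\sum_(N <= k <oo) hausdorff1 (D k) < e%:E)%E.
  apply: (tail [set x | x < e%:E]%E).
  apply: open_nbhs_nbhs; split; first exact: open_ereal_lt_ereal.
  by rewrite /= lte_fin.
have tmon m n : (m <= n)%N -> t n <= t m.
  by move=> mn; rewrite /t lerD2l lef_pV2 ?posrE ?ltr0n// ler_nat ltnS.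
have XAC : X `&` ~` A `<=`
    (X `&` [set p | t N.+1 <= l p]) `|` \bigcup_k D (k + N)%N.
  move=> p [Xp /negP]; rewrite -ltNge => /ltr_add_invr ap.
  have [m tm mmin] := ex_minnP ap.
  have [mN|Nm] := leqP m N.+1.
    by left; split => //=; apply: le_trans (tmon _ _ mN) (ltW tm).
  right; exists (m - N.+2)%N => //; split => //=.
  have -> : (m - N.+2 + N).+2 = m by rewrite -addnS -addnS subnK.
  split => //; rewrite leNgt; apply/negP => /mmin.
  by rewrite -addnS -ltnS -addnS subnK// ltnn.
apply: le_trans (leeD2l _ (le_hausdorff1 XAC)) _.
apply: le_trans (leeD2l _ (outer_measureU2 _ _ _)) _.
rewrite addeA; apply: leeD.
  apply: (@le_trans _ _
      (hausdorff1 ((X `&` A) `|` (X `&` [set p | t N.+1 <= l p])))).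
    by apply: (@hausdorff1_separated l a (t N.+1)) => // [p []|q []].
  by apply: le_hausdorff1 => p [] [].
apply: le_trans (hausdorff1_sigma_subadditive _) _.
rewrite (@nneseries_addn _ (hausdorff1 \o D))/=; first exact: ltW.
by move=> i; exact: hausdorff1_ge0.
Unshelve. all: by end_near. Qed.

Lemma fst_lip p q : `|p.1 - q.1| <= enorm (p - q).
Proof.
by rewrite -sqrtr_sqr ler_wsqrtr// /dotp/= -!expr2 lerDl sqr_ge0.
Qed.

Lemma snd_lip p q : `|p.2 - q.2| <= enorm (p - q).
Proof.
by rewrite -sqrtr_sqr ler_wsqrtr// /dotp/= -!expr2 lerDr sqr_ge0.
Qed.

Lemma caratheodory_hausdorff1_preimage (l : R * R -> R)
    (B : set (measurableTypeR R)) :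
  (forall p q, `|l p - l q| <= enorm (p - q)) -> measurable B ->
  hausdorff1.-caratheodory (l @^-1` B).
Proof.
move=> llip; suff: (measurable : set (set (measurableTypeR R))) `<=`
    [set B | hausdorff1.-caratheodory (l @^-1` B)] by exact.
apply: smallest_sub.
  split => /= [|C mC|F mF].
  - exact: caratheodory_measurable_set0.
  - rewrite setTD preimage_setC; exact: caratheodory_measurable_setC.
  - rewrite preimage_bigcup; exact: caratheodory_measurable_bigcup.
move=> _ [[a b] _ <-] /=.
rewrite (_ : _ @^-1` _ = [set p | l p <= b] `&` ~` [set p | l p <= a]).
  apply: caratheodory_measurable_setI; last apply: caratheodory_measurable_setC.
    exact: caratheodory_hausdorff1_le.
  exact: caratheodory_hausdorff1_le.
apply/seteqP; split => p /=; rewrite in_itv/=.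
  by move=> /andP[ap pb]; split => //; apply/negP; rewrite -ltNge.
by move=> [-> /negP]; rewrite -ltNge => ->.
Qed.

Lemma caratheodory_hausdorff1_borel
    (A : set (measurableTypeR R * measurableTypeR R)) :
  measurable A -> hausdorff1.-caratheodory A.
Proof.
suff: (measurable : set (set (measurableTypeR R * measurableTypeR R))) `<=`
    hausdorff1.-caratheodory by exact.
apply: smallest_sub.
  split => [|C mC|F mF].
  - exact: caratheodory_measurable_set0.
  - rewrite setTD; exact: caratheodory_measurable_setC.
  - exact: caratheodory_measurable_bigcup.
by move=> _ [[B mB <-]|[B mB <-]]; rewrite setTI;
  apply: caratheodory_hausdorff1_preimage => //;
  [exact: fst_lip|exact: snd_lip].
Qed.

Lemma hausdorff1_semi_sigma_additive : semi_sigma_additive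
  (hausdorff1 : set (measurableTypeR R * measurableTypeR R) -> \bar R).
Proof.
move=> F mF tF mUF.
apply: (@caratheodory_measure_sigma_additive _ (R * R)%type hausdorff1) => //.
- by move=> i; exact: caratheodory_hausdorff1_borel.
- exact: caratheodory_hausdorff1_borel.
Qed.

HB.instance Definition _ := isMeasure.Build _ _ _
  (hausdorff1 : set (measurableTypeR R * measurableTypeR R)%type -> \bar R)
  hausdorff10 hausdorff1_ge0 hausdorff1_semi_sigma_additive.

Definition hausdorff1_measure :
  {measure set (measurableTypeR R * measurableTypeR R)%type -> \bar R} :=
  hausdorff1.

End HausdorffMeasure.

Section Sobolev.
Context {R : realType}.
Implicit Types (Om : set (R * R)) (f g u phi : R * R -> R) (e : R * R).

Fixpoint Cn (n : nat) phi : Prop :=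
  match n with
  | 0 => continuous phi
  | m.+1 => [/\ continuous phi,
      forall p, derivable phi p ex /\ derivable phi p ez,
      Cn m ('D_ex phi) & Cn m ('D_ez phi)]
  end.

(* C_c^oo(Om) *)
Definition test_function Om phi :=
  (forall n, Cn n phi) /\
  exists2 K, compact K /\ K `<=` Om & forall p, ~ K p -> phi p = 0.

(* L^p(Om), through the extension by zero outside Om *)
Definition Lp Om (p : \bar R) f : Prop := f \_ Om \in Lfun leb2 p.

Definition Lp_cvg Om (p : \bar R) (f_ : (R * R -> R)^nat) f :=
  [/\ forall n, Lp Om p (f_ n), Lp Om p f &
   'N[leb2]_p[EFin \o ((f_ n \- f)%R \_ Om)]%E @[n --> \oo] --> 0%E].

Definition L1loc Om f :=
  measurable_fun Om
    (f : measurableTypeR R * measurableTypeR R -> measurableTypeR R) /\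
  forall K, compact K -> K `<=` Om -> leb2.-integrable K (EFin \o f).

Definition is_weak_derivative Om e u g := [/\ L1loc Om u, L1loc Om g &
  forall phi, test_function Om phi ->
    \int[leb2]_(p in Om) (u p * 'D_e phi p) =
    - \int[leb2]_(p in Om) (g p * phi p)].

(* An arbitrary representative of the weak derivative (unique up to a.e.
   equality); 0 when there is none, so existence of a derivative has to be
   asserted separately, which [weak_derivative_in] does. *)
Definition weak_derivative Om e u : R * R -> R :=
  xget (cst 0) [set g | is_weak_derivative Om e u g].

Definition weak_derivative_in Om (p : \bar R) e u :=
  exists2 g, is_weak_derivative Om e u g & Lp Om p g.

Definition H1 Om u := [/\ Lp Om 2%:E u,
  weak_derivative_in Om 2%:E ex u & weak_derivative_in Om 2%:E ez u].

Definition weak_gradient Om u (p : R * R) : R * R :=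
  (weak_derivative Om ex u p, weak_derivative Om ez u p).

(* The distributional derivative in direction e is the finite signed Borel
   measure mup - mum. *)
Definition BV Om f := Lp Om 1%:E f /\
  forall e, e = ex \/ e = ez ->
  exists mup mum :
    {finite_measure set (measurableTypeR R * measurableTypeR R)%type -> \bar R},
  forall phi, test_function Om phi ->
    \int[leb2]_(p in Om) (f p * 'D_e phi p) =
    - (\int[mup]_(p in Om) phi p - \int[mum]_(p in Om) phi p).

End Sobolev.

Section JumpSet.
Context {R : realType}.
Implicit Types (Om : set (R * R)) (v : R * R -> R * R) (p a b nu : R * R).

(* The half of the Euclidean ball B_r(p) lying on the side nu points to. *)
Definition half_ball p nu (r : R) : set (R * R) :=
  [set q | enorm (q - p) < r /\ 0 < dotp (q - p) nu].

Definition one_sided_trace v p nu a :=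
  ((leb2 (half_ball p nu r))^-1 *
    \int[leb2]_(q in half_ball p nu r) (enorm (v q - a))%:E)%E
  @[r --> 0^'+] --> 0%E.

(* (a, b, nu) is unique up to exchanging it with (b, a, - nu); nu points from
   the side of b to the side of a. *)
Definition is_jump Om v p a b nu := [/\ Om p, a != b, enorm nu = 1,
  one_sided_trace v p nu a & one_sided_trace v p (- nu) b].

Definition jump_set Om v : set (R * R) :=
  [set p | exists a b nu, is_jump Om v p a b nu].

End JumpSet.

Section Energy.
Context {R : realType}.
Implicit Types (Om : set (R * R)) (u : R * R -> R) (m : R * R).

(* The integral is extended-real-valued and the integrand nonnegative, so the
   value is +oo when the first term is not integrable, as required. *)
Definition energy Om (eps : R) u : \bar R :=
  ((2^-1)%:E * \int[leb2]_(p in Om)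
    (eps^-1 * (weak_derivative Om ez u p
               - 2^-1 * weak_derivative Om ex u p ^+ 2) ^+ 2
     + eps * weak_derivative Om ex (weak_derivative Om ex u) p ^+ 2)%:E)%E.

Definition Sigma m : R * R :=
  (m.1 * m.2 - 6^-1 * m.1 ^+ 3, - (2^-1 * m.1 ^+ 2)).

End Energy.

(* Main.v *)
(* Write v = d_x u and w = d_z u.  Then div Sigma(grad u) = (w - v^2 / 2) d_x v,
   so by AM-GM the pairing of -div Sigma(grad u_n) with a test function phi,
   |phi| <= 1, is at most the energy of u_n; as d_x v is
   only in L^2, the identity is obtained from difference quotients.  As Sigma is
   cubic in v and of lower order in w, the L^3 and L^(3/2) convergence passes the
   pairing to the limit: the pairing with grad u is at most the liminf.
   At a jump point p, let phi be a radial bump function that approximates the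
   indicator of the disc of radius r.  Replacing grad u by its traces on the two
   half discs costs o(r), and the remaining half-plane integrals give a pairing of
   about 2 r |(Sigma(a) - Sigma(b)) . nu|, the jump times the diameter.  Bumps
   with disjoint supports can be added, so a Vitali covering turns this into
   t H^1(A) <= sup of the pairing on U, for A a set of jump points where the jump
   is at least t, and U an open neighbourhood of A.  The integral over the jump set
   is the supremum over the simple functions below the integrand, whose level
   sets are approximated from inside by disjoint closed sets; these have disjoint
   open neighbourhoods, on which the suprema add up. *)
Require Import Defs.
From HB Require Import structures.
From mathcomp Require Import all_boot all_order all_algebra.
From mathcomp Require Import all_classical all_reals all_analysis.
From mathcomp Require Import measurable_realfun ess_sup_inf ring lra.
Import Order.TTheory GRing.Theory Num.Theory.
Import numFieldNormedType.Exports.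
Local Open Scope classical_set_scope.
Local Open Scope ring_scope.
Set Implicit Arguments.
Unset Strict Implicit.
Unset Printing Implicit Defensive.

(** * Smooth functions *)

(** The only second derivative at hand is [d_x v], and [v] starts in L^2. Finite energy supplies
    what is missing: [w - v^2 / 2] is in L^2, hence so is [v^2], and this gives a meaning to [v^3]
    and [v^2 d_x v]. All functions are extended by zero to the plane, where translations are
    isometries of L^2; the weak derivative relation holds only against test functions supported in
    the domain, so each shift costs a slightly smaller domain. As [weak_derivative] picks an
    arbitrary representative, its square integrability has to be recovered through uniqueness almost
    everywhere. The estimate of H^1 has the sharp constant because the diameters of the chosen discs
    are compared directly with the pairing: the enlargement by 3 of the Vitali covering falls only
    on a tail of small total radius. A jump point carries, by its very definition, nearly optimal
    bumps at all small radii, which is the fine cover that the Vitali argument asks for. *)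

Section SmoothFunctions.
Context {R : realType}.
Implicit Types (f g : R * R -> R) (p q e : R * R).

Lemma scaler1 (h : R) : h *: (1 : R) = h.
Proof. exact: mulr1. Qed.

(** Restriction to a line turns directional derivatives into derivatives on [R], where the chain
    rule [is_derive1_comp] and the mean value theorem live. *)
Lemma derive_lineE (V : normedModType R) (f : V -> R) (p e : V) :
  'D_e f p = 'D_1 (fun t : R => f (t *: e + p)) (0 : R).
Proof.
rewrite /derive.
apply: (congr1 (fun F : R -> R => lim (F @ 0^'))); apply/funext => h /=.
by rewrite addr0 scale0r add0r scaler1.
Qed.

Lemma is_derive_line (V : normedModType R) (f : V -> R) (p e : V) (df : R) :
  is_derive (0 : R) 1 (fun t : R => f (t *: e + p)) df -> is_derive p e f df.
Proof.
by move=> [d1 d2]; split; [exact/derivable1P|rewrite derive_lineE].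
Qed.

Lemma line_is_derive (V : normedModType R) (f : V -> R) (p e : V) (df : R) :
  is_derive p e f df -> is_derive (0 : R) 1 (fun t : R => f (t *: e + p)) df.
Proof.
by move=> [d1 d2]; split; [move/derivable1P: d1|rewrite -derive_lineE].
Qed.

Lemma is_derive_shift2 f p e h (df : R) :
  is_derive (p + h) e f df -> is_derive p e (fun q => f (q + h)) df.
Proof.
move=> /line_is_derive H; apply: is_derive_line.
by under eq_fun do rewrite -addrA.
Qed.

Lemma is_derive_along f p e (t df : R) :
  is_derive (p + t *: e) e f df ->
  is_derive t 1 (fun s : R => f (p + s *: e)) df.
Proof.
move=> /line_is_derive H; apply: is_derive_line.
have -> : (fun h : R => f (p + (h *: 1 + t) *: e)) =
  (fun h : R => f (h *: e + (p + t *: e))).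
  by apply/funext => h; rewrite scaler1 scalerDl addrCA.
exact: H.
Qed.

Lemma is_derive_comp_dir (k : R -> R) f p e (dk df : R) :
  is_derive (f p) 1 k dk -> is_derive p e f df ->
  is_derive p e (k \o f) (dk * df).
Proof.
move=> dk1 /line_is_derive df1; apply: is_derive_line.
have := @is_derive1_comp R k (fun t : R => f (t *: e + p)) 0 dk df.
by rewrite scale0r add0r; exact.
Qed.

Lemma is_derive_lin1 (a b t : R) : is_derive t 1 (fun s : R => s * a + b) a.
Proof.
have : is_derive t 1 ((a *: id) + cst b : R -> R) (a *: 1 + 0).
  by apply: is_deriveD.
rewrite scaler1 addr0; have -> : a *: id + cst b = (fun s : R => s * a + b).
  by apply/funext => s /=; rewrite fctE /= mulrC.
exact.
Qed.

Lemma is_derive_fst p e : is_derive p e (fst : R * R -> R) e.1.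
Proof. apply: is_derive_line; exact: is_derive_lin1. Qed.

Lemma is_derive_snd p e : is_derive p e (snd : R * R -> R) e.2.
Proof. apply: is_derive_line; exact: is_derive_lin1. Qed.

Lemma Cn_continuous n f : Cn n f -> continuous f.
Proof. by case: n => [|n] //= []. Qed.

Lemma CnSE n f : Cn n.+1 f = [/\ continuous f,
  forall p, derivable f p ex /\ derivable f p ez,
  Cn n ('D_ex f) & Cn n ('D_ez f)].
Proof. by []. Qed.

Lemma CnW n f : Cn n.+1 f -> Cn n f.
Proof.
elim: n f => [|n IHn] f; rewrite CnSE; first by case.
case=> [cf df Dx Dz]; rewrite CnSE; split; [exact: cf|exact: df| |].
  exact: (IHn _ Dx).
exact: (IHn _ Dz).
Qed.

(** Introduction rule for the recursive [Cn]: the two partial derivatives are supplied in closed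
    form, so that smoothness goes by induction on the order. *)
Lemma CnS n f fx fz : continuous f -> Cn n fx -> Cn n fz ->
  (forall p, is_derive p ex f (fx p)) -> (forall p, is_derive p ez f (fz p)) ->
  Cn n.+1 f.
Proof.
move=> cf Cx Cz Dx Dz; rewrite CnSE.
have -> : 'D_ex f = fx by apply/funext => p; case: (Dx p).
have -> : 'D_ez f = fz by apply/funext => p; case: (Dz p).
split; [exact: cf| |exact: Cx|exact: Cz].
by move=> p; split; [case: (Dx p)|case: (Dz p)].
Qed.

Lemma CnS_inv n f : Cn n.+1 f -> [/\ continuous f, Cn n ('D_ex f),
  Cn n ('D_ez f), forall p, is_derive p ex f ('D_ex f p) &
  forall p, is_derive p ez f ('D_ez f p)].
Proof.
rewrite CnSE => -[cf df Cx Cz].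
split; [exact: cf|exact: Cx|exact: Cz| |].
  by move=> p; apply: derivableP; case: (df p).
by move=> p; apply: derivableP; case: (df p).
Qed.

Lemma Cn_cst n (c : R) : Cn n (cst c : R * R -> R).
Proof.
elim: n c => [|n IHn] c; first exact: cst_continuous.
apply: (@CnS n (cst c) (cst 0) (cst 0)); [exact: cst_continuous|exact: IHn|exact: IHn].
Qed.

Lemma Cn_fst n : Cn n (fst : R * R -> R).
Proof.
have c1 : continuous (fst : R * R -> R) by move=> p; exact: cvg_fst.
case: n => [|n] //; apply: (CnS c1 (Cn_cst n 1) (Cn_cst n 0)) => p;
  exact: is_derive_fst.
Qed.

Lemma Cn_snd n : Cn n (snd : R * R -> R).
Proof.
have c1 : continuous (snd : R * R -> R) by move=> p; exact: cvg_snd.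
case: n => [|n] //; apply: (CnS c1 (Cn_cst n 0) (Cn_cst n 1)) => p;
  exact: is_derive_snd.
Qed.

Lemma Cn_add n f g : Cn n f -> Cn n g -> Cn n (f + g).
Proof.
elim: n f g => [|n IHn] f g.
  by move=> cf cg p; apply: cvgD; [exact: cf|exact: cg].
move=> /CnS_inv[cf fx fz dfx dfz] /CnS_inv[cg gx gz dgx dgz].
refine (@CnS n (f + g) ('D_ex f + 'D_ex g) ('D_ez f + 'D_ez g) _
  (IHn _ _ fx gx) (IHn _ _ fz gz) _ _).
- by move=> p; apply: cvgD; [exact: cf|exact: cg].
Qed.

Lemma Cn_mul n f g : Cn n f -> Cn n g -> Cn n (f * g).
Proof.
elim: n f g => [|n IHn] f g.
  by move=> cf cg p; apply: cvgM; [exact: cf|exact: cg].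
move=> Cf Cg; have Cf' := CnW Cf; have Cg' := CnW Cg.
move: Cf Cg => /CnS_inv[cf fx fz dfx dfz] /CnS_inv[cg gx gz dgx dgz].
refine (@CnS n (f * g) (f * 'D_ex g + g * 'D_ex f)
   (f * 'D_ez g + g * 'D_ez f) _ (Cn_add (IHn _ _ Cf' gx) (IHn _ _ Cg' fx))
   (Cn_add (IHn _ _ Cf' gz) (IHn _ _ Cg' fz)) _ _).
- by move=> p; apply: cvgM; [exact: cf|exact: cg].
Qed.

Lemma Cn_shift n f h : Cn n f -> Cn n (fun p => f (p + h)).
Proof.
have cs g : continuous g -> continuous (fun p : R * R => g (p + h)).
  move=> cg p; apply: (@continuous_comp _ _ _ (fun q => q + h) g); last exact: cg.
  by apply: cvgD; [exact: cvg_id|exact: cvg_cst].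
elim: n f => [|n IHn] f; first exact: cs.
move=> /CnS_inv[cf fx fz dfx dfz].
apply: (CnS (cs _ cf) (IHn _ fx) (IHn _ fz)) => p; exact: is_derive_shift2.
Qed.

End SmoothFunctions.

(** * The flat function exp(-1/t) and its relatives *)

Section Flat.
Context {R : realType}.
Implicit Types (t s : R) (f g : R * R -> R) (p q e : R * R).

(* The derivatives of exp(-1/t), t > 0, are combinations of these functions. *)
Definition flat (n : nat) t : R :=
  if 0 < t then t^-1 ^+ n * expR (- t^-1) else 0.

Lemma flat0 n t : t <= 0 -> flat n t = 0.
Proof. by rewrite /flat leNgt => /negbTE ->. Qed.

Lemma flat_ge0 n t : 0 <= flat n t.
Proof.
rewrite /flat; case: ifPn => // t0.
by rewrite mulr_ge0 ?expR_ge0// exprn_ge0// invr_ge0 ltW.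
Qed.

(** A single term of the exponential series is a lower bound for [expR s]. *)
Lemma expn_expRN n s : 0 <= s -> s ^+ n * expR (- s) <= n`!%:R.
Proof.
move=> s0; case: n => [|n].
  by rewrite expr0 mul1r fact0 -expR0 ler_expR oppr_le0.
rewrite expRN ler_pdivrMr ?expR_gt0//.
have := expR_ge1Dxn n s0; move=> /(le_trans (ler_wpDl ler01 (lexx _))).
by rewrite ler_pdivrMr ?ltr0n ?fact_gt0// mulrC.
Qed.

Lemma flat_le n t : flat n t <= n`!%:R.
Proof.
rewrite /flat; case: ifPn => t0; last by rewrite ler0n.
by apply: expn_expRN; rewrite invr_ge0 ltW.
Qed.

Lemma flat_shift n k t : flat n t = t ^+ k * flat (n + k) t.
Proof.
rewrite /flat; case: ifPn => t0; last by rewrite mulr0.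
rewrite exprD mulrA [_ * (_ ^+ k)]mulrC mulrA -exprMn divff ?gt_eqF//.
by rewrite expr1n mul1r.
Qed.

(** Powers of 1/t absorb powers of t ([flat_shift] with exponent 2). This quadratic decay makes the
    difference quotient at 0 vanish. *)
Lemma flat_le_sqr n t : `|flat n t| <= (n.+2)`!%:R * t ^+ 2.
Proof.
rewrite ger0_norm ?flat_ge0// (flat_shift n 2) addn2 mulrC.
by rewrite ler_wpM2r ?sqr_ge0// flat_le.
Qed.

Lemma is_derive_flat n t :
  is_derive t 1 (flat n) (flat n.+2 t - n%:R * flat n.+1 t).
Proof.
have [t0|t0|->] := ltgtP t 0.
- rewrite !flat0 ?(ltW t0)// mulr0 subr0.
  apply: (@near_eq_is_derive _ _ _ (cst 0)).
  near=> s; rewrite flat0//=; apply: ltW.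
  by near: s; apply: lt_nbhsl.
- pose g (s : R) := s^-1 ^+ n * expR (- s^-1).
  apply: (@near_eq_is_derive _ _ _ g).
    near=> s; rewrite /flat ifT//.
    by near: s; apply: lt_nbhsr.
  have tN0 : t != 0 by rewrite gt_eqF.
  have dinv : is_derive t 1 (fun s : R => s^-1) (- t^-1 ^+ 2).
    have := @is_deriveV R id t 1 1 tN0 (is_derive_id t (1 : R)).
    by rewrite scaler1 exprVn.
  have d1 : is_derive t 1 (fun s : R => expR (- s^-1)) (expR (- t^-1) * t^-1 ^+ 2).
    apply: (@is_derive1_comp _ expR (fun s : R => - s^-1)).
    by rewrite -[t^-1 ^+ 2]opprK; exact: is_deriveN.
  have d2 : is_derive t 1 (fun s : R => s^-1 ^+ n)
      ((n%:R * t^-1 ^+ n.-1) *: (- t^-1 ^+ 2)).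
    have := @is_deriveX _ _ (fun s : R => s^-1) n t 1 _ dinv.
    by rewrite exprfctE.
  have := @is_deriveM _ _ _ _ t 1 _ _ d2 d1.
  have -> : (fun s : R => s^-1 ^+ n) * (fun s : R => expR (- s^-1)) = g by [].
  congr is_derive; rewrite /flat t0 /GRing.scale/=.
  case: n {g d2} => [|n] /=; first by rewrite !mul0r mulr0 addr0 subr0 expr0; ring.
  by rewrite !exprS; ring.
(* At 0 the quotient is at most (n+2)! |h| by [flat_le_sqr]. *)
- rewrite !flat0// mulr0 subr0.
  suff H : h^-1 *: ((flat n \o shift 0) (h *: 1) - flat n 0) @[h --> (0:R)^'] --> (0 : R).
    by split; [apply/cvg_ex; exists 0|exact/cvg_lim].
  apply/cvgrPdist_le => eps eps0; near=> h.
  have h0 : h != 0 by near: h; exact: nbhs_dnbhs_neq.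
  rewrite /= (flat0 n (lexx 0)) scaler1 addr0 subr0 sub0r normrN normrZ normfV.
  rewrite mulrC ler_pdivrMr ?normr_gt0//.
  apply: (le_trans (flat_le_sqr n h)).
  rewrite -real_normK ?num_real// expr2 mulrA ler_wpM2r//.
  rewrite mulrC -ler_pdivlMr ?ltr0n ?fact_gt0//.
  near: h; apply: (@dnbhs0_le R R); rewrite divr_gt0// ltr0n fact_gt0//.
Unshelve. all: by end_near. Qed.

Lemma continuous_flat n : continuous (flat n).
Proof.
move=> t; apply: differentiable_continuous; apply/derivable1_diffP.
by case: (is_derive_flat n t).
Qed.

Lemma Cn_scale m (c : R) f : Cn m f -> Cn m (fun p => c * f p).
Proof. by move=> /(Cn_mul (Cn_cst m c)). Qed.

(** Induction on [m] with [n] general: differentiation raises [n] by one or two but stays inside the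
    family. *)
Lemma Cn_flat_comp m n f : (forall k, Cn k f) -> Cn m (flat n \o f).
Proof.
move=> Cf; have ccomp k : continuous (flat k \o f).
  move=> p; apply: continuous_comp; first exact: (Cn_continuous (Cf 0)).
  exact: continuous_flat.
elim: m n => [|m IHm] n; first exact: ccomp.
have [_ fx fz dfx dfz] := CnS_inv (Cf m.+1).
pose d := flat n.+2 \o f + (fun p => - n%:R * (flat n.+1 \o f) p).
have Cd : Cn m d by apply: Cn_add; [exact: IHm|apply: Cn_scale; exact: IHm].
apply: (@CnS _ m _ (d * 'D_ex f) (d * 'D_ez f)) => //; try exact: Cn_mul.
  move=> p; have -> : (d * 'D_ex f) p =
      (flat n.+2 (f p) - n%:R * flat n.+1 (f p)) * 'D_ex f p.
    by rewrite /d !fctE/= mulNr.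
  by apply: is_derive_comp_dir => //; exact: is_derive_flat.
move=> p; have -> : (d * 'D_ez f) p =
    (flat n.+2 (f p) - n%:R * flat n.+1 (f p)) * 'D_ez f p.
  by rewrite /d !fctE/= mulNr.
by apply: is_derive_comp_dir => //; exact: is_derive_flat.
Qed.

Lemma flat_lt1 t : flat 0 t <= 1.
Proof. by have := flat_le 0 t; rewrite fact0. Qed.

(** Since [flat 0] vanishes for t <= 0, the functions [flat 0 (k.+1%:R * l)] tend to the indicator
    of l > 0. The smooth approximations of indicators below come from this limit. *)
Lemma cvg_flat_pos t : 0 < t -> flat 0 (k.+1%:R * t) @[k --> \oo] --> (1 : R).
Proof.
move=> t0.
have -> : (fun k : nat => flat 0 (k.+1%:R * t)) =
    (fun k : nat => expR (- (k.+1%:R^-1 * t^-1))).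
  apply/funext => k; rewrite /flat mulr_gt0 ?ltr0n// expr0 mul1r.
  by rewrite invfM.
have H : - (harmonic k * t^-1) @[k --> \oo] --> - (0 * t^-1).
  by apply: cvgN; apply: cvgM; [exact: cvg_harmonic|exact: cvg_cst].
have := cvg_comp _ _ H (@continuous_expR R _).
by rewrite mul0r oppr0 expR0; exact.
Qed.

End Flat.

(** * Integration on the plane *)

Section PlaneMeasure.
Context {R : realType}.
Local Notation plane := (measurableTypeR R * measurableTypeR R)%type.
Implicit Types (p q h : R * R).

(** The sigma-algebra is the product one, so an open set is written as a countable union of squares
    with rational centre and radius. *)
Lemma open_measurable_plane (U : set (R * R)) : open U ->
  measurable (U : set plane).
Proof.
move=> oU.
pose B (t : rat * rat * rat) : set plane :=
  (ball (ratr t.1.1 : R) (ratr t.2)) `*` (ball (ratr t.1.2 : R) (ratr t.2)).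
have -> : U = \bigcup_(t in [set t | B t `<=` U]) B t.
  apply/seteqP; split => [p Up|p [t BU Bp]]; last exact: BU.
  have : nbhs p U by exact: open_nbhs_nbhs.
  move=> /nbhs_ballP[e /= e0 peU].
  have [r] := @rat_in_itvoo R 0 (e / 2) (divr_gt0 e0 (ltr0n R 2)).
  rewrite in_itv /= => /andP[r0 re].
  have Hc (x : R) : exists c : rat, `|x - ratr c| < ratr r.
    have [|c] := @rat_in_itvoo R (x - ratr r) (x + ratr r); first by lra.
    rewrite in_itv /= => /andP[c1 c2]; exists c; rewrite ltr_norml; lra.
  have [c1 Hc1] := Hc p.1; have [c2 Hc2] := Hc p.2.
  exists (c1, c2, r) => /=; last first.
    by split; rewrite /= /ball/= distrC.
  move=> q [/= q1 q2]; apply: peU; split => /=; rewrite /ball/=.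
    move: q1; rewrite /ball/= => q1; have := ler_distD (ratr c1 : R) p.1 q.1.
    lra.
  move: q2; rewrite /ball/= => q2; have := ler_distD (ratr c2 : R) p.2 q.2.
  lra.
rewrite bigcup_mkcond; apply: countable_bigcupT_measurable => // t.
case: ifP => _; last exact: measurable0.
apply: measurableX; apply: open_measurable; exact: ball_open.
Qed.

Lemma continuous_measurable_plane (f : R * R -> R) : continuous f ->
  measurable_fun [set: plane] (f : plane -> measurableTypeR R).
Proof.
move=> cf; apply: (measurability _ (RGenOpens.measurableE R)).
move=> _ [_ [a [b ->] <-]]; rewrite setTI; apply: open_measurable_plane.
by move/continuousP : cf; apply; exact: interval_open.
Qed.

Lemma measurable_affine (c b : R) :
  measurable_fun setT (fun x : measurableTypeR R => c * x + b : measurableTypeR R).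
Proof. by apply: measurable_funD => //; exact: measurable_funM. Qed.

(** Uniqueness of Lebesgue measure: [c] times the pushforward gives half-open intervals their
    length. *)
Lemma lebesgue_measure_affine (c b : R) (A : set (measurableTypeR R)) : 0 < c ->
  measurable A ->
  (c%:E * lebesgue_measure ((fun x : measurableTypeR R => (c * x + b)%R : measurableTypeR R) @^-1` A) =
   lebesgue_measure A)%E.
Proof.
move=> c0 mA.
pose k : {nonneg R} := NngNum (ltW c0).
pose m := pushforward (@lebesgue_measure R)
  (fun x : measurableTypeR R => c * x + b : measurableTypeR R).
pose m1 : {measure set (measurableTypeR R) -> \bar R} :=
  measure_function_pushforward__canonical__measure_function_Measure lebesgue_measure (measurable_affine c b).
have := @lebesgue_measure_unique R (mscale k m1) _ A mA.
move=> E; transitivity (mscale k m1 A); first by []. symmetry; apply: E.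
move=> _ [[x y] _ <-].
rewrite /= /mscale/= /pushforward.
have -> : (fun x : measurableTypeR R => c * x + b : measurableTypeR R) @^-1` `]x, y] =
    `](x - b) / c, (y - b) / c]%classic.
  apply/seteqP; split => z /=; rewrite !in_itv/= ltr_pdivrMr// ler_pdivlMr// ltrBlDr lerBrDr mulrC//.
rewrite !lebesgue_measure_itv/= !lte_fin ltr_pM2r ?invr_gt0// ltrD2r.
case: ifPn => xy; last by rewrite mule0.
by rewrite -!EFinB -EFinM; congr EFin; field; rewrite gt_eqF.
Qed.

End PlaneMeasure.

(** * Integrable and square-integrable functions on a measure space *)

Section SquareIntegrable.
Context {d : measure_display} {T : measurableType d} {R : realType}.
Variable mu : {measure set T -> \bar R}.
Implicit Types (f g : T -> R).

Definition L1 f : Prop := mu.-integrable setT (EFin \o f).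
Definition rint f : R := \int[mu]_(p in setT) f p.

Lemma L1_meas f : L1 f -> measurable_fun setT f.
Proof. by move=> /measurable_int/measurable_EFinP. Qed.

Lemma eq_L1 f g : f =1 g -> L1 f -> L1 g.
Proof. by move=> /funext ->. Qed.

Lemma eq_rint f g : f =1 g -> rint f = rint g.
Proof. by move=> /funext ->. Qed.

Lemma L1D f g : L1 f -> L1 g -> L1 (fun p => f p + g p).
Proof.
by move=> Lf Lg; have := integrableD measurableT Lf Lg; exact.
Qed.

Lemma L1Z (c : R) f : L1 f -> L1 (fun p => c * f p).
Proof.
by move=> Lf; have := integrableZl measurableT c Lf; exact.
Qed.

Lemma L1N f : L1 f -> L1 (fun p => - f p).
Proof. by move=> /(L1Z (-1)); apply: eq_L1 => p; rewrite mulN1r. Qed.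

Lemma L1B f g : L1 f -> L1 g -> L1 (fun p => f p - g p).
Proof. by move=> Lf /L1N; exact: L1D. Qed.

Lemma L10 : L1 (cst 0).
Proof. exact: (integrable0 mu setT). Qed.

Lemma L1_dom f g : measurable_fun setT f -> L1 g ->
  (forall p, `|f p| <= g p) -> L1 f.
Proof.
move=> mf Lg fg; apply: (le_integrable _ _ _ Lg) => //.
  exact/measurable_EFinP.
move=> p _ /=; rewrite lee_fin (le_trans (fg p))//; exact: ler_norm.
Qed.

Lemma L1_norm f : L1 f -> L1 (fun p => `|f p|).
Proof.
move=> Lf; have mf := L1_meas Lf.
apply: (le_integrable _ _ _ Lf) => //.
  by apply/measurable_EFinP; exact: measurableT_comp.
by move=> p _ /=; rewrite normr_id.
Qed.

Lemma rintD f g : L1 f -> L1 g -> rint (fun p => f p + g p) = rint f + rint g.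
Proof. by move=> Lf Lg; rewrite /rint RintegralD. Qed.

Lemma rintZ (c : R) f : L1 f -> rint (fun p => c * f p) = c * rint f.
Proof. by move=> Lf; rewrite /rint RintegralZl. Qed.

Lemma rintN f : L1 f -> rint (fun p => - f p) = - rint f.
Proof.
move=> Lf; rewrite -mulN1r -rintZ//.
by apply: eq_rint => p; rewrite mulN1r.
Qed.

Lemma rintB f g : L1 f -> L1 g -> rint (fun p => f p - g p) = rint f - rint g.
Proof. by move=> Lf Lg; rewrite rintD ?rintN//; exact: L1N. Qed.

Lemma rint_ge0 f : (forall p, 0 <= f p) -> 0 <= rint f.
Proof. by move=> f0; apply: Rintegral_ge0. Qed.

Lemma rint_le f g : L1 f -> L1 g -> (forall p, f p <= g p) -> rint f <= rint g.
Proof. by move=> Lf Lg fg; apply: le_Rintegral. Qed.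

Lemma rint_norm f : L1 f -> `|rint f| <= rint (fun p => `|f p|).
Proof. by move=> Lf; apply: le_normr_Rintegral. Qed.

Lemma L1_indic (A : set T) : measurable A -> (mu A < +oo)%E -> L1 \1_A.
Proof.
move=> mA finA; apply/integrableP; split.
  by apply/measurable_EFinP; exact: measurable_indic.
under eq_integral do rewrite /= ger0_norm ?indicE ?ler0n//.
rewrite (eq_integral (fun x => (\1_A x)%:E)); last first.
  by move=> x _; rewrite indicE.
by rewrite integral_indic// setIT.
Qed.

Definition L2 f := measurable_fun setT f /\ L1 (fun p => f p ^+ 2).
(** [fine] sends an infinite integral to 0, so the triangle and Cauchy-Schwarz inequalities ask for
    [L2]. *)
Definition nrm f : R := Num.sqrt (rint (fun p => f p ^+ 2)).

Lemma eq_L2 f g : f =1 g -> L2 f -> L2 g.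
Proof. by move=> /funext ->. Qed.

Lemma eq_nrm f g : f =1 g -> nrm f = nrm g.
Proof. by move=> /funext ->. Qed.

Lemma nrm_ge0 f : 0 <= nrm f.
Proof. exact: sqrtr_ge0. Qed.

Lemma nrm_sqr f : nrm f ^+ 2 = rint (fun p => f p ^+ 2).
Proof. by rewrite sqr_sqrtr// rint_ge0// => p; exact: sqr_ge0. Qed.

Lemma nrm_le f (c : R) : 0 <= c -> rint (fun p => f p ^+ 2) <= c ^+ 2 -> nrm f <= c.
Proof.
by move=> c0 H; rewrite -(ler_pXn2r (ltn0Sn 1)) ?nnegrE ?nrm_ge0// nrm_sqr.
Qed.

Lemma L2_dom f g : measurable_fun setT f -> L2 g ->
  (forall p, `|f p| <= `|g p|) -> L2 f.
Proof.
move=> mf [mg Lg] fg; split => //; apply: (L1_dom _ Lg).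
  exact: measurable_funX.
move=> p; rewrite normrX -[leRHS]real_normK ?num_real//.
by rewrite lerXn2r// ?nnegrE.
Qed.

Lemma L2_L1M f g : L2 f -> L2 g -> L1 (fun p => f p * g p).
Proof.
move=> [mf Lf] [mg Lg]; apply: (L1_dom _ (L1D Lf Lg)).
  exact: measurable_funM.
move=> p; rewrite normrM -(real_normK (num_real (f p))) -(real_normK (num_real (g p))).
have := sqr_ge0 (`|f p| - `|g p|).
have := mulr_ge0 (normr_ge0 (f p)) (normr_ge0 (g p)); nra.
Qed.

Lemma L2Z (c : R) f : L2 f -> L2 (fun p => c * f p).
Proof.
move=> [mf Lf]; split; first exact: measurable_funM.
by apply: eq_L1 (L1Z (c ^+ 2) Lf) => p; rewrite exprMn.
Qed.

Lemma L2N f : L2 f -> L2 (fun p => - f p).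
Proof. by move=> /(L2Z (-1)); apply: eq_L2 => p; rewrite mulN1r. Qed.

Lemma L2D f g : L2 f -> L2 g -> L2 (fun p => f p + g p).
Proof.
move=> Lf Lg; split; first by apply: measurable_funD; [case: Lf|case: Lg].
apply: eq_L1 (L1D (L1D Lf.2 Lg.2) (L1Z 2 (L2_L1M Lf Lg))) => p.
by ring.
Qed.

Lemma L2B f g : L2 f -> L2 g -> L2 (fun p => f p - g p).
Proof. by move=> Lf /L2N; exact: L2D. Qed.

Lemma L2_bddM (M : R) f g : measurable_fun setT g -> (forall p, `|g p| <= M) ->
  L2 f -> L2 (fun p => g p * f p).
Proof.
move=> mg gM Lf; apply: (L2_dom _ (L2Z M Lf)).
  by apply: measurable_funM => //; case: Lf.
by move=> p; rewrite !normrM ler_wpM2r// (le_trans (gM p))// ler_norm.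
Qed.

Lemma nrmZ (c : R) f : L2 f -> nrm (fun p => c * f p) = `|c| * nrm f.
Proof.
move=> [_ Lf]; rewrite /nrm (@eq_rint _ (fun p => c ^+ 2 * f p ^+ 2)).
  by rewrite rintZ// sqrtrM ?sqr_ge0// sqrtr_sqr.
by move=> p; rewrite exprMn.
Qed.

Lemma nrm_bddM (M : R) f g : measurable_fun setT g -> (forall p, `|g p| <= M) ->
  L2 f -> nrm (fun p => g p * f p) <= M * nrm f.
Proof.
move=> mg gM Lf.
have M0 (p : T) : 0 <= M by exact: le_trans (normr_ge0 _) (gM p).
(* [0 <= M] is read off from a value of [g]; on an empty type all functions coincide and both norms
   are 0. *)
have [[p _]|none] := pselect (exists p : T, True); last first.
  have H (k : T -> R) : nrm k = 0.
    have -> : nrm k = nrm (cst 0) by apply: eq_nrm => p; case: none; exists p.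
    rewrite /nrm (@eq_rint _ (fun p => 0 * cst 0 p)).
      by rewrite rintZ ?mul0r ?sqrtr0//; exact: L10.
    by move=> p /=; rewrite expr0n mul0r.
  by rewrite !H mulr0.
have {}M0 := M0 p.
apply: nrm_le; first by rewrite mulr_ge0// nrm_ge0.
rewrite exprMn nrm_sqr -rintZ; last by case: Lf.
apply: rint_le.
- by case: (L2_bddM mg gM Lf).
- by apply: L1Z; case: Lf.
- move=> q; rewrite exprMn ler_wpM2r ?sqr_ge0//.
  by rewrite -(real_normK (num_real (g q))) lerXn2r ?nnegrE.
Qed.

(** Discriminant argument: the quadratic polynomial in t given by the integral of (t f - g)^2 is
    nonnegative. *)
Lemma cauchy_schwarz f g : L2 f -> L2 g -> `|rint (fun p => f p * g p)| <= nrm f * nrm g.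
Proof.
move=> Lf Lg; set B := rint _.
have Lfg := L2_L1M Lf Lg.
have H (t : R) : 0 <= t ^+ 2 * nrm f ^+ 2 - 2 * t * B + nrm g ^+ 2.
  rewrite !nrm_sqr /B -!rintZ//; last by case: Lf.
  rewrite -rintB; [|by apply: L1Z; case: Lf|exact: L1Z].
  rewrite -rintD; [|apply: L1B; [by apply: L1Z; case: Lf|exact: L1Z]|by case: Lg].
  apply: rint_ge0 => p; apply: (le_trans (sqr_ge0 (t * f p - g p))).
  by rewrite le_eqVlt; apply/orP; left; apply/eqP; ring.
have nf := nrm_ge0 f; have ng := nrm_ge0 g.
rewrite -(ler_pXn2r (ltn0Sn 1)) ?nnegrE ?mulr_ge0// real_normK ?num_real//.
have [f0|f0] := eqVneq (nrm f) 0.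
  rewrite f0 mul0r expr0n/=; have [->|B0] := eqVneq B 0; first by rewrite expr0n.
  (* When [f] has norm 0 the polynomial is affine in t, and at this t its value is -1. *)
  have := H ((nrm g ^+ 2 + 1) / (2 * B)); rewrite f0 expr0n/= mulr0.
  have -> : 2 * ((nrm g ^+ 2 + 1) / (2 * B)) * B = nrm g ^+ 2 + 1 by field.
  lra.
(* The minimiser of the polynomial. *)
have := H (B / nrm f ^+ 2).
have -> : (B / nrm f ^+ 2) ^+ 2 * nrm f ^+ 2 - 2 * (B / nrm f ^+ 2) * B + nrm g ^+ 2 =
  ((nrm f * nrm g) ^+ 2 - B ^+ 2) / nrm f ^+ 2 by field.
by rewrite pmulr_lge0 ?subr_ge0// invr_gt0 exprn_gt0// lt_neqAle eq_sym f0.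
Qed.

Lemma nrmD f g : L2 f -> L2 g -> nrm (fun p => f p + g p) <= nrm f + nrm g.
Proof.
move=> Lf Lg; have := nrm_ge0 f; have := nrm_ge0 g => ng nf.
apply: nrm_le; first exact: addr_ge0.
have -> : rint (fun p => (f p + g p) ^+ 2) =
    nrm f ^+ 2 + nrm g ^+ 2 + 2 * rint (fun p => f p * g p).
  have LL := L2_L1M Lf Lg; have L1f := Lf.2; have L1g := Lg.2.
  rewrite !nrm_sqr -rintZ// -!rintD//; [|exact: L1D|exact: L1Z].
  by apply: eq_rint => p; ring.
have := cauchy_schwarz Lf Lg; have := ler_norm (rint (fun p => f p * g p)); nra.
Qed.

Lemma nrmB f g : L2 f -> L2 g -> nrm (fun p => f p - g p) <= nrm f + nrm g.
Proof.
move=> Lf Lg; apply: (le_trans (nrmD Lf (L2N Lg))).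
rewrite lerD2l le_eqVlt; apply/orP; left; apply/eqP.
by rewrite /nrm; congr Num.sqrt; apply: eq_rint => p; rewrite sqrrN.
Qed.

End SquareIntegrable.

(** * Dominated convergence for real integrals and L^2 norms *)

Section DominatedConvergence.
Context {d : measure_display} {T : measurableType d} {R : realType}.
Variable mu : {measure set T -> \bar R}.
Implicit Types (f g : T -> R).

Lemma rint_dominated_cvg (f_ : nat -> T -> R) f g :
  (forall k, measurable_fun setT (f_ k)) -> L1 mu g ->
  (forall k p, `|f_ k p| <= g p) -> (forall p, f_ k p @[k --> \oo] --> f p) ->
  L1 mu f /\ rint mu (f_ k) @[k --> \oo] --> rint mu f.
Proof.
move=> mf_ Lg fg cf.
have mf : measurable_fun setT f by exact: (measurable_fun_cvg mf_).
have fle p : `|f p| <= g p.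
  have c1 : `|f_ k p| @[k --> \oo] --> `|f p| by apply: cvg_norm; exact: cf.
  by apply: (ler_cvg_to c1 (@cvg_cst _ (g p) _ _ _)); near=> k; exact: fg.
have Lf : L1 mu f by exact: (L1_dom mf Lg fle).
split => //.
rewrite /rint /Rintegral; apply: fine_cvg; rewrite fineK; last first.
  exact: (integrable_fin_num measurableT Lf).
apply: (@dominated_cvg _ _ _ mu setT measurableT (fun k => EFin \o f_ k)
  (EFin \o f) (EFin \o g)) => //.
- by move=> k; apply/measurable_EFinP.
- by move=> p _; apply: cvg_EFin; [near=> k|exact: cf].
- by move=> k p _ /=; rewrite lee_fin.
Unshelve. all: by end_near. Qed.

Lemma nrm_cvg0 (f_ : nat -> T -> R) f g :
  (forall k, measurable_fun setT (f_ k)) -> measurable_fun setT f -> L1 mu g ->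
  (forall k p, (f_ k p - f p) ^+ 2 <= g p) ->
  (forall p, f_ k p @[k --> \oo] --> f p) ->
  nrm mu (fun p => f_ k p - f p) @[k --> \oo] --> 0.
Proof.
move=> mf_ mf Lg fg cf.
have mS k : measurable_fun setT (fun p => (f_ k p - f p) ^+ 2).
  by apply: measurable_funX; exact: measurable_funB.
have bS k p : `|(f_ k p - f p) ^+ 2| <= g p by rewrite ger0_norm ?sqr_ge0.
have cS p : (f_ k p - f p) ^+ 2 @[k --> \oo] --> (cst 0 p : R).
  have H : f_ k p - f p @[k --> \oo] --> f p - f p.
    by apply: cvgB; [exact: cf|exact: cvg_cst].
  by rewrite subrr in H; have := cvgM H H; rewrite mul0r; exact.
have [_] := rint_dominated_cvg mS Lg bS cS.
have -> : rint mu (cst 0) = 0 by rewrite /rint /Rintegral integral0.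
move=> H; rewrite -sqrtr0.
by apply: (cvg_comp _ _ H); exact: sqrt_continuous.
Qed.

Lemma cvg0_ex (u : nat -> R) e : u k @[k --> \oo] --> 0 -> 0 < e ->
  exists k, `|u k| <= e.
Proof.
move=> /cvgrPdist_le u0 e0; have [N _ HN] := u0 _ e0.
by exists N; have := HN N (leqnn N); rewrite /= sub0r normrN.
Qed.

End DominatedConvergence.

(** * Translation invariance on the plane *)

Section PlaneTranslation.
Context {R : realType}.
Local Notation plane := (measurableTypeR R * measurableTypeR R)%type.
Implicit Types (p q h : R * R).

Lemma lebesgue_measure_shift (b : R) (A : set (measurableTypeR R)) : measurable A ->
  lebesgue_measure ((fun x : measurableTypeR R => (x + b)%R : measurableTypeR R) @^-1` A) =
  lebesgue_measure A.
Proof.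
move=> mA; rewrite -(@lebesgue_measure_affine R 1 b A)// mul1e.
by congr lebesgue_measure; apply/seteqP; split => x /=; rewrite mul1r.
Qed.

Lemma measurable_shift h : measurable_fun [set: plane] (fun p : plane => (p + h : plane)).
Proof.
apply/measurable_fun_pairP; split.
  by apply: measurable_funD => //; exact: measurable_fst.
by apply: measurable_funD => //; exact: measurable_snd.
Qed.

(** A product measure is determined by its values on rectangles, where the one-dimensional
    invariance applies to each side. *)
Lemma leb2_shift h (A : set plane) : measurable A ->
  leb2 ((fun p : plane => (p + h : plane)) @^-1` A) = leb2 A.
Proof.
move=> mA.
pose m : {measure set plane -> \bar R} :=
  measure_function_pushforward__canonical__measure_function_Measure leb2 (measurable_shift h).
have E := @product_measure_unique _ _ _ _ R (@lebesgue_measure R) (@lebesgue_measure R) m.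
transitivity (m A); first by [].
symmetry; apply: E => // B C mB mC.
rewrite /m/= /pushforward.
have -> : (fun p : plane => (p + h : plane)) @^-1` (B `*` C) =
  ((fun x : measurableTypeR R => (x + h.1)%R : measurableTypeR R) @^-1` B) `*`
  ((fun x : measurableTypeR R => (x + h.2)%R : measurableTypeR R) @^-1` C) by [].
have mD (b : R) (D : set (measurableTypeR R)) : measurable D ->
    measurable ((fun x : measurableTypeR R => (x + b)%R : measurableTypeR R) @^-1` D).
  move=> mD; rewrite -[X in measurable X]setTI.
  have mf : measurable_fun setT (fun x : measurableTypeR R => (x + b)%R : measurableTypeR R).
    by apply: measurable_funD.
  exact: mf.
rewrite /leb2 product_measure1E; [|exact: mD|exact: mD].
by congr (_ * _)%E; exact: lebesgue_measure_shift.
Qed.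

Lemma ge0_integral_shift h (F : plane -> \bar R) : measurable_fun setT F ->
  (forall p, 0 <= F p)%E ->
  (\int[leb2]_p F (p + h)%R = \int[leb2]_p F p)%E.
Proof.
move=> mF F0.
have := @ge0_integral_pushforward _ _ _ _ R _ (measurable_shift h) leb2 setT F
  measurableT mF (fun p _ => F0 p).
rewrite preimage_setT => <-.
apply: (@eq_measure_integral _ _ _ _ leb2
  (measure_function_pushforward__canonical__measure_function_Measure leb2 (measurable_shift h))).
by move=> A mA _; exact: leb2_shift.
Qed.

Lemma L1_shift h (f : plane -> R) : L1 leb2 f -> L1 leb2 (fun p => f (p + h)).
Proof.
move=> Lf; have mf := L1_meas Lf; apply/integrableP; split.
  apply/measurable_EFinP; apply: (measurableT_comp mf); exact: measurable_shift.
rewrite (ge0_integral_shift h (F := fun p => `|(f p)%:E|%E))//.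
  by case/integrableP : Lf.
by do 2 apply: measurableT_comp => //.
Qed.

Lemma rint_shift h (f : plane -> R) : L1 leb2 f -> rint leb2 (fun p => f (p + h)) = rint leb2 f.
Proof.
move=> Lf; rewrite /rint /Rintegral; congr fine.
have mf := L1_meas Lf.
have := @integral_pushforward _ _ _ _ R _ (measurable_shift h) leb2 setT (EFin \o f)
  _ _ measurableT.
rewrite preimage_setT => <-.
- apply: (@eq_measure_integral _ _ _ _ leb2
    (measure_function_pushforward__canonical__measure_function_Measure leb2 (measurable_shift h))).
  by move=> A mA _; exact: leb2_shift.
- exact/measurable_EFinP.
- exact: L1_shift.
Qed.

Lemma L2_shift h (f : plane -> R) : L2 leb2 f -> L2 leb2 (fun p => f (p + h)).
Proof.
move=> [mf Lf]; split; last exact: (L1_shift h Lf).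
by apply: (measurableT_comp mf); exact: measurable_shift.
Qed.

Lemma nrm_shift h (f : plane -> R) : L2 leb2 f ->
  nrm leb2 (fun p => f (p + h)) = nrm leb2 f.
Proof. by move=> [mf Lf]; rewrite /nrm (rint_shift h Lf). Qed.

End PlaneTranslation.

(** * Induction over Borel sets and smooth approximation of indicators *)

Section PlaneSigmaAlgebra.
Context {R : realType}.
Local Notation plane := (measurableTypeR R * measurableTypeR R)%type.

(** The generators are half-planes instead of rectangles: as superlevel sets of [fst] and [snd] they
    allow base cases with explicit functions. Rectangles come back as intersections, which
    complements and countable unions provide. *)
Lemma plane_sigma_ind (C : set (set plane)) :
  C set0 -> (forall A, C A -> C (~` A)) ->
  (forall F : nat -> set plane, (forall i, C (F i)) -> C (\bigcup_i F i)) ->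
  (forall a : R, C [set p | a < p.1]) -> (forall a : R, C [set p | a < p.2]) ->
  forall A, measurable A -> C A.
Proof.
move=> C0 CC CU C1 C2; suff: (measurable : set (set plane)) `<=` C by exact.
have CI A B : C A -> C B -> C (A `&` B).
  move=> CA CB; rewrite -[_ `&` _]setCK setCI; apply: (CC).
  pose F i := if i is 0%N then ~` A else ~` B.
  have -> : ~` A `|` ~` B = \bigcup_i F i.
    apply/seteqP; split => [p [Ap|Bp]|p [[|i] _ Fp]].
    - by exists 0%N.
    - by exists 1%N.
    - by left.
    - by right.
  by apply: (CU) => -[|i]; exact: CC.
have key (l : R * R -> R) (B : set (measurableTypeR R)) :
    (forall a, C [set p | a < l p]) -> measurable B -> C (l @^-1` B).
  move=> Cl; suff: (measurable : set (set (measurableTypeR R))) `<=`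
    [set B | C (l @^-1` B)] by exact.
  apply: smallest_sub.
    split => /= [|D CD|F CF].
    - by rewrite preimage_set0.
    - by rewrite setTD preimage_setC; exact: CC.
    - by rewrite preimage_bigcup; exact: CU.
  move=> _ [[a b] _ <-] /=.
  rewrite (_ : _ @^-1` _ = [set p | a < l p] `&` ~` [set p | b < l p]).
    by apply: CI => //; exact: CC.
  apply/seteqP; split => p /=; rewrite in_itv/=.
    by move=> /andP[-> pb]; split => //; apply/negP; rewrite -leNgt.
  by move=> [-> /negP]; rewrite -leNgt => ->.
apply: smallest_sub.
  split => [|D CD|F CF] //; last exact: CU.
  by rewrite setTD; exact: CC.
move=> _ [[B mB <-]|[B mB <-]]; rewrite setTI.
  exact: (key fst).
exact: (key snd).
Qed.

Let mu := @leb2 R.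

Definition smooth01 (f : R * R -> R) :=
  (forall n, Cn n f) /\ (forall p, 0 <= f p <= 1).

Lemma smooth_measurable (f : plane -> R) : (forall n, Cn n f) -> measurable_fun setT f.
Proof. by move=> Cf; apply: continuous_measurable_plane; exact: (Cn_continuous (Cf 0)). Qed.

Lemma smooth01_compl f : smooth01 f -> smooth01 (fun p => 1 - f p).
Proof.
move=> [Cf f01]; split => [n|p]; last by have := f01 p; lra.
have -> : (fun p => 1 - f p) = cst 1 + (fun p => -1 * f p).
  by apply/funext => p; rewrite fctE/= mulN1r.
apply: Cn_add; [exact: Cn_cst|exact: Cn_scale].
Qed.

Lemma smooth01_mul f g : smooth01 f -> smooth01 g -> smooth01 (fun p => f p * g p).
Proof.
move=> [Cf f01] [Cg g01]; split => [n|p]; first exact: (Cn_mul (Cf n) (Cg n)).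
have := f01 p; have := g01 p; move=> /andP[g0 g1] /andP[f0 f1].
by rewrite mulr_ge0//= mulr_ile1.
Qed.

Lemma smooth01_flat f : (forall n, Cn n f) -> smooth01 (flat 0 \o f).
Proof.
move=> Cf; split => [n|p]; first exact: Cn_flat_comp.
by rewrite /= flat_ge0 flat_lt1.
Qed.

Variable Q : set plane.
Hypothesis mQ : measurable Q.
Hypothesis finQ : (mu Q < +oo)%E.

(** Closeness is measured on a set [Q] of finite measure, where indicators are square integrable;
    values in [0, 1] keep products under control. Compact support is arranged later, by
    [boxbump]. *)
Definition approximable (A : set plane) := measurable A /\
  forall e, 0 < e -> exists2 f, smooth01 f &
    nrm mu (fun p => \1_Q p * (\1_A p - f p)) <= e.

Lemma L1_indicQ : L1 mu \1_Q.
Proof. exact: L1_indic. Qed.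

Lemma mfQ : measurable_fun setT (\1_Q : plane -> R).
Proof. exact: measurable_indic. Qed.

Lemma indic01 (A : set plane) p : 0 <= (\1_A p : R) <= 1.
Proof. by rewrite indicE; case: (_ \in _); rewrite ?lexx ?ler01. Qed.

Lemma L2_Q (f : plane -> R) : measurable_fun setT f -> (forall p, `|f p| <= 1) ->
  L2 mu (fun p => \1_Q p * f p).
Proof.
move=> mf f1; split; first by apply: measurable_funM => //; exact: mfQ.
apply: (L1_dom _ L1_indicQ).
  by apply: measurable_funX; apply: measurable_funM => //; exact: mfQ.
move=> p; rewrite exprMn normrM indicE; case: (_ \in _); last by rewrite expr0n normr0 mul0r.
by rewrite expr1n normr1 mul1r normrX expr_le1.
Qed.

Lemma approximable_lt (l : R * R -> R) (a : R) : (forall n, Cn n l) ->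
  approximable [set p | a < l p].
Proof.
move=> Cl.
have mA : measurable ([set p | a < l p] : set plane).
  apply: open_measurable_plane; rewrite -[X in open X]/(l @^-1` [set x | a < x]).
  apply: open_comp; last exact: open_gt.
  by move=> p _; exact: (Cn_continuous (Cl 0)).
split => // e e0.
pose f_ (k : nat) := flat 0 \o (fun p => k.+1%:R * (l p - a)).
have sf k : smooth01 (f_ k).
  apply: smooth01_flat => n; apply: Cn_scale.
  have -> : (fun p => l p - a) = l + cst (- a) by [].
  by apply: Cn_add => //; exact: Cn_cst.
have mf k : measurable_fun setT (f_ k : plane -> R).
  by apply: smooth_measurable; case: (sf k).
have c0 : nrm mu (fun p => \1_Q p * f_ k p - \1_Q p * \1_[set p | a < l p] p) @[k --> \oo] --> 0.
  apply: (nrm_cvg0 _ _ L1_indicQ).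
  - by move=> k; apply: measurable_funM => //; exact: mfQ.
  - by apply: measurable_funM; [exact: mfQ|exact: measurable_indic].
  - move=> k p; rewrite -mulrBr exprMn [in X in X * _]indicE [leRHS]indicE.
    case: (_ \in Q); last by rewrite expr0n mul0r.
    rewrite expr1n mul1r; have := (sf k).2 p; have := indic01 [set p | a < l p] p.
    move=> /andP[i0 i1] /andP[f0 f1].
    by rewrite -real_normK ?num_real// expr_le1// ler_norml; apply/andP; split; lra.
  - move=> p; apply: cvgM; first exact: cvg_cst.
    rewrite indicE; have [apl|lpa] := ltP a (l p).
      by rewrite mem_set//; apply: cvg_flat_pos; rewrite subr_gt0.
    rewrite memNset/=; last by apply/negP; rewrite -leNgt.
    rewrite (_ : (fun k => _) = cst 0); first exact: cvg_cst.
    apply/funext => k; rewrite /f_/= flat0//.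
    by rewrite pmulr_rle0 ?ltr0n// subr_le0.
have [k Hk] := cvg0_ex c0 e0.
exists (f_ k) => //; apply: le_trans Hk; rewrite ger0_norm ?nrm_ge0//.
rewrite le_eqVlt; apply/orP; left; apply/eqP.
by rewrite /nrm; congr Num.sqrt; apply: eq_rint => p; ring.
Qed.

Lemma approximableC A : approximable A -> approximable (~` A).
Proof.
move=> [mA HA]; split; first exact: measurableC.
move=> e e0; have [f sf fe] := HA e e0; exists (fun p => 1 - f p).
  exact: smooth01_compl.
apply: le_trans fe; rewrite le_eqVlt; apply/orP; left; apply/eqP.
rewrite /nrm; congr Num.sqrt; apply: eq_rint => p; rewrite !indicE in_setC.
by case: (p \in A) => /=; ring.
Qed.

(** The approximation 1 - (1 - f)(1 - g) has the error (1 - 1_B)(1_A - f) + (1 - f)(1_B - g), and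
    both prefactors are at most 1. *)
Lemma approximableU A B : approximable A -> approximable B -> approximable (A `|` B).
Proof.
move=> [mA HA] [mB HB]; split; first exact: measurableU.
move=> e e0; have e20 : 0 < e / 2 by rewrite divr_gt0.
have [f sf fe] := HA _ e20; have [g sg ge] := HB _ e20.
have sh := smooth01_compl (smooth01_mul (smooth01_compl sf) (smooth01_compl sg)).
eexists; first exact: sh.
have mf : measurable_fun setT (f : plane -> R) by apply: smooth_measurable; case: sf.
have mg : measurable_fun setT (g : plane -> R) by apply: smooth_measurable; case: sg.
have dif01 (x y : R) : 0 <= x <= 1 -> 0 <= y <= 1 -> `|x - y| <= 1.
  by move=> /andP[? ?] /andP[? ?]; rewrite ler_norml; apply/andP; split; lra.
have LA : L2 mu (fun p => \1_Q p * (\1_A p - f p)).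
  apply: L2_Q; first by apply: measurable_funB => //; exact: measurable_indic.
  by move=> p; apply: dif01; [exact: indic01|exact: sf.2].
have LB : L2 mu (fun p => \1_Q p * (\1_B p - g p)).
  apply: L2_Q; first by apply: measurable_funB => //; exact: measurable_indic.
  by move=> p; apply: dif01; [exact: indic01|exact: sg.2].
have mcA : measurable_fun setT (fun p : plane => 1 - \1_B p : R).
  by apply: measurable_funB => //; exact: measurable_indic.
have mcf : measurable_fun setT (fun p : plane => 1 - f p : R).
  by apply: measurable_funB.
have cA1 p : `|1 - \1_B p : R| <= 1.
  by have := indic01 B p => /andP[? ?]; rewrite ler_norml; apply/andP; split; lra.
have cf1 p : `|1 - f p : R| <= 1.
  by have := sf.2 p => /andP[? ?]; rewrite ler_norml; apply/andP; split; lra.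
have := nrmD (L2_bddM mcA cA1 LA) (L2_bddM mcf cf1 LB).
have := nrm_bddM mcA cA1 LA; have := nrm_bddM mcf cf1 LB; rewrite !mul1r => H1 H2 H3.
have -> : e = e / 2 + e / 2 by field.
apply: (le_trans _ (le_trans H3 (lerD (le_trans H2 fe) (le_trans H1 ge)))).
rewrite le_eqVlt; apply/orP; left; apply/eqP.
rewrite /nrm; congr Num.sqrt; apply: eq_rint => p; rewrite !indicE in_setU.
by case: (p \in A); case: (p \in B) => /=; ring.
Qed.

(** Finite unions converge to the countable one in L^2 of [Q], dominated by [\1_Q]; half of the
    error pays for stopping at a finite union. *)
Lemma approximable_bigcup (F : nat -> set plane) :
  (forall i, approximable (F i)) -> approximable (\bigcup_i F i).
Proof.
move=> HF; have mU : measurable (\bigcup_i F i).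
  by apply: bigcupT_measurable => i; case: (HF i).
split => // e e0; have e20 : 0 < e / 2 by rewrite divr_gt0.
pose G n := \big[setU/set0]_(i < n.+1) F i.
have HG n : approximable (G n).
  rewrite /G; elim: n => [|n IHn]; first by rewrite big_ord_recr/= big_ord0 set0U.
  by rewrite big_ord_recr/=; exact: approximableU.
have c0 : nrm mu (fun p => \1_Q p * \1_(G k) p - \1_Q p * \1_(\bigcup_i F i) p) @[k --> \oo] --> 0.
  apply: (nrm_cvg0 _ _ L1_indicQ).
  - move=> k; apply: measurable_funM; first exact: mfQ.
    by apply: measurable_indic; case: (HG k).
  - by apply: measurable_funM; [exact: mfQ|exact: measurable_indic].
  - move=> k p; rewrite -mulrBr exprMn [in X in X * _]indicE [leRHS]indicE.
    case: (_ \in Q); last by rewrite expr0n mul0r.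
    rewrite expr1n mul1r; have := indic01 (G k) p; have := indic01 (\bigcup_i F i) p.
    move=> /andP[i0 i1] /andP[f0 f1].
    by rewrite -real_normK ?num_real// expr_le1// ler_norml; apply/andP; split; lra.
  - move=> p; apply: cvgM; first exact: cvg_cst.
    have [[i _ Fip]|nU] := pselect ((\bigcup_i F i) p).
      apply: cvg_near_cst; exists i => // k /= ik.
      rewrite !indicE !mem_set//; first by exists i.
      rewrite /G -bigcup_mkord; exists i => //=; rewrite ltnS.
    rewrite (_ : (fun k => _) = cst (\1_(\bigcup_i F i) p)); first exact: cvg_cst.
    apply/funext => k; rewrite /= !indicE !memNset// => Gp; apply: nU.
    exact: (bigsetU_bigcup Gp).
have [k Hk] := cvg0_ex c0 e20.
rewrite ger0_norm ?nrm_ge0// in Hk.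
have [f sf fe] := (HG k).2 _ e20; exists f => //.
have mf : measurable_fun setT (f : plane -> R) by apply: smooth_measurable; case: sf.
have LA : L2 mu (fun p => \1_Q p * (\1_(G k) p - f p)).
  apply: L2_Q; first by apply: measurable_funB => //; apply: measurable_indic; case: (HG k).
  move=> p; have := indic01 (G k) p; have := sf.2 p.
  by move=> /andP[? ?] /andP[? ?]; rewrite ler_norml; apply/andP; split; lra.
have LB : L2 mu (fun p => \1_Q p * (\1_(G k) p - \1_(\bigcup_i F i) p)).
  apply: L2_Q.
    apply: measurable_funB; apply: measurable_indic => //; by case: (HG k).
  move=> p; have := indic01 (G k) p; have := indic01 (\bigcup_i F i) p.
  by move=> /andP[? ?] /andP[? ?]; rewrite ler_norml; apply/andP; split; lra.
have -> : e = e / 2 + e / 2 by field.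
apply: le_trans (le_trans (nrmB LA LB) (lerD fe _)).
  rewrite le_eqVlt; apply/orP; left; apply/eqP.
  by rewrite /nrm; congr Num.sqrt; apply: eq_rint => p; ring.
apply: le_trans Hk; rewrite le_eqVlt; apply/orP; left; apply/eqP.
by rewrite /nrm; congr Num.sqrt; apply: eq_rint => p; ring.
Qed.

Lemma measurable_approximable A : measurable A -> approximable A.
Proof.
apply: plane_sigma_ind.
- split; first exact: measurable0.
  move=> e e0; exists (cst 0).
    by split => [n|p]; [exact: Cn_cst|rewrite /= lexx ler01].
  apply: nrm_le; first exact: ltW.
  rewrite (@eq_rint _ _ _ _ _ (cst 0)); last first.
    move=> p; have -> : \1_(set0 : set plane) p = 0 :> R by rewrite indicE memNset.
    by rewrite /= subrr mulr0 expr0n.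
  by rewrite /rint /Rintegral integral0 sqr_ge0.
- exact: approximableC.
- exact: approximable_bigcup.
- by move=> a; apply: approximable_lt; exact: Cn_fst.
- by move=> a; apply: approximable_lt; exact: Cn_snd.
Qed.

End PlaneSigmaAlgebra.

(** * Test functions *)

Section TestFunctions.
Context {R : realType}.
Local Notation plane := (measurableTypeR R * measurableTypeR R)%type.
Implicit Types (Om : set (R * R)) (f g phi psi : R * R -> R) (p q h : R * R).

Definition smooth f := forall n, Cn n f.

Lemma test_smooth Om phi : test_function Om phi -> smooth phi.
Proof. by case. Qed.

Lemma smooth_D e f : e = ex \/ e = ez -> smooth f -> smooth ('D_e f).
Proof. by move=> [->|->] sf n; case: (CnS_inv (sf n.+1)). Qed.

Lemma smooth_is_derive e f p : e = ex \/ e = ez -> smooth f ->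
  is_derive p e f ('D_e f p).
Proof. by move=> [->|->] sf; case: (CnS_inv (sf 1%N)). Qed.

Lemma smooth_continuous f : smooth f -> continuous f.
Proof. by move=> sf; exact: (Cn_continuous (sf 0%N)). Qed.

Lemma compact_bound (K : set (R * R)) f : compact K -> continuous f ->
  exists2 M : R, 0 <= M & forall p, K p -> `|f p| <= M.
Proof.
move=> cK cf.
have [K0|/set0P[p0 Kp0]] := eqVneq K set0.
  by exists 0 => // p; rewrite K0.
have [c _ Hc] : exists2 c, c \in K & forall t, t \in K -> `|f t| <= `|f c|.
  apply: (@compact_EVT_max _ _ (fun p => `|f p|)) => //.
  + by exists p0.
  + apply: continuous_subspaceT => p; apply: cvg_norm; exact: cf.
by exists `|f c| => // p Kp; apply: Hc; rewrite inE.
Qed.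

Lemma test_bound Om phi : test_function Om phi ->
  exists2 M : R, 0 <= M & forall p, `|phi p| <= M.
Proof.
move=> [sphi [K [cK _] K0]].
have [M M0 HM] := compact_bound cK (smooth_continuous sphi).
exists M => // p; have [/HM//|/K0 ->] := pselect (K p); by rewrite normr0.
Qed.

(** The same compact set serves: its complement is open, so [phi] is 0 near each point of the
    complement. *)
Lemma test_D Om e phi : e = ex \/ e = ez -> test_function Om phi ->
  test_function Om ('D_e phi).
Proof.
move=> he [sphi [K [cK KO] K0]]; split; first exact: smooth_D.
exists K => // p nKp.
have oKc : open (~` K).
  by apply: closed_openC; apply: compact_closed => //; exact: norm_hausdorff.
have Kp : nbhs p (~` K) by exact: open_nbhs_nbhs.
have H : is_derive p e phi 0.
  apply: (@near_eq_is_derive _ _ _ (cst 0)).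
  by near=> q => /=; rewrite K0//; near: q.
by case: H.
Unshelve. all: by end_near. Qed.

Lemma test_mul Om phi f : test_function Om phi -> smooth f ->
  test_function Om (fun p => phi p * f p).
Proof.
move=> [sphi [K [cK KO] K0]] sf; split.
  by move=> n; exact: (Cn_mul (sphi n) (sf n)).
by exists K => // p /K0 ->; rewrite mul0r.
Qed.

Lemma test_scale Om (c : R) phi : test_function Om phi ->
  test_function Om (fun p => c * phi p).
Proof.
move=> tphi; have := test_mul tphi (fun n => Cn_cst n c).
by congr test_function; apply/funext => p /=; rewrite mulrC.
Qed.

Lemma test_add Om phi psi : test_function Om phi -> test_function Om psi ->
  test_function Om (fun p => phi p + psi p).
Proof.
move=> [sphi [K [cK KO] K0]] [spsi [L [cL LO] L0]]; split.
  by move=> n; exact: (Cn_add (sphi n) (spsi n)).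
exists (K `|` L).
  by split; [exact: compactU|move=> p [/KO|/LO]].
by move=> p /not_orP[/K0 -> /L0 ->]; rewrite addr0.
Qed.

Lemma test_0 Om : test_function Om (cst 0).
Proof.
split; first by move=> n; exact: Cn_cst.
by exists set0 => //; split => //; exact: compact0.
Qed.

Lemma test_sub_dom Om Om' phi : Om `<=` Om' -> test_function Om phi ->
  test_function Om' phi.
Proof.
move=> OO [sphi [K [cK KO] K0]]; split => //; exists K => //.
by split => // p /KO /OO.
Qed.

Lemma test_shift Om Om' phi h : (forall p, Om p -> Om' (p - h)) ->
  test_function Om phi -> test_function Om' (fun p => phi (p + h)).
Proof.
move=> OO [sphi [K [cK KO] K0]]; split; first by move=> n; exact: Cn_shift.
exists ((fun p => p - h) @` K).
  split; last by move=> _ [p /KO Op <-]; exact: OO.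
  apply: continuous_compact => //; apply: continuous_subspaceT => p.
  by apply: cvgB; [exact: cvg_id|exact: cvg_cst].
move=> p nK; apply: K0 => Kp; apply: nK; exists (p + h) => //.
by rewrite addrK.
Qed.

Lemma test_measurable Om phi : test_function Om phi ->
  measurable_fun setT (phi : plane -> R).
Proof. by move=> [sphi _]; exact: smooth_measurable. Qed.

(** The open ball of the max norm, written as a rectangle so that its measure is a product. *)
Definition box (r : R) : set plane := ball (0 : R) r `*` ball (0 : R) r.

Lemma measurable_box r : measurable (box r).
Proof. by apply: measurableX; apply: open_measurable; exact: ball_open. Qed.

Lemma box_fin r : (leb2 (box r) < +oo)%E.
Proof.
have mb : measurable (ball (0 : R) r : set (measurableTypeR R)).
  by apply: open_measurable; exact: ball_open.
have -> : leb2 (box r) = (lebesgue_measure (ball 0%R r) *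
    lebesgue_measure (ball 0%R r))%E by exact: product_measure1E.
have fin : (lebesgue_measure (ball (0%R : R) r) < +oo)%E.
  rewrite ball_itv lebesgue_measure_itv; case: ifP => _; last exact: ltry.
  by rewrite -EFinB ltry.
by rewrite lte_mul_pinfty// ge0_fin_numE.
Qed.

Lemma compact_box (K : set (R * R)) : compact K -> exists2 r : R, 0 < r & K `<=` box r.
Proof.
move=> cK.
have [M M0 HM] := compact_bound cK (smooth_continuous (fun n => Cn_fst n)).
have [N N0 HN] := compact_bound cK (smooth_continuous (fun n => Cn_snd n)).
exists (M + N + 1) => [|p Kp]; first lra.
have := HM p Kp; have := HN p Kp.
by split; rewrite /ball/= sub0r normrN; lra.
Qed.

Lemma bounded_L1 (f : plane -> R) (M r : R) : measurable_fun setT f ->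
  (forall p, `|f p| <= M) -> (forall p, ~ box r p -> f p = 0) -> L1 leb2 f.
Proof.
move=> mf fM f0.
apply: (@L1_dom _ plane R leb2 f (fun p : plane => M * \1_(box r) p)) => //.
  by apply: L1Z; apply: L1_indic; [exact: measurable_box|exact: box_fin].
move=> p; rewrite indicE; have [bp|nbp] := pselect (box r p).
  by rewrite mem_set// mulr1.
by rewrite memNset//= mulr0 f0// normr0.
Qed.

Lemma test_L2 Om phi : test_function Om phi -> L2 leb2 phi.
Proof.
move=> tphi; have mphi := test_measurable tphi; split => //.
have [M M0 HM] := test_bound tphi.
case: tphi => _ [K [cK _] K0]; have [r r0 Kr] := compact_box cK.
apply: (@bounded_L1 _ (M ^+ 2) r).
- exact: measurable_funX.
- by move=> p; rewrite normrX lerXn2r// nnegrE.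
- by move=> p nb; rewrite K0 ?expr0n// => /Kr.
Qed.

Lemma test_L1 Om phi : test_function Om phi -> L1 leb2 phi.
Proof.
move=> tphi; have mphi := test_measurable tphi.
have [M M0 HM] := test_bound tphi.
case: tphi => _ [K [cK _] K0]; have [r r0 Kr] := compact_box cK.
by apply: (@bounded_L1 _ M r) => // p nb; rewrite K0// => /Kr.
Qed.

Lemma smooth_opp_shift f (c : R) : smooth f -> smooth (fun p => c - f p).
Proof.
move=> sf n; have -> : (fun p => c - f p) = cst c + (fun p => -1 * f p).
  by apply/funext => p; rewrite fctE/= mulN1r.
by apply: Cn_add; [exact: Cn_cst|exact: Cn_scale].
Qed.

(** Smooth and positive exactly on [box r]; a larger [k] brings it closer to the indicator of the
    box. *)
Definition boxbump (r : R) (k : nat) (p : R * R) : R :=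
  flat 0 (k.+1%:R * (r ^+ 2 - p.1 * p.1)) * flat 0 (k.+1%:R * (r ^+ 2 - p.2 * p.2)).

Lemma boxE (r : R) p : 0 < r -> box r p <-> p.1 * p.1 < r ^+ 2 /\ p.2 * p.2 < r ^+ 2.
Proof.
move=> r0; have H (x : R) : ball (0 : R) r x <-> x * x < r ^+ 2.
  rewrite /ball/= sub0r normrN -expr2 -(real_normK (num_real x)).
  by rewrite ltr_pXn2r// ?nnegrE// ltW.
by split=> [[/H ? /H]|[/H ? /H]].
Qed.

Lemma boxbump_smooth r k : smooth (boxbump r k).
Proof.
move=> n; apply: (@Cn_mul _ n (fun p => _) (fun p => _)).
  apply: (@Cn_flat_comp R n 0 (fun p => k.+1%:R * (r ^+ 2 - p.1 * p.1))) => m.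
  apply: Cn_scale; apply: smooth_opp_shift => l.
  exact: (Cn_mul (Cn_fst l) (Cn_fst l)).
apply: (@Cn_flat_comp R n 0 (fun p => k.+1%:R * (r ^+ 2 - p.2 * p.2))) => m.
apply: Cn_scale; apply: smooth_opp_shift => l.
exact: (Cn_mul (Cn_snd l) (Cn_snd l)).
Qed.

Lemma boxbump01 r k p : 0 <= boxbump r k p <= 1.
Proof. by rewrite mulr_ge0 ?flat_ge0//= mulr_ile1 ?flat_ge0 ?flat_lt1. Qed.

Lemma boxbump0 r k p : 0 < r -> ~ box r p -> boxbump r k p = 0.
Proof.
move=> r0; rewrite boxE// => /not_andP[/negP|/negP]; rewrite -leNgt => H;
  rewrite /boxbump.
  by rewrite flat0 ?mul0r// pmulr_rle0 ?ltr0n// subr_le0.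
by rewrite [X in _ * X]flat0 ?mulr0// pmulr_rle0 ?ltr0n// subr_le0.
Qed.

Lemma boxbump_test r k : 0 < r -> test_function setT (boxbump r k).
Proof.
move=> r0; split; first exact: boxbump_smooth.
exists (`[- r, r] `*` `[- r, r]).
  by split => //; apply: compact_setX; exact: segment_compact.
move=> p nK; apply: boxbump0 => //; apply: contra_not nK => -[].
rewrite /ball/= !sub0r !normrN => /ltr_normlP[a b] /ltr_normlP[c d'].
by split => /=; rewrite in_itv/=; apply/andP; split; lra.
Qed.

Lemma boxbump_cvg r p : 0 < r -> boxbump r k p @[k --> \oo] --> (\1_(box r) p : R).
Proof.
move=> r0; rewrite indicE; have [bp|nbp] := pselect (box r p).
  rewrite mem_set//= -[X in _ --> X]mulr1.
  have [p1 p2] := (boxE p r0).1 bp.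
  by apply: cvgM; apply: cvg_flat_pos; rewrite subr_gt0.
rewrite memNset//= (_ : (fun k => _) = cst 0); first exact: cvg_cst.
by apply/funext => k; rewrite boxbump0.
Qed.

End TestFunctions.

(** * Density and translations in L^2 *)

Section Density.
Context {R : realType}.
Local Notation plane := (measurableTypeR R * measurableTypeR R)%type.
Local Notation mu := (@leb2 R).
Implicit Types (f g : plane -> R) (p q h : R * R).

Definition test_dense f := forall e : R, 0 < e ->
  exists2 psi, test_function setT psi & nrm mu (fun p => f p - psi p) <= e.

Lemma test_dense_test psi : test_function setT psi -> test_dense psi.
Proof.
move=> tpsi e e0; exists psi => //; apply: nrm_le; first exact: ltW.
rewrite (@eq_rint _ _ _ _ _ (cst 0)); last by move=> p; rewrite subrr expr0n.
by rewrite /rint /Rintegral integral0 sqr_ge0.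
Qed.

Lemma test_dense_close f : L2 mu f -> (forall e : R, 0 < e -> exists g,
  [/\ L2 mu g, test_dense g & nrm mu (fun p => f p - g p) <= e]) -> test_dense f.
Proof.
move=> Lf H e e0; have e20 : 0 < e / 2 by rewrite divr_gt0.
have [g [Lg dg fg]] := H _ e20; have [psi tpsi gpsi] := dg _ e20.
exists psi => //.
have -> : e = e / 2 + e / 2 by field.
apply: le_trans (le_trans (nrmD (L2B Lf Lg) (L2B Lg (test_L2 tpsi))) (lerD fg gpsi)).
rewrite le_eqVlt; apply/orP; left; apply/eqP; apply: eq_nrm => p.
by rewrite addrA subrK.
Qed.

Lemma nrm_sub_sym f g : nrm mu (fun p => f p - g p) = nrm mu (fun p => g p - f p).
Proof.
by rewrite /nrm; congr Num.sqrt; apply: eq_rint => p; rewrite -sqrrN opprB.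
Qed.

Lemma test_dense_cvg (f_ : nat -> plane -> R) f : L2 mu f ->
  (forall k, L2 mu (f_ k)) -> (forall k, test_dense (f_ k)) ->
  nrm mu (fun p => f_ k p - f p) @[k --> \oo] --> 0 -> test_dense f.
Proof.
move=> Lf Lf_ df c0; apply: test_dense_close => // e e0.
have [k Hk] := cvg0_ex c0 e0; exists (f_ k); split => //.
by rewrite nrm_sub_sym; rewrite ger0_norm ?nrm_ge0 in Hk.
Qed.

Lemma test_denseD f g : L2 mu f -> L2 mu g -> test_dense f -> test_dense g ->
  test_dense (fun p => f p + g p).
Proof.
move=> Lf Lg df dg e e0; have e20 : 0 < e / 2 by rewrite divr_gt0.
have [phi tphi fphi] := df _ e20; have [psi tpsi gpsi] := dg _ e20.
exists (fun p => phi p + psi p); first exact: test_add.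
have -> : e = e / 2 + e / 2 by field.
apply: le_trans (le_trans (nrmD (L2B Lf (test_L2 tphi)) (L2B Lg (test_L2 tpsi)))
   (lerD fphi gpsi)).
rewrite le_eqVlt; apply/orP; left; apply/eqP; apply: eq_nrm => p; ring.
Qed.

Lemma test_denseZ (c : R) f : L2 mu f -> test_dense f -> test_dense (fun p => c * f p).
Proof.
move=> Lf df e e0; have c1 : 0 < `|c| + 1 by rewrite ltr_wpDl.
have [phi tphi fphi] := df _ (divr_gt0 e0 c1).
exists (fun p => c * phi p); first exact: test_scale.
have -> : nrm mu (fun p => c * f p - c * phi p) = nrm mu (fun p => c * (f p - phi p)).
  by apply: eq_nrm => p; rewrite mulrBr.
rewrite nrmZ; last exact: (L2B Lf (test_L2 tphi)).
apply: (@le_trans _ _ ((`|c| + 1) * (e / (`|c| + 1)))).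
  by apply: ler_pM => //; [exact: nrm_ge0|rewrite lerDl].
by rewrite mulrC divfK// gt_eqF.
Qed.

Lemma L2_indic_box r (A : set plane) : measurable A ->
  L2 mu (fun p => \1_(box r) p * \1_A p).
Proof.
move=> mA; apply: L2_Q; [exact: measurable_box|exact: box_fin|exact: measurable_indic|].
by move=> p; have /andP[? ?] := indic01 A p; rewrite ger0_norm.
Qed.

(** Two approximations in a row: the indicator by a smooth [phi] on the box, then the sharp cutoff
    to the box by [boxbump], which gives compact support. *)
Lemma test_dense_indic r (A : set plane) : 0 < r -> measurable A ->
  test_dense (fun p => \1_(box r) p * \1_A p).
Proof.
move=> r0 mA; have LA := L2_indic_box r mA.
apply: test_dense_close => // e e0.
have [_ /(_ e e0)[phi [sphi phi01] He]] :=
  measurable_approximable (measurable_box r) (box_fin r) mA.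
have mphi : measurable_fun setT (phi : plane -> R) by exact: smooth_measurable.
have phi1 p : `|phi p| <= 1.
  by have /andP[? ?] := phi01 p; rewrite ger0_norm.
have Lphi : L2 mu (fun p => \1_(box r) p * phi p).
  by apply: L2_Q => //; [exact: measurable_box|exact: box_fin].
exists (fun p => \1_(box r) p * phi p); split => //; last first.
  apply: le_trans He; rewrite le_eqVlt; apply/orP; left; apply/eqP.
  by apply: eq_nrm => p; rewrite mulrBr.
have tk k : test_function setT (fun p => boxbump r k p * phi p).
  by apply: test_mul => //; exact: boxbump_test.
apply: (@test_dense_cvg (fun k p => boxbump r k p * phi p)) => //.
- by move=> k; exact: test_L2 (tk k).
- by move=> k; exact: test_dense_test.
apply: (nrm_cvg0 _ _ (L1_indicQ (measurable_box r) (box_fin r))).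
- by move=> k; exact: test_measurable (tk k).
- by case: Lphi.
- move=> k p; rewrite -mulrBl exprMn indicE; have [bp|nbp] := pselect (box r p).
    rewrite mem_set//= -exprMn -real_normK ?num_real// expr_le1// normrM.
    rewrite mulr_ile1//; have /andP[? ?] := boxbump01 r k p.
    by rewrite ler_norml; apply/andP; split; lra.
  by rewrite memNset//= boxbump0// subrr expr0n mul0r.
- by move=> p; apply: cvgM; [exact: boxbump_cvg|exact: cvg_cst].
Qed.

Lemma test_dense_sum r (s : seq R) (A : R -> set plane) : 0 < r ->
  (forall y, measurable (A y)) ->
  L2 mu (fun p => \sum_(y <- s) y * (\1_(box r) p * \1_(A y) p)) /\
  test_dense (fun p => \sum_(y <- s) y * (\1_(box r) p * \1_(A y) p)).
Proof.
move=> r0 mA; elim: s => [|y s [IH1 IH2]].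
  have -> : (fun p => \sum_(y <- [::]) y * (\1_(box r) p * \1_(A y) p)) = cst 0 :> (plane -> R).
    by apply/funext => p; rewrite big_nil.
  by split; [exact: test_L2 (test_0 setT)|apply: test_dense_test; exact: test_0].
have -> : (fun p => \sum_(y <- y :: s) y * (\1_(box r) p * \1_(A y) p)) =
  (fun p => y * (\1_(box r) p * \1_(A y) p) + \sum_(y <- s) y * (\1_(box r) p * \1_(A y) p)).
  by apply/funext => p; rewrite big_cons.
have L1y := L2_indic_box r (mA y).
split; first by apply: L2D => //; exact: L2Z.
apply: test_denseD => //; first exact: L2Z.
by apply: test_denseZ => //; exact: test_dense_indic.
Qed.

Import HBNNSimple.

Lemma test_dense_nnsfun r (g : {nnsfun plane >-> R}) : 0 < r ->
  L2 mu (fun p => \1_(box r) p * g p) /\ test_dense (fun p => \1_(box r) p * g p).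
Proof.
move=> r0.
have := @test_dense_sum r (finmap.enum_fset (fset_set (range g))) (fun y => g @^-1` [set y]) r0.
have -> : (fun p => \1_(box r) p * g p) = (fun p =>
    \sum_(y <- finmap.enum_fset (fset_set (range g))) y * (\1_(box r) p * \1_(g @^-1` [set y]) p)).
  apply/funext => p; rewrite [in LHS](fimfunE g p) fsbig_finite//= mulr_sumr.
  by apply: eq_bigr => y _; rewrite mulrCA.
by apply => y; rewrite -[X in measurable X]setTI; exact: measurable_funP.
Qed.

Lemma test_dense_nneg f : L2 mu f -> (forall p, 0 <= f p) -> test_dense f.
Proof.
move=> Lf f0; have [mf L1f] := Lf.
have mf' : measurable_fun setT (EFin \o f) by exact/measurable_EFinP.
pose g_ := nnsfun_approx (@measurableT _ plane) mf'.
have gcvg p : g_ k p @[k --> \oo] --> f p.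
  have H := @cvg_nnsfun_approx _ _ _ _ measurableT _ mf' (fun p _ => f0 p) p Logic.I.
  exact: (fine_cvg H).
have gle k p : g_ k p <= f p.
  have ndg : nondecreasing_seq (fun k => g_ k p).
    by move=> m n mn; have /lefP := nd_nnsfun_approx measurableT mf' mn; exact.
  have := nondecreasing_cvgn_le ndg; rewrite (cvg_lim _ (gcvg p))//; apply.
  exact: gcvg.
(* The cutoff to growing boxes brings the simple functions within reach of [test_dense_nnsfun]; the
   squared errors are dominated by [f ^+ 2]. *)
pose f_ k p := \1_(box k.+1%:R) p * g_ k p.
have Hf_ k := @test_dense_nnsfun k.+1%:R (g_ k) (ltr0Sn R k).
apply: (@test_dense_cvg f_) => //.
- by move=> k; case: (Hf_ k).
- by move=> k; case: (Hf_ k).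
apply: (nrm_cvg0 _ mf L1f).
- by move=> k; case: (Hf_ k) => -[].
- move=> k p; have g0 : 0 <= g_ k p by [].
  have /andP[i0 i1] := indic01 (box k.+1%:R) p.
  have := gle k p; rewrite /f_ => gk.
  have H1 : 0 <= \1_(box k.+1%:R) p * g_ k p by rewrite mulr_ge0.
  have H2 : \1_(box k.+1%:R) p * g_ k p <= f p.
    by apply: le_trans gk; rewrite ler_piMl.
  rewrite -(real_normK (num_real (_ - _))) lerXn2r ?nnegrE//.
  by rewrite ler_norml; apply/andP; split; lra.
- move=> p; rewrite -[X in _ --> X]mul1r; apply: cvgM; last exact: gcvg.
  have [r r0 Hr] := @compact_box R [set p] (@compact_set1 _ p).
  apply: cvg_near_cst; near=> k; rewrite indicE mem_set//.
  have [] := Hr p erefl; rewrite /ball/= !sub0r !normrN => h1 h2.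
  have rk : r <= k.+1%:R.
    apply: (@le_trans _ _ k%:R); last by rewrite ler_nat.
    by near: k; exact: nbhs_infty_ger.
  by split; rewrite /ball/= sub0r normrN; apply: lt_le_trans rk.
Unshelve. all: by end_near. Qed.

Lemma L2_dense f : L2 mu f -> test_dense f.
Proof.
move=> Lf; have [mf L1f] := Lf.
pose fp : plane -> R := fun p => Num.max (f p) 0.
pose fn : plane -> R := fun p => Num.max (- f p) 0.
have m_p : measurable_fun setT fp by apply: measurable_maxr.
have m_n : measurable_fun setT fn by apply: measurable_maxr => //; exact: measurableT_comp.
have Lp : L2 mu fp.
  apply: (L2_dom m_p Lf) => p; rewrite /fp.
  by have [H|H] := leP 0 (f p); rewrite ?normr0.
have Ln : L2 mu fn.
  apply: (L2_dom m_n Lf) => p; rewrite /fn -(normrN (f p)).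
  by have [H|H] := leP 0 (- f p); rewrite ?normr0.
have -> : f = (fun p => fp p + (-1) * fn p).
  apply/funext => p; rewrite /fp /fn mulN1r.
  by have [H|H] := leP 0 (f p); have [H'|H'] := leP 0 (- f p); lra.
apply: test_denseD => //; first exact: L2Z.
  by apply: test_dense_nneg => // p; rewrite /fp le_max lexx orbT.
by apply: test_denseZ => //; apply: test_dense_nneg => // p; rewrite /fn le_max lexx orbT.
Qed.

(** Shifts of length at most 1 keep all supports in one box, where the constant (2 M)^2
    dominates. *)
Lemma test_translation psi (h : nat -> R * R) : test_function setT psi ->
  (forall k, `|h k| <= 1) -> h k @[k --> \oo] --> (0 : R * R) ->
  nrm mu (fun p => psi (p + h k) - psi p) @[k --> \oo] --> 0.
Proof.
move=> tpsi h1 h0.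
have [M M0 HM] := test_bound tpsi.
have mpsi := test_measurable tpsi.
have spsi := test_smooth tpsi.
case: tpsi => _ [K [cK _] K0]; have [r r0 Kr] := compact_box cK.
have Kb p : ~ box r p -> psi p = 0 by move=> nb; apply: K0 => /Kr.
apply: (@nrm_cvg0 _ plane R mu (fun k (p : plane) => psi (p + h k)) psi
  (fun p : plane => (2 * M) ^+ 2 * \1_(box (r + 1)) p)).
- by move=> k; apply: (measurableT_comp mpsi); exact: measurable_shift.
- exact: mpsi.
- by apply: L1Z; apply: L1_indic; [exact: measurable_box|exact: box_fin].
- move=> k p; rewrite indicE; have [bp|nbp] := pselect (box (r + 1) p).
    rewrite mem_set//= mulr1 -(real_normK (num_real (_ - _))) lerXn2r ?nnegrE//.
      by rewrite mulr_ge0.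
    apply: (le_trans (ler_normB _ _)); have := HM (p + h k); have := HM p; lra.
  rewrite memNset//= mulr0 (Kb (p + h k)) ?(Kb p) ?subrr ?expr0n//.
    apply: contra_not nbp => -[p1 p2]; move: p1 p2; rewrite /ball/= !sub0r !normrN => p1 p2.
    by split; rewrite /ball/= sub0r normrN; lra.
  apply: contra_not nbp => -[p1 p2]; move: p1 p2; rewrite /ball/= !sub0r !normrN => p1 p2.
  have := h1 k; rewrite prod_normE ge_max => /andP[hk1 hk2].
  split; rewrite /ball/= sub0r normrN.
    by have := ler_normB (p.1 + (h k).1) (h k).1; rewrite addrK; lra.
  by have := ler_normB (p.2 + (h k).2) (h k).2; rewrite addrK; lra.
- move=> p; have H : p + h k @[k --> \oo] --> p + (0 : R * R).
    by apply: cvgD; [exact: cvg_cst|exact: h0].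
  by rewrite addr0 in H; exact: (cvg_comp _ _ H (smooth_continuous spsi (x := p))).
Qed.

(** Argued by contradiction, so that the offending shifts form a sequence tending to 0 and dominated
    convergence for a test function close to [f] applies. *)
Lemma L2_translation f (e : R) : L2 mu f -> 0 < e -> exists2 delta : R, 0 < delta &
  forall h, `|h| < delta -> nrm mu (fun p => f (p + h) - f p) <= e.
Proof.
move=> Lf e0; apply: contrapT => nH.
have {}nH (k : nat) : exists h : R * R, `|h| < k.+1%:R^-1 /\
    e < nrm mu (fun p => f (p + h) - f p).
  apply: contrapT => nE; apply: nH; exists k.+1%:R^-1; first by rewrite invr_gt0 ltr0n.
  move=> h hk; rewrite leNgt; apply/negP => eh; apply: nE; by exists h.
pose h k := projT1 (cid (nH k)).
have hk k : `|h k| < k.+1%:R^-1 by rewrite /h; case: (cid _) => ? [].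
have ek k : e < nrm mu (fun p => f (p + h k) - f p) by rewrite /h; case: (cid _) => ? [].
have e40 : 0 < e / 4 by rewrite divr_gt0.
have [psi tpsi fpsi] := L2_dense Lf e40.
have h0 : h k @[k --> \oo] --> (0 : R * R).
  apply/cvgrPdist_lt => eps eps0; near=> k; rewrite sub0r normrN.
  apply: (lt_trans (hk k)).
  by near: k; exact: (near_infty_natSinv_lt (PosNum eps0)).
have h1 k : `|h k| <= 1.
  by apply: ltW; apply: (lt_le_trans (hk k)); rewrite invf_le1 ?ltr0n// ler1n.
have [k Hk] := cvg0_ex (test_translation tpsi h1 h0) e40.
rewrite ger0_norm ?nrm_ge0// in Hk.
have Lpsi := test_L2 tpsi.
have Ld := L2B Lf Lpsi.
have := ek k; rewrite ltNge => /negP; apply.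
(* The difference splits into the shifted f - psi, the shift error of [psi], and f - psi itself;
   each costs at most e / 4. *)
have -> : e = e / 4 + e / 4 + e / 4 + e / 4 by field.
have H1 := nrmD (L2_shift (h k) Ld) (L2B (L2_shift (h k) Lpsi) Lpsi).
have H2 := nrmB (L2D (L2_shift (h k) Ld) (L2B (L2_shift (h k) Lpsi) Lpsi)) Ld.
rewrite (nrm_shift (h k) Ld) in H1.
apply: (@le_trans _ _ (nrm mu (fun p => f (p + h k) - psi (p + h k) +
  (psi (p + h k) - psi p) - (f p - psi p)))).
  by rewrite le_eqVlt; apply/orP; left; apply/eqP; apply: eq_nrm => p; ring.
lra.
Unshelve. all: by end_near. Qed.

End Density.

(** * Difference quotients of weak derivatives *)

Section DifferenceQuotients.
Context {R : realType}.
Local Notation plane := (measurableTypeR R * measurableTypeR R)%type.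
Local Notation mu := (@leb2 R).
Implicit Types (f g : plane -> R) (p q : R * R) (phi psi theta : R * R -> R).

(** Integrals run over the plane, for functions extended by zero; the test functions, supported in
    [Om], do not see the extension. *)
Definition weak_deriv (Om : set (R * R)) (e : R * R) f g :=
  forall theta, test_function Om theta ->
    rint mu (fun p => f p * 'D_e theta p) = - rint mu (fun p => g p * theta p).

Lemma weak_deriv_sub Om Om' e f g : Om `<=` Om' -> weak_deriv Om' e f g ->
  weak_deriv Om e f g.
Proof. by move=> OO H theta /(test_sub_dom OO); exact: H. Qed.

Lemma L2_testM Om f theta : L2 mu f -> test_function Om theta ->
  L1 mu (fun p => f p * theta p).
Proof. by move=> Lf /test_L2 Lt; exact: L2_L1M. Qed.

Lemma derive_shift_dir e theta h p : e = ex \/ e = ez -> smooth theta ->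
  'D_e (fun q => theta (q + h)) p = 'D_e theta (p + h).
Proof.
move=> he st.
by have [_ ->] := is_derive_shift2 (smooth_is_derive (p + h) he st).
Qed.

Lemma is_derive_line_opp e theta p (t : R) : e = ex \/ e = ez -> smooth theta ->
  is_derive t 1 (fun s : R => theta (p - s *: e)) (- 'D_e theta (p - t *: e)).
Proof.
move=> he st.
have H := @is_derive_along R theta p e (- t) _ (smooth_is_derive (p + - t *: e) he st).
have := @is_derive1_comp R (fun s => theta (p + s *: e)) (fun s : R => - s) t _ _ H _.
move=> /(_ (- 1) (is_deriveN (is_derive_id t (1 : R)))).
have -> : (fun s => theta (p + s *: e)) \o (fun s : R => - s) =
    (fun s : R => theta (p - s *: e)).
  by apply/funext => s /=; rewrite scaleNr.
by rewrite mulrN1 scaleNr.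
Qed.

Lemma basis_norm e : e = ex \/ e = ez -> `|e| <= (1 : R).
Proof.
by move=> [->|->]; rewrite prod_normE/= ?normr0 ?normr1 ge_max lexx ler01.
Qed.

Lemma basis_scale_norm e (s : R) : e = ex \/ e = ez -> `|s *: e| <= `|s|.
Proof. by move=> he; rewrite normrZ ler_piMr// basis_norm. Qed.

Lemma box_norm r p : box r p <-> `|p| < r.
Proof.
rewrite prod_normE gt_max; split.
  by move=> [p1 p2]; move: p1 p2; rewrite /ball/= !sub0r !normrN => -> ->.
by move=> /andP[p1 p2]; split; rewrite /ball/= sub0r normrN.
Qed.

Section Mean.
Variables (e : R * R) (Om Om' : set (R * R)) (d0 : R) (f f' : plane -> R).
Hypotheses (he : e = ex \/ e = ez) (d00 : 0 < d0).
Hypothesis Hsh : forall p s, Om' p -> `|s| <= d0 -> Om (p + s *: e).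
Hypotheses (Lf : L2 mu f) (Lf' : L2 mu f') (Hw : weak_deriv Om e f f').

(** The shift is put on the smooth [theta] and differentiated under the integral sign; the weak
    derivative of [f] is then used once, against the translated test function. *)
Lemma is_derive_corr theta (s : R) : test_function Om' theta -> `|s| <= d0 ->
  is_derive s 1 (fun t => rint mu (fun p => f p * theta (p - t *: e)))
    (rint mu (fun p => f' (p + s *: e) * theta p)).
Proof.
move=> tt sd; have st := test_smooth tt.
have tts (t : R) : test_function setT (fun p => theta (p - t *: e)).
  by apply: (@test_shift R Om' setT theta (- (t *: e))).
have [mf L1f] := Lf.
have intf (t : R) : L1 mu (fun p => f p * theta (p - t *: e)).
  exact: (L2_testM Lf (tts t)).
have derf p (t : R) : is_derive t 1 (fun x : R => f p * theta (p - x *: e))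
    (- (f p * 'D_e theta (p - t *: e))).
  have := is_deriveZ (f p) (is_derive_line_opp p t he st).
  by rewrite /GRing.scale/= mulrN.
have tD := test_D he tt; have [M M0 HM] := test_bound tD.
have [_ [K [cK _] K0]] := tD; have [r r0 Kr] := compact_box cK.
(* Dominates the derivative in the shift x: while |x| < d0 + 1, the translated supports stay in one
   box. *)
pose G p := `|f p| * (M * \1_(box (r + (d0 + 1))) p).
have LG : L1 mu G.
  apply: L2_L1M.
    by apply: (L2_dom _ Lf); [exact: measurableT_comp|move=> p; rewrite normr_id].
  apply: L2Z; split; first by apply: measurable_indic; exact: measurable_box.
  apply: eq_L1 (L1_indic (measurable_box (r + (d0 + 1))) (box_fin _)) => p.
  by rewrite indicE; case: (_ \in _); rewrite ?expr1n ?expr0n.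
have Gub (x : R) p : `](- (d0 + 1)), (d0 + 1)[%classic x ->
    `|partial1of2 (fun x p => f p * theta (p - x *: e)) x p| <= G p.
  rewrite /= in_itv/= => /andP[x1 x2].
  rewrite partial1of2E; have [_ ->] := derf p x.
  rewrite normrN normrM /G ler_wpM2l// indicE.
  have [bp|nbp] := pselect (box (r + (d0 + 1)) p).
    by rewrite mem_set//= mulr1.
  rewrite memNset//= mulr0 K0 ?normr0// => /Kr /box_norm Hr; apply: nbp.
  apply/box_norm.
  have := ler_normD (p - x *: e) (x *: e); rewrite subrK.
  have := basis_scale_norm x he.
  have : `|x| < d0 + 1 by rewrite ltr_norml x1 x2.
  lra.
(* The [+ 1] makes every s with |s| <= d0, endpoints included, interior to the interval of
   differentiation. *)
have Ia : `](- (d0 + 1)), (d0 + 1)[%classic s.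
  rewrite /= in_itv/=; move: sd; rewrite ler_norml => /andP[? ?].
  by apply/andP; split; lra.
have dd p (x : R) : derivable (fun x : R => f p * theta (p - x *: e)) x 1.
  by case: (derf p x).
have G0 p : 0 <= G p.
  by apply: mulr_ge0 => //; apply: mulr_ge0 => //; have /andP[] := indic01 (box (r + (d0 + 1))) p.
have H := @cvg_differentiation_under_integral R _ _ mu
  (fun x p => f p * theta (p - x *: e)) setT measurableT s _ _ Ia
  (fun x _ => intf x) (fun x p _ _ => dd p x) G G0 LG
  (fun x p Ix _ => Gub x p Ix).
have E : \int[mu]_(p in setT) partial1of2 (fun x p => f p * theta (p - x *: e)) s p =
    rint mu (fun p => f' (p + s *: e) * theta p).
  transitivity (- rint mu (fun p => f p * 'D_e (fun q => theta (q - s *: e)) p)).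
    rewrite -rintN.
      by apply: eq_rint => p; rewrite partial1of2E derive_shift_dir//; have [_ ->] := derf p s.
    exact: (L2_testM Lf (test_D he (tts s))).
  rewrite Hw.
    rewrite opprK -(rint_shift (s *: e)).
      by apply: eq_rint => p; rewrite addrK.
    exact: (L2_testM Lf' (tts s)).
  by apply: (test_shift _ tt) => p Op; rewrite opprK; exact: Hsh.
rewrite E in H.
split.
  apply/cvg_ex; exists (rint mu (fun p => f' (p + s *: e) * theta p)).
  by under eq_fun do rewrite scaler1; exact: H.
rewrite /derive; apply: cvg_lim; first exact: Rhausdorff.
by under eq_fun do rewrite scaler1; exact: H.
Qed.

(** The mean value theorem for the correlation of [f] with [theta]. The intermediate shift [s]
    depends on [theta]. *)
Lemma diff_quotient_mean theta (h : R) : test_function Om' theta -> 0 < h <= d0 ->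
  exists2 s : R, 0 < s < h &
    rint mu (fun p => (f (p + h *: e) - f p) * theta p) =
    h * rint mu (fun p => f' (p + s *: e) * theta p).
Proof.
move=> tt /andP[h0 hd].
pose Phi (t : R) := rint mu (fun p => f p * theta (p - t *: e)).
have dPhi (t : R) : `|t| <= d0 -> is_derive t 1 Phi
    (rint mu (fun p => f' (p + t *: e) * theta p)) by exact: is_derive_corr.
have tts (t : R) : test_function setT (fun p => theta (p - t *: e)).
  by apply: (@test_shift R Om' setT theta (- (t *: e))).
have PhiE (t : R) : rint mu (fun p => f (p + t *: e) * theta p) = Phi t.
  rewrite /Phi -[RHS](rint_shift (t *: e)).
    by apply: eq_rint => p; rewrite addrK.
  exact: (L2_testM Lf (tts t)).
have [||s] := @MVT R Phi (fun t => rint mu (fun p => f' (p + t *: e) * theta p)) 0 h h0.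
- move=> x; rewrite in_itv/= => /andP[x0 xh]; apply: dPhi.
  by rewrite ger0_norm ?ltW//; lra.
- apply: derivable_within_continuous => x; rewrite in_itv/= => /andP[x0 xh].
  have xd : `|x| <= d0 by rewrite ger0_norm//; lra.
  by case: (dPhi x xd).
rewrite in_itv/= subr0 => s0h Hs; exists s => //.
rewrite mulrC -Hs -!PhiE -rintB.
- by apply: eq_rint => p; rewrite scale0r addr0 mulrBl.
- exact: (L2_testM (L2_shift _ Lf) tt).
- exact: (L2_testM (L2_shift _ Lf) tt).
Qed.

Definition dquot (h : R) (g : plane -> R) (p : plane) := h^-1 * (g (p + h *: e) - g p).

Lemma L2_dquot h g : L2 mu g -> L2 mu (dquot h g).
Proof. by move=> Lg; apply: L2Z; apply: L2B => //; exact: L2_shift. Qed.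

(** Although the intermediate shift depends on the test function, only the modulus [omega] of f'
    enters, so the bound is uniform in [psi]. *)
Lemma dquot_test phi psi (h omega M : R) : test_function Om' phi ->
  test_function setT psi -> 0 < h <= d0 ->
  (forall s, 0 < s < h -> nrm mu (fun p => f' (p + s *: e) - f' p) <= omega) ->
  (forall p, `|phi p| <= M) ->
  `|rint mu (fun p => (dquot h f p - f' p) * (phi p * psi p))| <= omega * (M * nrm mu psi).
Proof.
move=> tphi tpsi h0d Hom HM.
have tt : test_function Om' (fun p => phi p * psi p).
  by apply: test_mul => //; exact: test_smooth tpsi.
have Lt := test_L2 tt.
have [s s0h Hs] := diff_quotient_mean tt h0d.
have h0 : h != 0 by have /andP[? _] := h0d; rewrite gt_eqF.
have -> : rint mu (fun p => (dquot h f p - f' p) * (phi p * psi p)) =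
    rint mu (fun p => (f' (p + s *: e) - f' p) * (phi p * psi p)).
  transitivity (h^-1 * rint mu (fun p => (f (p + h *: e) - f p) * (phi p * psi p)) -
      rint mu (fun p => f' p * (phi p * psi p))).
    rewrite -rintZ; last exact: (L2_L1M (L2B (L2_shift _ Lf) Lf) Lt).
    rewrite -rintB.
    - by apply: eq_rint => p; rewrite /dquot mulrBl mulrA.
    - by apply: L1Z; exact: (L2_L1M (L2B (L2_shift _ Lf) Lf) Lt).
    - exact: L2_L1M.
  rewrite Hs mulKf// -rintB.
  - by apply: eq_rint => p; rewrite mulrBl.
  - exact: (L2_L1M (L2_shift _ Lf') Lt).
  - exact: L2_L1M.
apply: (le_trans (cauchy_schwarz (L2B (L2_shift (s *: e) Lf') Lf') Lt)).
apply: ler_pM; [exact: nrm_ge0|exact: nrm_ge0|exact: Hom|].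
exact: (nrm_bddM (test_measurable tphi) HM (test_L2 tpsi)).
Qed.

(** Density of test functions: for a fixed step, [dquot h f - f'] is some L^2 function, so [psi] may
    be replaced by a nearby test function. The factor [phi] localises to the set where f' is the
    derivative of [f]. *)
Lemma dquot_L2 phi (psi : plane -> R) (h omega M : R) : test_function Om' phi ->
  L2 mu psi -> 0 < h <= d0 -> 0 <= M -> 0 <= omega ->
  (forall s, 0 < s < h -> nrm mu (fun p => f' (p + s *: e) - f' p) <= omega) ->
  (forall p, `|phi p| <= M) ->
  `|rint mu (fun p => (dquot h f p - f' p) * (phi p * psi p))| <= omega * (M * nrm mu psi).
Proof.
move=> tphi Lpsi h0d M0 om0 Hom HM.
have LG : L2 mu (fun p => dquot h f p - f' p) by apply: L2B => //; exact: L2_dquot.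
have mphi := test_measurable tphi.
apply/ler_addgt0Pr => eps eps0.
(* The total coefficient of eps / C in the estimate; the [+ 1] makes it positive. *)
pose C := omega * M + nrm mu (fun p => dquot h f p - f' p) * M + 1.
have C0 : 0 < C.
  by rewrite /C ltr_wpDl// addr_ge0// mulr_ge0// nrm_ge0.
have [chi tchi Hchi] := L2_dense Lpsi (divr_gt0 eps0 C0).
have Lchi := test_L2 tchi; have Lpc := L2B Lpsi Lchi.
have -> : rint mu (fun p => (dquot h f p - f' p) * (phi p * psi p)) =
    rint mu (fun p => (dquot h f p - f' p) * (phi p * chi p)) +
    rint mu (fun p => (dquot h f p - f' p) * (phi p * (psi p - chi p))).
  rewrite -rintD; last 2 first.
  - exact: (L2_L1M LG (L2_bddM mphi HM Lchi)).
  - exact: (L2_L1M LG (L2_bddM mphi HM Lpc)).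
  by apply: eq_rint => p; ring.
apply: (le_trans (ler_normD _ _)).
have H1 := dquot_test tphi tchi h0d Hom HM.
have H2 := cauchy_schwarz LG (L2_bddM mphi HM Lpc).
have H3 := nrm_bddM mphi HM Lpc.
have H4 : nrm mu chi <= nrm mu psi + eps / C.
  have -> : nrm mu chi = nrm mu (fun p => psi p - (psi p - chi p)).
    by apply: eq_nrm => p; ring.
  by apply: (le_trans (nrmB Lpsi Lpc)); rewrite lerD2l.
have n0 := nrm_ge0 mu (fun p => dquot h f p - f' p).
have Hfin : eps = C * (eps / C) by rewrite mulrC divfK// gt_eqF.
have H5 : omega * (M * nrm mu chi) <= omega * (M * (nrm mu psi + eps / C)).
  by rewrite !ler_wpM2l.
have H6 : nrm mu (fun p => dquot h f p - f' p) * nrm mu (fun p => phi p * (psi p - chi p)) <=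
    nrm mu (fun p => dquot h f p - f' p) * (M * (eps / C)).
  by rewrite ler_wpM2l// (le_trans H3)// ler_wpM2l.
have ec : 0 < eps / C by rewrite divr_gt0.
rewrite Hfin {1}/C; lra.
Qed.

Definition step (k : nat) : R := d0 / k.+1%:R.

Lemma step_gt0 k : 0 < step k.
Proof. by rewrite divr_gt0// ltr0n. Qed.

Lemma step_le k : step k <= d0.
Proof. by rewrite ler_pdivrMr ?ltr0n// ler_peMr ?ler1n// ltW. Qed.

Lemma step_cvg0 : step k @[k --> \oo] --> 0.
Proof.
have H : d0 * harmonic k @[k --> \oo] --> d0 * 0.
  by apply: cvgM; [exact: cvg_cst|exact: cvg_harmonic].
by rewrite mulr0 in H; exact: H.
Qed.

Lemma nrm_step_cvg0 g : L2 mu g ->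
  nrm mu (fun p => g (p + step k *: e) - g p) @[k --> \oo] --> 0.
Proof.
move=> Lg; apply/cvgrPdist_le => eps eps0.
have [del del0 Hdel] := L2_translation Lg eps0.
near=> k; rewrite sub0r normrN ger0_norm ?nrm_ge0//; apply: Hdel.
apply: (le_lt_trans (basis_scale_norm _ he)).
near: k; have /cvgrPdist_lt/(_ _ del0) := step_cvg0.
by apply: filterS => k; rewrite sub0r normrN.
Unshelve. all: by end_near. Qed.

(** [dquot_L2] bounds the error uniformly over L^2 balls, so the second factor may vary with the
    step as long as it converges strongly. *)
Lemma dquot_cvg phi (psi_ : nat -> plane -> R) psi : test_function Om' phi ->
  (forall k, L2 mu (psi_ k)) -> L2 mu psi ->
  nrm mu (fun p => psi_ k p - psi p) @[k --> \oo] --> 0 ->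
  rint mu (fun p => dquot (step k) f p * (phi p * psi_ k p)) @[k --> \oo] -->
  rint mu (fun p => f' p * (phi p * psi p)).
Proof.
move=> tphi Lpsi_ Lpsi c0.
have [M M0 HM] := test_bound tphi; have mphi := test_measurable tphi.
apply/cvgrPdist_le => eps eps0.
pose C := M * (nrm mu psi + 1) + nrm mu f' * M + 1.
have C0 : 0 < C.
  by rewrite /C ltr_wpDl// addr_ge0// mulr_ge0// ?addr_ge0 ?nrm_ge0.
pose eta := Num.min 1 (eps / C).
have eta0 : 0 < eta by rewrite lt_min ltr01 divr_gt0.
have eta1 : eta <= 1 by rewrite ge_min lexx.
have etaC : C * eta <= eps.
  by rewrite mulrC -ler_pdivlMr// ge_min lexx orbT.
have [del del0 Hdel] := L2_translation Lf' eta0.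
near=> k.
have n1 : nrm mu (fun p => psi_ k p - psi p) <= eta.
  have : `|0 - nrm mu (fun p => psi_ k p - psi p)| <= eta.
    by near: k; move/cvgrPdist_le : c0; exact.
  by rewrite sub0r normrN ger0_norm// nrm_ge0.
have sk : `|0 - step k| < del.
  by near: k; have /cvgrPdist_lt := step_cvg0; exact.
rewrite sub0r normrN ger0_norm ?ltW ?step_gt0// in sk.
have om s : 0 < s < step k -> nrm mu (fun p => f' (p + s *: e) - f' p) <= eta.
  move=> /andP[s0 s1]; apply: Hdel; apply: (le_lt_trans (basis_scale_norm _ he)).
  by rewrite gtr0_norm//; lra.
have h0d : 0 < step k <= d0 by rewrite step_gt0 step_le.
have Ld := L2_dquot (step k) Lf.
have Lk := L2_bddM mphi HM (Lpsi_ k); have Lp := L2_bddM mphi HM Lpsi.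
have Lkp := L2B (Lpsi_ k) Lpsi.
rewrite distrC.
have -> : rint mu (fun p => dquot (step k) f p * (phi p * psi_ k p)) -
    rint mu (fun p => f' p * (phi p * psi p)) =
    rint mu (fun p => (dquot (step k) f p - f' p) * (phi p * psi_ k p)) +
    rint mu (fun p => f' p * (phi p * (psi_ k p - psi p))).
  rewrite -rintB; [|exact: L2_L1M|exact: L2_L1M].
  rewrite -rintD; last 2 first.
  - exact: (L2_L1M (L2B Ld Lf') Lk).
  - exact: (L2_L1M Lf' (L2_bddM mphi HM Lkp)).
  by apply: eq_rint => p; ring.
apply: (le_trans (ler_normD _ _)).
have H1 := dquot_L2 tphi (Lpsi_ k) h0d M0 (ltW eta0) om HM.
have H2 := cauchy_schwarz Lf' (L2_bddM mphi HM Lkp).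
have H3 := nrm_bddM mphi HM Lkp.
have H4 : nrm mu (psi_ k) <= nrm mu psi + 1.
  have -> : nrm mu (psi_ k) = nrm mu (fun p => psi p + (psi_ k p - psi p)).
    by apply: eq_nrm => p; ring.
  apply: (le_trans (nrmD Lpsi Lkp)); lra.
have H5 : eta * (M * nrm mu (psi_ k)) <= eta * (M * (nrm mu psi + 1)).
  by apply: ler_wpM2l; [exact: ltW|exact: ler_wpM2l].
have H6 : nrm mu f' * nrm mu (fun p => phi p * (psi_ k p - psi p)) <= nrm mu f' * (M * eta).
  apply: ler_wpM2l; first exact: nrm_ge0.
  by apply: (le_trans H3); exact: ler_wpM2l.
have H7 : C * eta = eta * (M * (nrm mu psi + 1)) + nrm mu f' * (M * eta) + eta.
  by rewrite /C; ring.
lra.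
Unshelve. all: by end_near. Qed.

End Mean.
End DifferenceQuotients.

(** * The entropy identity *)

Section EntropyIdentity.
Context {R : realType}.
Local Notation plane := (measurableTypeR R * measurableTypeR R)%type.
Local Notation mu := (@leb2 R).
Implicit Types (f g : plane -> R) (p q : R * R) (phi psi theta : R * R -> R).

Lemma is_derive_seq (f : R -> R) (t df : R) (h : nat -> R) : is_derive t 1 f df ->
  (forall k, h k != 0) -> h k @[k --> \oo] --> 0 ->
  (h k)^-1 * (f (h k + t) - f t) @[k --> \oo] --> df.
Proof.
move=> [/cvg_ex[l Hl] Hdf] hN0 h0.
have El : l = df.
  by rewrite -Hdf /derive; apply/esym; apply: cvg_lim; first exact: Rhausdorff.
rewrite El in Hl.
move/cvgr_dnbhsP : Hl => /(_ h (conj hN0 h0)) H.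
apply: cvg_trans H; apply: near_eq_cvg; near=> k => /=.
by rewrite scaler1.
Unshelve. all: by end_near. Qed.

Lemma seq_cvg_unique (s : nat -> R) (a b : R) :
  s k @[k --> \oo] --> a -> s k @[k --> \oo] --> b -> a = b.
Proof. by move=> ha hb; exact: (cvg_unique (@Rhausdorff R) ha hb). Qed.

Lemma seq_cvgD (s t : nat -> R) (a b : R) :
  s k @[k --> \oo] --> a -> t k @[k --> \oo] --> b ->
  (fun k => s k + t k) k @[k --> \oo] --> a + b.
Proof. by move=> ha hb; exact: cvgD. Qed.

Lemma seq_cvgN (s : nat -> R) (a : R) :
  s k @[k --> \oo] --> a -> (fun k => - s k) k @[k --> \oo] --> - a.
Proof. by move=> ha; exact: cvgN. Qed.

Section OneDirection.
Variables (e : R * R) (d0 : R).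
Hypotheses (he : e = ex \/ e = ez) (d00 : 0 < d0).

Lemma test_quot_bound Om phi (M h : R) p : test_function Om phi ->
  (forall q, `|'D_e phi q| <= M) -> 0 < h -> `|h^-1 * (phi (p - h *: e) - phi p)| <= M.
Proof.
move=> tphi HM h0; have sphi := test_smooth tphi.
have D (t : R) := is_derive_line_opp p t he sphi.
have [|c _ Hc] := @MVT R (fun s => phi (p - s *: e)) (fun t => - 'D_e phi (p - t *: e)) 0 h h0.
  by apply: derivable_within_continuous => x _; case: (D x).
rewrite scale0r !subr0 in Hc; rewrite Hc.
by rewrite mulrCA mulVf ?gt_eqF// mulr1 normrN.
Qed.

(** Translation invariance moves the quotient onto [phi], where the mean value theorem provides
    domination. Integrability of [F] suffices, which admits products and cubes. *)
Lemma test_quot_cvg Om phi (F : plane -> R) : L1 mu F -> test_function Om phi ->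
  rint mu (fun p => dquot e (step d0 k) F p * phi p) @[k --> \oo] -->
  - rint mu (fun p => F p * 'D_e phi p).
Proof.
move=> LF tphi; have sphi := test_smooth tphi; have mphi := test_measurable tphi.
have mF := L1_meas LF.
have [M M0 HM] := test_bound (test_D he tphi); have [N N0 HN] := test_bound tphi.
have s0 k := step_gt0 d00 k.
have LFb (psi : plane -> R) (B : R) : measurable_fun setT psi -> (forall p, `|psi p| <= B) ->
    L1 mu (fun p => F p * psi p).
  move=> mpsi bpsi.
  apply: (@L1_dom _ plane R mu _ (fun p : plane => B * `|F p|)).
  + exact: measurable_funM.
  + by apply: L1Z; exact: L1_norm.
  + by move=> p; rewrite normrM mulrC ler_wpM2r.
have tsh k : test_function setT (fun p => phi (p - step d0 k *: e)).
  by apply: (@test_shift R Om setT phi (- (step d0 k *: e))).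
have E k : rint mu (fun p => dquot e (step d0 k) F p * phi p) =
    rint mu (fun p => F p * ((step d0 k)^-1 * (phi (p - step d0 k *: e) - phi p))).
  have L1a : L1 mu (fun p => F p * phi (p - step d0 k *: e)).
    by apply: (LFb _ N) => //; exact: test_measurable (tsh k).
  have L1b : L1 mu (fun p => F p * phi p) by exact: (LFb _ N).
  have L1c := L1_shift (step d0 k *: e) L1a.
  transitivity ((step d0 k)^-1 * (rint mu (fun p => F (p + step d0 k *: e) *
      phi (p + step d0 k *: e - step d0 k *: e)) - rint mu (fun p => F p * phi p))).
    rewrite -rintB// -rintZ; last exact: L1B.
    by apply: eq_rint => p; rewrite /dquot addrK; ring.
  rewrite (rint_shift (step d0 k *: e) L1a) -rintB// -rintZ; last exact: L1B.
  by apply: eq_rint => p; ring.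
rewrite -rintN; last first.
  by apply: (LFb _ M) => //; exact: test_measurable (test_D he tphi).
have [||||_] := @rint_dominated_cvg _ plane R mu
  (fun k (p : plane) => F p * ((step d0 k)^-1 * (phi (p - step d0 k *: e) - phi p)))
  (fun p => - (F p * 'D_e phi p)) (fun p => M * `|F p|).
- move=> k; apply: measurable_funM => //; apply: measurable_funM => //.
  by apply: measurable_funB => //; exact: test_measurable (tsh k).
- by apply: L1Z; exact: L1_norm.
- move=> k p; rewrite normrM mulrC ler_wpM2r//.
  exact: (test_quot_bound p tphi HM (s0 k)).
- move=> p; rewrite -mulrN; apply: cvgM; first exact: cvg_cst.
  have := is_derive_seq (is_derive_line_opp p 0 he sphi) _ (step_cvg0 d0).
  rewrite scale0r subr0.
  move=> /(_ (fun k => lt0r_neq0 (s0 k))).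
  by under eq_fun do rewrite addr0.
by move=> H; under eq_fun do rewrite E; exact: H.
Qed.

(** Discrete Leibniz rule: the quotient of f g is that of [f] times the shifted [g], plus that of
    [g] times [f]. The product is merely integrable, so [test_quot_cvg] handles the left side. *)
Lemma weak_deriv_mul (Om Om' : set (R * R)) f f' g g' : 
  (forall p s, Om' p -> `|s| <= d0 -> Om (p + s *: e)) ->
  L2 mu f -> L2 mu f' -> L2 mu g -> L2 mu g' ->
  weak_deriv Om e f f' -> weak_deriv Om e g g' ->
  weak_deriv Om' e (fun p => f p * g p) (fun p => f' p * g p + g' p * f p).
Proof.
move=> Hsh Lf Lf' Lg Lg' Hf Hg phi tphi.
have [M M0 HM] := test_bound tphi; have mphi := test_measurable tphi.
have s0 k := step_gt0 d00 k.
have H1 := test_quot_cvg (L2_L1M Lf Lg) tphi.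
have Lgk k : L2 mu (fun p => g (p + step d0 k *: e)) by exact: L2_shift.
have H2 := dquot_cvg he d00 Hsh Lf Lf' Hf tphi Lgk Lg (nrm_step_cvg0 d0 he Lg).
have c0 : nrm mu (fun p => f p - f p) @[k --> \oo] --> 0.
  have -> : nrm mu (fun p => f p - f p) = 0; last exact: cvg_cst.
  rewrite /nrm (_ : rint _ _ = 0) ?sqrtr0//.
  have -> : (fun p => (f p - f p) ^+ 2) = cst 0 by apply/funext => p; rewrite subrr expr0n.
  by rewrite /rint /Rintegral integral0.
have H3 := dquot_cvg he d00 Hsh Lg Lg' Hg tphi (fun _ => Lf) Lf c0.
have H4 := seq_cvgD H2 H3.
have E : (fun k => rint mu (fun p => dquot e (step d0 k) (fun p => f p * g p) p * phi p)) =
    (fun k => rint mu (fun p => dquot e (step d0 k) f p * (phi p * g (p + step d0 k *: e)))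
    + rint mu (fun p => dquot e (step d0 k) g p * (phi p * f p))).
  apply/funext => k; rewrite -rintD.
  - by apply: eq_rint => p; rewrite /dquot; ring.
  - exact: (L2_L1M (L2_dquot _ _ Lf) (L2_bddM mphi HM (Lgk k))).
  - exact: (L2_L1M (L2_dquot _ _ Lg) (L2_bddM mphi HM Lf)).
rewrite E in H1.
have /(congr1 -%R) := seq_cvg_unique H1 H4; rewrite opprK => ->.
congr (- _); rewrite -rintD.
- by apply: eq_rint => p; ring.
- exact: (L2_L1M Lf' (L2_bddM mphi HM Lg)).
- exact: (L2_L1M Lg' (L2_bddM mphi HM Lf)).
Qed.

(** The signed square a|a| distinguishes a from -a, unlike the square, so its continuity under
    translation controls a difference of shifts. The constant 2 is for opposite signs, where (a -
    b)^2 <= 2 (a^2 + b^2). *)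
Lemma sqr_sub_le (a b : R) : (a - b) ^+ 2 <= 2 * `|a * `|a| - b * `|b| |.
Proof.
wlog ba : a b / b <= a => [H|].
  have [/H //|/ltW/H] := leP b a.
  by rewrite -sqrrN opprB [`|b * _ - _|]distrC.
have [b0|b0] := leP 0 b.
  have a0 : 0 <= a by exact: le_trans ba.
  have H1 : 0 <= (a - b) * a by rewrite mulr_ge0// subr_ge0.
  have H2 : 0 <= (a - b) * b by rewrite mulr_ge0// subr_ge0.
  rewrite (ger0_norm a0) (ger0_norm b0).
  apply: (le_trans _ (ler_wpM2l (ler0n _ 2) (ler_norm _))); nra.
have [a0|a0] := leP 0 a.
  have H1 := sqr_ge0 (a + b).
  rewrite (ger0_norm a0) (ltr0_norm b0).
  apply: (le_trans _ (ler_wpM2l (ler0n _ 2) (ler_norm _))); nra.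
have H1 : 0 <= (a - b) * (- a) by rewrite mulr_ge0 ?subr_ge0 ?oppr_ge0// ltW.
have H2 : 0 <= (a - b) * (- b) by rewrite mulr_ge0 ?subr_ge0 ?oppr_ge0// ltW.
rewrite (ltr0_norm a0) (ltr0_norm b0).
apply: (le_trans _ (ler_wpM2l (ler0n _ 2) (ler_norm _))); nra.
Qed.

(** The squared error is f^2 times a squared shift difference of [f]. By [sqr_sub_le] and
    Cauchy-Schwarz its integral is at most 2 |f^2| times the shift error of f|f| in L^2. *)
Lemma quadratic_shift_cvg f : L2 mu f -> L2 mu (fun p => f p ^+ 2) ->
  (forall k, L2 mu (fun p => f (p + step d0 k *: e) * f p)) /\
  nrm mu (fun p => f (p + step d0 k *: e) * f p - f p ^+ 2) @[k --> \oo] --> 0.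
Proof.
move=> Lf Lf2; have [mf _] := Lf.
have msh k : measurable_fun setT (fun p : plane => f (p + step d0 k *: e)).
  by case: (L2_shift (step d0 k *: e) Lf).
pose s p := f p * `|f p|.
have Ls : L2 mu s.
  apply: (L2_dom _ Lf2); first by apply: measurable_funM => //; exact: measurableT_comp.
  by move=> p; rewrite /s normrM normr_id normrX expr2.
have bnd k p : (f (p + step d0 k *: e) * f p - f p ^+ 2) ^+ 2 <=
    2 * (f p ^+ 2 * `|s (p + step d0 k *: e) - s p|).
  have -> : (f (p + step d0 k *: e) * f p - f p ^+ 2) ^+ 2 =
    f p ^+ 2 * (f (p + step d0 k *: e) - f p) ^+ 2 by ring.
  rewrite [leRHS]mulrCA; apply: ler_wpM2l; [exact: sqr_ge0|exact: sqr_sub_le].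
have Lts k : L2 mu (fun p => `|s (p + step d0 k *: e) - s p|).
  have Ld := L2B (L2_shift (step d0 k *: e) Ls) Ls.
  apply: (L2_dom _ Ld); first by apply: measurableT_comp => //; case: Ld.
  by move=> p; rewrite normr_id.
have Ldif k : L2 mu (fun p => f (p + step d0 k *: e) * f p - f p ^+ 2).
  have md : measurable_fun setT (fun p : plane => f (p + step d0 k *: e) * f p - f p ^+ 2).
    by apply: measurable_funB; [exact: measurable_funM|exact: measurable_funX].
  split => //; apply: (@L1_dom _ plane R mu _
    (fun p : plane => 2 * (f p ^+ 2 * `|s (p + step d0 k *: e) - s p|))).
  - exact: measurable_funX.
  - by apply: L1Z; exact: L2_L1M.
  - by move=> p; rewrite ger0_norm ?sqr_ge0//; exact: bnd.
split.
  move=> k; apply: eq_L2 (L2D (Ldif k) Lf2) => p; by rewrite subrK.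
have c1 := nrm_step_cvg0 d0 he Ls.
pose u k := 2 * (nrm mu (fun p => f p ^+ 2) * nrm mu (fun p => s (p + step d0 k *: e) - s p)).
have u0 : u k @[k --> \oo] --> 0.
  have H : u k @[k --> \oo] --> 2 * (nrm mu (fun p => f p ^+ 2) * 0).
    by apply: cvgM; [exact: cvg_cst|apply: cvgM; [exact: cvg_cst|exact: c1]].
  by rewrite !mulr0 in H.
have su0 : Num.sqrt (u k) @[k --> \oo] --> 0.
  rewrite -(@sqrtr0 R); exact: (cvg_comp _ _ u0 (@sqrt_continuous R 0)).
apply: (@squeeze_cvgr _ _ _ _ (cst 0) (fun k => Num.sqrt (u k))) => //; last exact: cvg_cst.
near=> k; rewrite /= nrm_ge0/=.
have uk0 : 0 <= u k by rewrite mulr_ge0// mulr_ge0// nrm_ge0.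
apply: nrm_le; first exact: sqrtr_ge0.
rewrite sqr_sqrtr//.
apply: (@le_trans _ _ (rint mu (fun p => 2 * (f p ^+ 2 * `|s (p + step d0 k *: e) - s p|)))).
  apply: rint_le => //; first by case: (Ldif k).
  by apply: L1Z; exact: L2_L1M.
rewrite rintZ; last exact: L2_L1M.
rewrite /u ler_wpM2l//.
apply: (le_trans (ler_norm _)); apply: (le_trans (cauchy_schwarz Lf2 (Lts k))).
rewrite ler_wpM2l ?nrm_ge0// le_eqVlt; apply/orP; left; apply/eqP.
rewrite /nrm; congr Num.sqrt; apply: eq_rint => p.
by rewrite real_normK ?num_real.
Unshelve. all: by end_near. Qed.

Lemma L1_cube f : L2 mu f -> L2 mu (fun p => f p ^+ 2) -> L1 mu (fun p => f p ^+ 3).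
Proof.
move=> Lf Lf2; apply: eq_L1 (L2_L1M Lf Lf2) => p; by rewrite exprS.
Qed.

(** The factorisation a^3 - b^3 = (a - b)(a^2 + a b + b^2): the second factor, with a the shift of
    [f] and b = f, converges to 3 f^2 in L^2. *)
Lemma weak_deriv_cube (Om Om' : set (R * R)) f f' :
  (forall p s, Om' p -> `|s| <= d0 -> Om (p + s *: e)) ->
  L2 mu f -> L2 mu f' -> L2 mu (fun p => f p ^+ 2) -> weak_deriv Om e f f' ->
  weak_deriv Om' e (fun p => f p ^+ 3) (fun p => 3 * (f p ^+ 2 * f' p)).
Proof.
move=> Hsh Lf Lf' Lf2 Hf phi tphi.
have H1 := test_quot_cvg (L1_cube Lf Lf2) tphi.
have [Lq cq] := quadratic_shift_cvg Lf Lf2.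
pose Q k p := f (p + step d0 k *: e) ^+ 2 + f (p + step d0 k *: e) * f p + f p ^+ 2.
have Lsh k : L2 mu (fun p => f (p + step d0 k *: e) ^+ 2) by exact: (L2_shift _ Lf2).
have LQ k : L2 mu (Q k) by apply: L2D => //; exact: L2D.
have L3 : L2 mu (fun p => 3 * f p ^+ 2) by exact: L2Z.
have cQ : nrm mu (fun p => Q k p - 3 * f p ^+ 2) @[k --> \oo] --> 0.
  have cD : nrm mu (fun p => f (p + step d0 k *: e) ^+ 2 - f p ^+ 2) +
      nrm mu (fun p => f (p + step d0 k *: e) * f p - f p ^+ 2) @[k --> \oo] --> 0 + (0 : R).
    by apply: cvgD; [exact: (nrm_step_cvg0 d0 he Lf2)|exact: cq].
  rewrite addr0 in cD.
  apply: (@squeeze_cvgr _ _ _ _ (cst 0) _ _ _ _ _ cD); last exact: cvg_cst.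
  near=> k; rewrite /= nrm_ge0/=.
  apply: le_trans (nrmD (L2B (Lsh k) Lf2) (L2B (Lq k) Lf2)).
  rewrite le_eqVlt; apply/orP; left; apply/eqP; apply: eq_nrm => p.
  by rewrite /Q; ring.
have H2 := dquot_cvg he d00 Hsh Lf Lf' Hf tphi LQ L3 cQ.
have E : (fun k => rint mu (fun p => dquot e (step d0 k) (fun p => f p ^+ 3) p * phi p)) =
    (fun k => rint mu (fun p => dquot e (step d0 k) f p * (phi p * Q k p))).
  apply/funext => k; apply: eq_rint => p; rewrite /dquot /Q; ring.
rewrite E in H1.
have /(congr1 -%R) := seq_cvg_unique H1 H2; rewrite opprK => ->.
by congr (- _); apply: eq_rint => p; ring.
Unshelve. all: by end_near. Qed.

Lemma weak_deriv_shift (Om Om' : set (R * R)) e' f f' h : e' = ex \/ e' = ez ->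
  (forall p, Om' p -> Om (p + h)) -> L2 mu f -> L2 mu f' ->
  weak_deriv Om e' f f' ->
  weak_deriv Om' e' (fun p => f (p + h)) (fun p => f' (p + h)).
Proof.
move=> he' Hsh Lf Lf' Hf phi tphi.
have tsh : test_function Om (fun p => phi (p - h)).
  by apply: (test_shift _ tphi) => p; rewrite opprK; exact: Hsh.
transitivity (rint mu (fun p => f p * 'D_e' (fun q => phi (q - h)) p)).
  rewrite -[RHS](rint_shift h).
    apply: eq_rint => p; rewrite derive_shift_dir ?addrK//; exact: test_smooth tphi.
  exact: (L2_testM Lf (test_D he' tsh)).
rewrite Hf//; congr (- _).
rewrite -[LHS](rint_shift h); last exact: (L2_testM Lf' tsh).
by apply: eq_rint => p; rewrite addrK.
Qed.

Lemma weak_deriv_lin Om e' f f' g g' (a : R) : e' = ex \/ e' = ez ->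
  L2 mu f -> L2 mu f' -> L2 mu g -> L2 mu g' ->
  weak_deriv Om e' f f' -> weak_deriv Om e' g g' ->
  weak_deriv Om e' (fun p => f p + a * g p) (fun p => f' p + a * g' p).
Proof.
move=> he' Lf Lf' Lg Lg' Hf Hg phi tphi.
have tD := test_D he' tphi.
transitivity (rint mu (fun p => f p * 'D_e' phi p) + a * rint mu (fun p => g p * 'D_e' phi p)).
  rewrite -rintZ; last exact: L2_testM tD.
  rewrite -rintD; last 2 first.
  - exact: L2_testM tD.
  - by apply: L1Z; exact: L2_testM tD.
  by apply: eq_rint => p; ring.
rewrite Hf// Hg// mulrN -opprD; congr (- _).
rewrite -rintZ; last exact: L2_testM tphi.
rewrite -rintD; last 2 first.
- exact: L2_testM tphi.
- by apply: L1Z; exact: L2_testM tphi.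
by apply: eq_rint => p; ring.
Qed.

End OneDirection.

(* Testing d_z(v^2)/2 = d_x(v w) - w d_x v, which holds because v = d_x u and
   w = d_z u have the same mixed derivative.  The difference quotient in z of u
   replaces w, so that its x-derivative is a function. *)
Lemma weak_deriv_sqr_ez (Om Om1 Om2 : set (R * R)) (d0 : R) (u v w g : plane -> R) phi :
  0 < d0 ->
  (forall p s, Om1 p -> `|s| <= d0 -> Om (p + s *: ez)) ->
  (forall p s, Om2 p -> `|s| <= d0 -> Om1 (p + s *: ex)) ->
  L2 mu u -> L2 mu v -> L2 mu w -> L2 mu g ->
  weak_deriv Om ex u v -> weak_deriv Om ez u w -> weak_deriv Om ex v g ->
  test_function Om2 phi ->
  rint mu (fun p => v p ^+ 2 * 'D_ez phi p) =
  2 * (rint mu (fun p => w p * (phi p * g p)) + rint mu (fun p => w p * ('D_ex phi p * v p))).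
Proof.
move=> d00 Hz Hx Lu Lv Lw Lg Huv Huw Hvg tphi.
have hez : (ez : R * R) = ex \/ (ez : R * R) = ez by right.
have hex : (ex : R * R) = ex \/ (ex : R * R) = ez by left.
have O21 : Om2 `<=` Om1.
  by move=> p /(Hx p 0); rewrite normr0 scale0r addr0; apply; exact: ltW.
have O1 : Om1 `<=` Om.
  by move=> p /(Hz p 0); rewrite normr0 scale0r addr0; apply; exact: ltW.
have tphi1 := test_sub_dom O21 tphi.
have tDphi := test_D hex tphi; have tDphi1 := test_sub_dom O21 tDphi.
have [M M0 HM] := test_bound tphi; have mphi := test_measurable tphi.
have [N N0 HN] := test_bound tDphi; have mDphi := test_measurable tDphi.
have H1 := test_quot_cvg hez d00 (Lv.2) tphi.
pose sh (f : plane -> R) k (p : plane) := f (p + step d0 k *: ez).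
have Lsh f k : L2 mu f -> L2 mu (sh f k) by move=> Lf; exact: L2_shift.
(* The quotient of v^2 is that of [v] times [vv], and [gg] is the x-derivative of [vv]. *)
pose vv k p := sh v k p + 1 * v p; pose gg k p := sh g k p + 1 * g p.
have Lvv k : L2 mu (vv k) by apply: L2D; [exact: Lsh|exact: L2Z].
have Lgg k : L2 mu (gg k) by apply: L2D; [exact: Lsh|exact: L2Z].
have stepO k p : Om1 p -> Om (p + step d0 k *: ez).
  move=> /(Hz p (step d0 k)); apply; rewrite ger0_norm ?step_le//.
  by apply: ltW; exact: step_gt0.
have Hvv k : weak_deriv Om1 ex (vv k) (gg k).
  apply: weak_deriv_lin => //; try exact: Lsh.
    exact: (weak_deriv_shift hex (stepO k) Lv Lg Hvg).
  exact: weak_deriv_sub Hvg.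
have Hww k : weak_deriv Om1 ex (dquot ez (step d0 k) u) (dquot ez (step d0 k) v).
  have H : weak_deriv Om1 ex (fun p => sh u k p + (-1) * u p) (fun p => sh v k p + (-1) * v p).
    apply: weak_deriv_lin => //; try exact: Lsh.
      exact: (weak_deriv_shift hex (stepO k) Lu Lv Huv).
    exact: weak_deriv_sub Huv.
  move=> theta tt; have := H theta tt.
  have tD := test_D hex tt.
  have L1a : L1 mu (fun p => (sh u k p + -1 * u p) * 'D_ex theta p).
    by apply: L2_testM tD; apply: L2D; [exact: Lsh|exact: L2Z].
  have L1b : L1 mu (fun p => (sh v k p + -1 * v p) * theta p).
    by apply: L2_testM tt; apply: L2D; [exact: Lsh|exact: L2Z].
  move=> /(congr1 ( *%R (step d0 k)^-1)); rewrite mulrN -!rintZ// => E.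
  transitivity (rint mu (fun p => (step d0 k)^-1 * ((sh u k p + -1 * u p) * 'D_ex theta p))).
    by apply: eq_rint => p; rewrite /dquot /sh; ring.
  by rewrite E; congr (- _); apply: eq_rint => p; rewrite /dquot /sh; ring.
(* As the quotient of [v] is the x-derivative of the quotient of [u], the product rule moves d_x
   onto [phi] and [vv]. *)
have E k : rint mu (fun p => dquot ez (step d0 k) (fun p => v p ^+ 2) p * phi p) =
    - (rint mu (fun p => dquot ez (step d0 k) u p * (phi p * gg k p)) +
       rint mu (fun p => dquot ez (step d0 k) u p * ('D_ex phi p * vv k p))).
  have Ldu := L2_dquot ez (step d0 k) Lu; have Ldv := L2_dquot ez (step d0 k) Lv.
  have := weak_deriv_mul hex d00 Hx Ldu Ldv (Lvv k) (Lgg k) (Hww k) (Hvv k) tphi.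
  have La : L1 mu (fun p => dquot ez (step d0 k) v p * vv k p * phi p).
    by apply: eq_L1 (L2_L1M Ldv (L2_bddM mphi HM (Lvv k))) => p; ring.
  have Lb : L1 mu (fun p => dquot ez (step d0 k) u p * (phi p * gg k p)).
    exact: L2_L1M Ldu (L2_bddM mphi HM (Lgg k)).
  have -> : rint mu (fun p => (dquot ez (step d0 k) v p * vv k p + gg k p * dquot ez (step d0 k) u p) * phi p) =
      rint mu (fun p => dquot ez (step d0 k) v p * vv k p * phi p) +
      rint mu (fun p => dquot ez (step d0 k) u p * (phi p * gg k p)).
    by rewrite -rintD//; apply: eq_rint => p; ring.
  have -> : rint mu (fun p => dquot ez (step d0 k) (fun p => v p ^+ 2) p * phi p) =
      rint mu (fun p => dquot ez (step d0 k) v p * vv k p * phi p).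
    by apply: eq_rint => p; rewrite /dquot /vv /sh; ring.
  have -> : rint mu (fun p => dquot ez (step d0 k) u p * ('D_ex phi p * vv k p)) =
      rint mu (fun p => dquot ez (step d0 k) u p * vv k p * 'D_ex phi p).
    by apply: eq_rint => p; ring.
  move=> ->; ring.
have c2 f : L2 mu f -> nrm mu (fun p => (sh f k p + 1 * f p) - 2 * f p) @[k --> \oo] --> 0.
  move=> Lf; have := nrm_step_cvg0 d0 hez Lf.
  apply: cvg_trans; apply: near_eq_cvg; near=> k.
  by apply: eq_nrm => p; rewrite /sh; ring.
have H2 := dquot_cvg hez d00 Hz Lu Lw Huw tphi1 Lgg (L2Z 2 Lg) (c2 _ Lg).
have H3 := dquot_cvg hez d00 Hz Lu Lw Huw tDphi1 Lvv (L2Z 2 Lv) (c2 _ Lv).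
have H4 := seq_cvgN (seq_cvgD H2 H3).
have E' : (fun k => rint mu (fun p => dquot ez (step d0 k) (fun p => v p ^+ 2) p * phi p)) =
   (fun k => - (rint mu (fun p => dquot ez (step d0 k) u p * (phi p * gg k p)) +
       rint mu (fun p => dquot ez (step d0 k) u p * ('D_ex phi p * vv k p)))).
  by apply/funext => k; rewrite E.
rewrite E' in H1.
have /(congr1 -%R) := seq_cvg_unique H1 H4; rewrite !opprK => ->.
rewrite mulrDr -!rintZ; last 2 first.
- exact: (L2_L1M Lw (L2_bddM mDphi HN Lv)).
- exact: (L2_L1M Lw (L2_bddM mphi HM Lg)).
by congr (_ + _); apply: eq_rint => p; ring.
Unshelve. all: by end_near. Qed.

(** Compactness keeps the support of [phi] away from the complement of [Om]. Two nested
    neighbourhoods are produced because [weak_deriv_sqr_ez] shifts in z and then in x. *)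
Lemma test_nbhs (Om : set (R * R)) phi : open Om -> test_function Om phi ->
  exists (Om1 Om2 : set (R * R)) (d0 : R), [/\ 0 < d0,
    forall e p s, e = ex \/ e = ez -> Om1 p -> `|s| <= d0 -> Om (p + s *: e),
    forall e p s, e = ex \/ e = ez -> Om2 p -> `|s| <= d0 -> Om1 (p + s *: e) &
    test_function Om2 phi].
Proof.
move=> oO [sphi [K [cK KO] K0]].
have [del del0 Hdel] : exists2 del : R, 0 < del & forall p q, K p -> `|q - p| < del -> Om q.
  (* Otherwise a sequence in [K], at vanishing distance from points outside [Om], clusters at a
     point of [K], which is interior to [Om]. *)
  apply: contrapT => nH.
  have {}nH (k : nat) : exists pq : (R * R) * (R * R),
      [/\ K pq.1, `|pq.2 - pq.1| < k.+1%:R^-1 & ~ Om pq.2].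
    apply: contrapT => nE; apply: nH; exists k.+1%:R^-1; first by rewrite invr_gt0 ltr0n.
    by move=> p q Kp pq; apply: contrapT => nO; apply: nE; exists (p, q).
  pose x k := (projT1 (cid (nH k))).1; pose y k := (projT1 (cid (nH k))).2.
  have Kx k : K (x k) by rewrite /x; case: (cid _) => ? [].
  have xy k : `|y k - x k| < k.+1%:R^-1 by rewrite /x /y; case: (cid _) => ? [].
  have nOy k : ~ Om (y k) by rewrite /y; case: (cid _) => ? [].
  have FK : (x @ \oo) K by exists 0%N => // k _; exact: Kx.
  have [p [Kp clp]] := cK (x @ \oo) _ FK.
  have /nbhs_ballP[r /= r0 rO] : nbhs p Om by apply: open_nbhs_nbhs; split => //; exact: KO.
  have r20 : 0 < r / 2 by rewrite divr_gt0.
  have FA : (x @ \oo) [set q | exists2 k : nat, k.+1%:R^-1 < r / 2 & x k = q].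
    have [N _ HN] := near_infty_natSinv_lt (PosNum r20).
    by exists N => // k Nk; exists k => //; exact: HN.
  have [q [[k kr xkq] pq]] := clp _ _ FA (nbhsx_ballx p _ r20).
  apply: (nOy k); apply: rO; rewrite -ball_normE /=.
  rewrite -ball_normE /= in pq; rewrite -xkq in pq.
  apply: (le_lt_trans (ler_distD (x k) _ _)); rewrite (splitr r); apply: ltrD => //.
  by rewrite distrC; exact: lt_trans (xy k) kr.
have cl (e : R * R) (s : R) : e = ex \/ e = ez -> `|s| <= del / 4 -> `|s *: e| <= del / 4.
  by move=> he sd; apply: (le_trans (basis_scale_norm s he)).
(* Shifts by at most del / 4 lead from the del / 4 neighbourhood into the del / 2 neighbourhood, and
   from there into [Om]. *)
exists [set q | exists2 p, K p & `|q - p| < del / 2].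
exists [set q | exists2 p, K p & `|q - p| < del / 4].
exists (del / 4); split.
- by rewrite divr_gt0.
- move=> e q s he [p Kp qp] sd; apply: (Hdel p) => //.
  have -> : q + s *: e - p = (q - p) + s *: e by rewrite addrAC.
  have := ler_normD (q - p) (s *: e); have := cl e s he sd; lra.
- move=> e q s he [p Kp qp] sd; exists p => //.
  have -> : q + s *: e - p = (q - p) + s *: e by rewrite addrAC.
  have := ler_normD (q - p) (s *: e); have := cl e s he sd; lra.
- split => //; exists K => //; split => // p Kp; exists p => //.
  by rewrite subrr normr0 divr_gt0.
Qed.

(** By [weak_deriv_sqr_ez] the v^2 term yields minus the integral of w v d_x phi, which cancels the
    first flux term, and minus that of w g phi; the cube contributes (1/6) 3 v^2 g phi. *)
Lemma entropy_identity (Om : set (R * R)) (u v w g : plane -> R) phi : open Om ->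
  L2 mu u -> L2 mu v -> L2 mu w -> L2 mu g -> L2 mu (fun p => v p ^+ 2) ->
  weak_deriv Om ex u v -> weak_deriv Om ez u w -> weak_deriv Om ex v g ->
  test_function Om phi ->
  rint mu (fun p => (v p * w p - 6^-1 * v p ^+ 3) * 'D_ex phi p +
                    - (2^-1 * v p ^+ 2) * 'D_ez phi p) =
  - rint mu (fun p => (w p - 2^-1 * v p ^+ 2) * g p * phi p).
Proof.
move=> oO Lu Lv Lw Lg Lv2 Huv Huw Hvg tphi.
have [Om1 [Om2 [d0 [d00 H1 H2 tphi2]]]] := test_nbhs oO tphi.
have hez : (ez : R * R) = ex \/ (ez : R * R) = ez by right.
have hex : (ex : R * R) = ex \/ (ex : R * R) = ez by left.
have O21 : Om2 `<=` Om1.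
  by move=> p Op; have := H2 ex p 0 hex Op; rewrite normr0 scale0r addr0; apply; exact: ltW.
have tphi1 := test_sub_dom O21 tphi2.
have tDx := test_D hex tphi; have tDz := test_D hez tphi.
have [M M0 HM] := test_bound tphi; have mphi := test_measurable tphi.
have [N N0 HN] := test_bound tDx; have mDphi := test_measurable tDx.
have [N' _ HN'] := test_bound tDz; have mDz := test_measurable tDz.
have E1 := weak_deriv_sqr_ez d00 (fun p s => H1 ez p s hez) (fun p s => H2 ex p s hex)
  Lu Lv Lw Lg Huv Huw Hvg tphi2.
have E2 := weak_deriv_cube hex d00 (fun p s => H1 ex p s hex) Lv Lg Lv2 Hvg tphi1.
have L3 : L1 mu (fun p => v p ^+ 3 * 'D_ex phi p).
  apply: eq_L1 (L2_L1M Lv2 (L2_bddM mDphi HN Lv)) => p.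
  by rewrite exprSr; ring.
have La : L1 mu (fun p => w p * ('D_ex phi p * v p)).
  exact: (L2_L1M Lw (L2_bddM mDphi HN Lv)).
have Lb : L1 mu (fun p => w p * (phi p * g p)).
  exact: (L2_L1M Lw (L2_bddM mphi HM Lg)).
have Lc : L1 mu (fun p => v p ^+ 2 * 'D_ez phi p) by exact: L2_testM tDz.
have Ld : L1 mu (fun p => v p ^+ 2 * (phi p * g p)).
  exact: (L2_L1M Lv2 (L2_bddM mphi HM Lg)).
transitivity (rint mu (fun p => w p * ('D_ex phi p * v p)) +
   (- 6^-1) * rint mu (fun p => v p ^+ 3 * 'D_ex phi p) +
   (- 2^-1) * rint mu (fun p => v p ^+ 2 * 'D_ez phi p)).
  rewrite -!rintZ// -rintD//; last by apply: L1Z.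
  rewrite -rintD//; [|by apply: L1D => //; exact: L1Z|exact: L1Z].
  by apply: eq_rint => p; ring.
rewrite E1 E2.
have -> : rint mu (fun p => 3 * (v p ^+ 2 * g p) * phi p) =
    3 * rint mu (fun p => v p ^+ 2 * (phi p * g p)).
  by rewrite -rintZ//; apply: eq_rint => p; ring.
transitivity (- (rint mu (fun p => w p * (phi p * g p)) +
    (- 2^-1) * rint mu (fun p => v p ^+ 2 * (phi p * g p)))).
  by field.
congr (- _); rewrite -rintZ// -rintD//; last exact: L1Z.
by apply: eq_rint => p; ring.
Qed.

End EntropyIdentity.

(** * The fundamental lemma *)

Section FundamentalLemma.
Context {R : realType}.
Local Notation plane := (measurableTypeR R * measurableTypeR R)%type.
Local Notation mu := (@leb2 R).
Implicit Types (Om : set (R * R)) (p q : R * R) (phi theta : R * R -> R).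

Lemma ae_imp (P Q : plane -> Prop) : (forall p, P p -> Q p) ->
  {ae mu, forall p, P p} -> {ae mu, forall p, Q p}.
Proof. by move=> PQ; apply: (@filterS _ _ (ae_filter_ringOfSetsType mu)). Qed.

Lemma L1_testM Om (h : plane -> R) phi : L1 mu h -> test_function Om phi ->
  L1 mu (fun p => h p * phi p).
Proof.
move=> Lh tphi; have [M M0 HM] := test_bound tphi.
apply: (@L1_dom _ plane R mu _ (fun p : plane => M * `|h p|)).
- by apply: measurable_funM; [exact: L1_meas Lh|exact: test_measurable tphi].
- by apply: L1Z; exact: L1_norm.
- by move=> p; rewrite normrM mulrC ler_wpM2r.
Qed.

Lemma L1_indicM (h : plane -> R) (A : set plane) : measurable A -> L1 mu h ->
  L1 mu (fun p => h p * \1_A p).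
Proof.
move=> mA Lh; apply: (@L1_dom _ plane R mu _ (fun p : plane => `|h p|)).
- by apply: measurable_funM; [exact: L1_meas Lh|exact: measurable_indic].
- exact: L1_norm.
- move=> p; rewrite normrM ler_piMr//; have /andP[i0 i1] := indic01 A p.
  by rewrite ger0_norm.
Qed.

(** [h] is only integrable, while the indicator is approximated in L^2. Where |h| > N the integral
    of |h| is small; elsewhere |h| <= N and Cauchy-Schwarz on a box applies. The level N is fixed
    before the approximation. *)
Lemma orthogonal_test_indic Om (h : plane -> R) phi (A : set plane) : L1 mu h ->
  (forall theta, test_function Om theta -> rint mu (fun p => h p * theta p) = 0) ->
  test_function Om phi -> measurable A -> rint mu (fun p => h p * phi p * \1_A p) = 0.
Proof.
move=> Lh H tphi mA.
have [M M0 HM] := test_bound tphi.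
have [_ [K [cK _] K0]] := tphi; have [r r0 Kr] := compact_box cK.
have mh := L1_meas Lh; have mphi := test_measurable tphi.
pose B (N : nat) : set plane := [set p | N%:R < `|h p|].
have mB N : measurable (B N).
  rewrite -[X in measurable X]setTI.
  have mnh : measurable_fun setT (fun p => `|h p|) by exact: measurableT_comp.
  have := mnh measurableT _ (measurable_itv `]N%:R, +oo[); congr measurable.
  by apply/seteqP; split => p /=; rewrite in_itv/= andbT.
pose b N p := `|h p| * \1_(B N) p.
have Lb N : L1 mu (b N) by apply: L1_indicM => //; exact: L1_norm.
have b0 : rint mu (b N) @[N --> \oo] --> 0.
  have [||||_] := @rint_dominated_cvg _ plane R mu b (cst 0) (fun p => `|h p|).
  - by move=> N; exact: L1_meas (Lb N).
  - exact: L1_norm.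
  - move=> N p; rewrite /b normrM normr_id ler_piMr//.
    by have /andP[i0 i1] := indic01 (B N) p; rewrite ger0_norm.
  - move=> p; apply: cvg_near_cst; near=> N.
    rewrite /b indicE memNset ?mulr0//= => hN.
    have : `|h p| <= N%:R by near: N; exact: nbhs_infty_ger.
    by rewrite leNgt hN.
  - by have -> : rint mu (cst 0) = 0 by rewrite /rint /Rintegral integral0.
have Q := measurable_box r; have finQ := box_fin r.
have L1i : L2 mu (\1_(box r) : plane -> R).
  apply: eq_L2 (L2_indic_box r (@measurableT _ plane)) => p.
  by rewrite [X in _ * X]indicE mem_set// mulr1.
apply/eqP; rewrite -normr_le0; apply/ler_addgt0Pr => eps eps0; rewrite add0r.
have M1 : 0 < M + 1 by rewrite ltr_wpDl.
have e1 : 0 < eps / (2 * (M + 1)) by rewrite divr_gt0// mulr_gt0.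
have [N HN] := cvg0_ex b0 e1.
have n0 := nrm_ge0 mu (\1_(box r) : plane -> R).
pose C := (M * N%:R * nrm mu (\1_(box r) : plane -> R)) + 1.
have C0 : 0 < C by rewrite /C ltr_wpDl// !mulr_ge0.
have e2 : 0 < eps / (2 * C) by rewrite divr_gt0// mulr_gt0.
have [_ /(_ _ e2)[f [sf f01] Hf]] := measurable_approximable Q finQ mA.
have mf : measurable_fun setT (f : plane -> R) by exact: smooth_measurable.
have dif p : `|\1_A p - f p| <= 1.
  have /andP[? ?] := indic01 A p; have /andP[? ?] := f01 p.
  by rewrite ler_norml; apply/andP; split; lra.
have md : measurable_fun setT (fun p : plane => \1_A p - f p : R).
  by apply: measurable_funB => //; exact: measurable_indic.
have LQd : L2 mu (fun p => \1_(box r) p * (\1_A p - f p)) by exact: L2_Q.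
have Lhp := L1_testM Lh tphi.
have Lhpd : L1 mu (fun p => h p * phi p * (\1_A p - f p)).
  apply: (L1_dom _ (L1_norm Lhp)).
    by apply: measurable_funM => //; exact: L1_meas Lhp.
  by move=> p; rewrite normrM ler_piMr.
have -> : rint mu (fun p => h p * phi p * \1_A p) =
    rint mu (fun p => h p * phi p * (\1_A p - f p)).
  have tf : test_function Om (fun p => phi p * f p) by exact: test_mul.
  rewrite -[RHS]addr0 -(H _ tf) -rintD//; last exact: L1_testM tf.
  by apply: eq_rint => p; ring.
apply: (le_trans (rint_norm Lhpd)).
have LQd2 : L1 mu (fun p => \1_(box r) p * `|\1_(box r) p * (\1_A p - f p)|).
  apply: L2_L1M => //; apply: (L2_dom _ LQd); last by move=> p; rewrite normr_id.
  by apply: measurableT_comp => //; case: LQd.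
apply: (@le_trans _ _ (rint mu (fun p => M * b N p +
    M * N%:R * (\1_(box r) p * `|\1_(box r) p * (\1_A p - f p)|)))).
  apply: rint_le.
  - exact: L1_norm.
  - by apply: L1D; apply: L1Z.
  move=> p; rewrite !normrM.
  have [bp|nbp] := pselect (box r p); last first.
    rewrite (K0 p) => [|/Kr//]; rewrite normr0 mulr0 mul0r indicE memNset//= mul0r mulr0 addr0.
    by rewrite mulr_ge0// mulr_ge0//; have /andP[] := indic01 (B N) p.
  rewrite [\1_(box r) p]indicE mem_set//= normr1 !mul1r.
  have HMp := HM p; have Hd := dif p.
  have d0 := normr_ge0 (\1_A p - f p); have h0 := normr_ge0 (h p).
  have p0 := normr_ge0 (phi p).
  have hp : `|h p| * `|phi p| <= M * `|h p| by rewrite mulrC ler_wpM2r.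
  rewrite /b [\1_(B N) p]indicE; have [Bp|nBp] := pselect (B N p).
    rewrite mem_set//= mulr1.
    have X : 0 <= M * N%:R * `|\1_A p - f p| by rewrite !mulr_ge0.
    have Y : `|h p| * `|phi p| * `|\1_A p - f p| <= `|h p| * `|phi p|.
      by rewrite ler_piMr// mulr_ge0.
    lra.
  rewrite memNset//= !mulr0 add0r.
  apply: ler_wpM2r => //; apply: (le_trans hp); apply: ler_wpM2l => //.
  by rewrite leNgt; apply/negP.
rewrite rintD; [|exact: L1Z|exact: L1Z].
rewrite !rintZ//.
have H1 : rint mu (b N) <= eps / (2 * (M + 1)) by exact: le_trans (ler_norm _) HN.
have LQn : L2 mu (fun p => `|\1_(box r) p * (\1_A p - f p)|).
  apply: (L2_dom _ LQd); last by move=> p; rewrite normr_id.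
  by apply: measurableT_comp => //; case: LQd.
have H2 := le_trans (ler_norm _) (cauchy_schwarz L1i LQn).
have H3 : nrm mu (fun p => `|\1_(box r) p * (\1_A p - f p)|) <= eps / (2 * C).
  apply: le_trans Hf; rewrite le_eqVlt; apply/orP; left; apply/eqP.
  by rewrite /nrm; congr Num.sqrt; apply: eq_rint => p; rewrite real_normK ?num_real.
have H4 : M * rint mu (b N) <= eps / 2.
  apply: (@le_trans _ _ (M * (eps / (2 * (M + 1))))); first by rewrite ler_wpM2l.
  have -> : eps / 2 = (M + 1) * (eps / (2 * (M + 1))) by field; rewrite gt_eqF.
  by apply: ler_wpM2r; [exact: ltW|rewrite lerDl].
have H5 : M * N%:R * rint mu (fun p => \1_(box r) p * `|\1_(box r) p * (\1_A p - f p)|) <= eps / 2.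
  apply: (@le_trans _ _ (M * N%:R * (nrm mu (\1_(box r) : plane -> R) * (eps / (2 * C))))).
    apply: ler_wpM2l; first by rewrite mulr_ge0.
    by apply: (le_trans H2); apply: ler_wpM2l.
  have -> : eps / 2 = C * (eps / (2 * C)) by field; rewrite gt_eqF.
  by rewrite mulrA; apply: ler_wpM2r; [exact: ltW|rewrite /C lerDl].
rewrite (splitr eps); exact: lerD.
Unshelve. all: by end_near. Qed.

(** With A the set where h > 0, |h phi| = 2 h phi 1_A - h phi, and both terms integrate to 0. *)
Lemma orthogonal_test_ae Om (h : plane -> R) phi : L1 mu h ->
  (forall theta, test_function Om theta -> rint mu (fun p => h p * theta p) = 0) ->
  test_function Om phi -> (forall p, 0 <= phi p) ->
  {ae mu, forall p, 0 < phi p -> h p = 0}.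
Proof.
move=> Lh H tphi phi0.
have mh := L1_meas Lh; have mphi := test_measurable tphi.
pose A : set plane := [set p | 0 < h p].
have mA : measurable A.
  rewrite -[X in measurable X]setTI.
  have := mh measurableT _ (measurable_itv `]0, +oo[); congr measurable.
  by apply/seteqP; split => p /=; rewrite in_itv/= andbT.
have Lhp := L1_testM Lh tphi.
have H1 := orthogonal_test_indic Lh H tphi mA.
have E : (fun p => `|h p * phi p|) =
    (fun p => 2 * (h p * phi p * \1_A p) - h p * phi p).
  apply/funext => p; rewrite normrM (ger0_norm (phi0 p)) indicE.
  have [hp|hp] := ltP 0 (h p).
    by rewrite mem_set//= gtr0_norm//; ring.
  rewrite memNset//=; last by apply/negP; rewrite -leNgt.
  by rewrite ler0_norm//; ring.
have LhA : L1 mu (fun p => h p * phi p * \1_A p) by exact: L1_indicM.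
have I0 : rint mu (fun p => `|h p * phi p|) = 0.
  rewrite E rintB//; last exact: L1Z.
  by rewrite rintZ// H1 mulr0 H// subr0.
have E0 : (\int[mu]_p `|(h p * phi p)%:E| = 0)%E.
  have Ln := L1_norm Lhp.
  rewrite -(@fineK _ (\int[mu]_p `|(h p * phi p)%:E|)%E).
    by congr EFin; exact: I0.
  exact: (integrable_fin_num measurableT Ln).
have mhp : measurable_fun setT (fun p : plane => (h p * phi p)%:E).
  by apply/measurable_EFinP; exact: measurable_funM.
have := (ae_eq_integral_abs mu measurableT mhp).1 E0.
apply: ae_imp => p /= /(_ Logic.I) [] /eqP.
rewrite mulf_eq0; case/orP => /eqP p0; first by [].
by rewrite p0 ltxx.
Qed.

(** Countably many rational squares whose closures lie in [Om] cover it. On each of them a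
    translated [boxbump] is positive, so [h] vanishes there almost everywhere. *)
Lemma fundamental_lemma Om (h : plane -> R) : open Om -> L1 mu h ->
  (forall theta, test_function Om theta -> rint mu (fun p => h p * theta p) = 0) ->
  {ae mu, forall p, Om p -> h p = 0}.
Proof.
move=> oO Lh H.
pose c (t : rat * rat * rat) : R * R := (ratr t.1.1, ratr t.1.2).
pose good (t : rat * rat * rat) := 0 < (ratr t.2 : R) /\
  forall q, `|q - c t| <= ratr t.2 -> Om q.
pose phi (t : rat * rat * rat) p := boxbump (ratr t.2) 0 (p - c t).
have aet (t : rat * rat * rat) : {ae mu, forall p, good t -> `|p - c t| < ratr t.2 -> h p = 0}.
  have [[r0 gt]|ng] := pselect (good t); last by apply/aeW => p.
  have tphi : test_function Om (phi t).
    split; first by move=> n; apply: (@Cn_shift R n _ (- c t)); exact: boxbump_smooth.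
    have [sb [L [cL _] L0]] := boxbump_test 0%N r0.
    exists [set q | `|q - c t| <= ratr t.2]; last first.
      move=> p /= /negP; rewrite -ltNge => pr; rewrite /phi boxbump0//.
      by move=> /box_norm /(lt_trans pr); rewrite ltxx.
    split => //.
    have -> : [set q : R * R | `|q - c t| <= ratr t.2] =
      (fun q => q + c t) @` (`[- ratr t.2, ratr t.2] `*` `[- ratr t.2, ratr t.2]).
      apply/seteqP; split => q /=.
        rewrite prod_normE ge_max /= !ler_norml => /andP[/andP[a1 a2] /andP[b1 b2]].
        by exists (q - c t); rewrite ?subrK//=; split; rewrite /= in_itv/=; apply/andP.
      move=> [y [/=]]; rewrite !in_itv/= => y1 y2 <-; rewrite addrK.
      by rewrite prod_normE ge_max /= !ler_norml y1 y2.
    apply: continuous_compact; last by apply: compact_setX; exact: segment_compact.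
    by apply: continuous_subspaceT => q; apply: cvgD; [exact: cvg_id|exact: cvg_cst].
  have phi0 p : 0 <= phi t p by have /andP[] := @boxbump01 R (ratr t.2) 0 (p - c t).
  have Ho := orthogonal_test_ae Lh H tphi phi0.
  apply: ae_imp Ho => p Hp _ pr; apply: Hp.
  have /box_norm bp := pr; have [p1 p2] := (boxE _ r0).1 bp.
  by rewrite /phi /boxbump mulr_gt0// /flat mulr_gt0 ?subr_gt0// expr0 mul1r expR_gt0.
have HA1 (n : nat) : {ae mu, forall p, forall t,
    @unpickle (rat * rat * rat)%type n = Some t -> good t ->
    `|(p : R * R) - c t| < ratr t.2 -> h p = 0}.
  case E : (unpickle n) => [t|]; last by apply/aeW.
  have Ht := aet t; by apply: ae_imp Ht => p Hp t' [<-].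
have HA := ae_foralln HA1.
move: HA; apply: ae_imp => p Hp Op.
have /nbhs_ballP[d /= d0 pdO] : nbhs p Om by exact: open_nbhs_nbhs.
have [r] := @rat_in_itvoo R 0 (d / 2) (divr_gt0 d0 (ltr0n R 2)).
rewrite in_itv /= => /andP[r0 rd].
have Hc (x : R) : exists a : rat, `|x - ratr a| < ratr r.
  have [|a] := @rat_in_itvoo R (x - ratr r) (x + ratr r); first by lra.
  rewrite in_itv /= => /andP[c1 c2]; exists a; rewrite ltr_norml; lra.
have [a1 Ha1] := Hc p.1; have [a2 Ha2] := Hc p.2.
have pc : `|p - c (a1, a2, r)| < ratr r by rewrite prod_normE gt_max Ha1 Ha2.
apply: (Hp (pickle (a1, a2, r)) (a1, a2, r)) => //; first exact: pickleK.
split => // q qc; apply: pdO; rewrite -ball_normE /=.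
apply: (le_lt_trans (ler_distD (c (a1, a2, r)) _ _)).
rewrite (splitr d); apply: ltrD; first exact: lt_trans pc rd.
by rewrite distrC; exact: le_lt_trans qc rd.
Qed.

Lemma L2_ae (f g : plane -> R) : measurable_fun setT f -> L2 mu g ->
  {ae mu, forall p, f p = g p} -> L2 mu f.
Proof.
move=> mf [mg Lg] fg; split => //; apply/integrableP; split.
  by apply/measurable_EFinP; exact: measurable_funX.
have /integrableP[_] := Lg; apply: le_lt_trans.
rewrite le_eqVlt; apply/orP; left; apply/eqP.
apply: ae_eq_integral => //.
- by apply: measurableT_comp => //; apply/measurable_EFinP; exact: measurable_funX.
- by apply: measurableT_comp => //; apply/measurable_EFinP; exact: measurable_funX.
by move: fg; apply: ae_imp => p /= -> _.
Qed.

Lemma weak_deriv_unique Om e (f g g' : plane -> R) : open Om ->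
  weak_deriv Om e f g -> weak_deriv Om e f g' -> L1 mu g -> L1 mu g' ->
  {ae mu, forall p, Om p -> g p = g' p}.
Proof.
move=> oO Hg Hg' Lg Lg'.
have := @fundamental_lemma Om (fun p => g p - g' p) oO (L1B Lg Lg') _.
have H theta : test_function Om theta -> rint mu (fun p => (g p - g' p) * theta p) = 0.
  move=> tt; transitivity (rint mu (fun p => g p * theta p) - rint mu (fun p => g' p * theta p)).
    rewrite -rintB; [|exact: L1_testM tt|exact: L1_testM tt].
    by apply: eq_rint => p; rewrite mulrBl.
  by apply/eqP; rewrite subr_eq0; apply/eqP/oppr_inj; rewrite -Hg// Hg'.
move=> /(_ H); apply: ae_imp => p Hp Op.
by apply/eqP; rewrite -subr_eq0 Hp.
Qed.

End FundamentalLemma.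

(** * The energy bound *)

Section EnergyBound.
Context {R : realType}.
Local Notation plane := (measurableTypeR R * measurableTypeR R)%type.
Local Notation mu := (@leb2 R).
Implicit Types (Om : set (R * R)) (p q : R * R) (phi : R * R -> R).

Lemma restr_in Om (f : R * R -> R) p : Om p -> (f \_ Om) p = f p.
Proof. by move=> Op; rewrite patchE mem_set. Qed.

Lemma restr_out Om (f : R * R -> R) p : ~ Om p -> (f \_ Om) p = 0.
Proof. by move=> Op; rewrite patchE memNset. Qed.

Lemma Lfun_powR (r : R) (f : plane -> R) : 0 < r -> f \in Lfun mu r%:E ->
  measurable_fun setT f /\ L1 mu (fun p => `|f p| `^ r).
Proof.
move=> r0 Hf; have mf : measurable_fun setT f.
  by have := sub_Lfun_mfun Hf; rewrite inE.
split => //.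
have fin : ('N[mu]_r%:E[EFin \o f] < +oo)%E.
  by have := sub_Lfun_finLfun Hf; rewrite inE.
apply/integrableP; split.
  apply/measurable_EFinP; apply: (measurableT_comp (measurable_powR r)); exact: measurableT_comp.
have := poweR_lty r fin.
rewrite poweR_Lnorm ?gt_eqF//; apply: le_lt_trans.
rewrite le_eqVlt; apply/orP; left; apply/eqP.
by apply: eq_integral => p _ /=; rewrite ger0_norm ?powR_ge0// -poweR_EFin.
Qed.

Lemma Lp2_L2 Om (f : R * R -> R) : Lp Om 2%:E f -> L2 mu (f \_ Om).
Proof.
move=> /(Lfun_powR (ltr0n R 2))[mf Lf]; split => //.
apply: eq_L1 Lf => p; rewrite (powR_mulrn 2)//.
by rewrite real_normK ?num_real.
Qed.

Lemma rint_restr Om (f : R * R -> R) :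
  \int[mu]_(p in Om) f p = rint mu (f \_ Om).
Proof. by rewrite Rintegral_mkcond. Qed.

Lemma is_weak_derivative_restr Om e u g : is_weak_derivative Om e u g ->
  weak_deriv Om e (u \_ Om) (g \_ Om).
Proof.
move=> [_ _ H] phi tphi.
transitivity (\int[mu]_(p in Om) (u p * 'D_e phi p)).
  rewrite rint_restr; apply: eq_rint => p.
  have [Op|nOp] := pselect (Om p); first by rewrite !restr_in.
  by rewrite !restr_out// mul0r.
rewrite H// rint_restr; congr (- _); apply: eq_rint => p.
have [Op|nOp] := pselect (Om p); first by rewrite !restr_in.
by rewrite !restr_out// mul0r.
Qed.

Lemma weak_derivativeP Om (r : \bar R) e u : weak_derivative_in Om r e u ->
  is_weak_derivative Om e u (weak_derivative Om e u).
Proof.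
move=> [g Hg _]; rewrite /weak_derivative.
by case: xgetP => [y _ //|/(_ g)].
Qed.

Lemma bounded_set_box Om : bounded_set Om -> exists2 r : R, 0 < r & Om `<=` box r.
Proof.
move=> [M [_ HM]]; exists (`|M| + 2) => [|p Op]; first by rewrite ltr_wpDl.
apply/box_norm; apply: (@le_lt_trans _ _ (`|M| + 1)); last by rewrite ltrD2l ltr1n.
by apply: HM => //; apply: (le_lt_trans (ler_norm M)); rewrite ltrDl.
Qed.

(* The pairing of -div Sigma(a, b) with phi. *)
Definition flux_pairing (a b : R * R -> R) phi :=
  - rint mu (fun p => (a p * b p - 6^-1 * a p ^+ 3) * 'D_ex phi p +
                      - (2^-1 * a p ^+ 2) * 'D_ez phi p).

Lemma is_weak_derivative_measurable Om e u g : open Om ->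
  is_weak_derivative Om e u g -> measurable_fun setT (g \_ Om : plane -> R).
Proof.
move=> oO [_ [mg _] _]; apply/(measurable_restrictT _ _).1 => //.
exact: open_measurable_plane.
Qed.

Lemma L2_L1_restr Om (f : R * R -> R) : bounded_set Om -> L2 mu (f \_ Om) -> L1 mu (f \_ Om).
Proof.
move=> bO Lf; have [r r0 Or] := bounded_set_box bO.
have Q := measurable_box r; have finQ := box_fin r.
have L1i : L2 mu (\1_(box r) : plane -> R).
  apply: eq_L2 (L2_indic_box r (@measurableT _ plane)) => p.
  by rewrite [X in _ * X]indicE mem_set// mulr1.
apply: eq_L1 (L2_L1M Lf L1i) => p; rewrite indicE.
have [Op|nOp] := pselect (Om p); first by rewrite mem_set ?mulr1//; exact: Or.
by rewrite restr_out// mul0r.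
Qed.

(** Some weak derivative is in L^2 by hypothesis; the arbitrary one chosen by [weak_derivative]
    agrees with it almost everywhere in [Om]. *)
Lemma weak_derivative_L2 Om e u : open Om -> bounded_set Om ->
  weak_derivative_in Om 2%:E e u -> L1 mu (weak_derivative Om e u \_ Om) ->
  L2 mu (weak_derivative Om e u \_ Om).
Proof.
move=> oO bO Hin L1w; have Hw := weak_derivativeP Hin.
have [g Hg Lg] := Hin; have {}Lg := Lp2_L2 Lg.
apply: (L2_ae _ Lg); first exact: L1_meas L1w.
have := weak_deriv_unique oO (is_weak_derivative_restr Hw) (is_weak_derivative_restr Hg)
  L1w (L2_L1_restr bO Lg).
apply: ae_imp => p Hp; have [/Hp//|nOp] := pselect (Om p).
by rewrite !restr_out.
Qed.

Lemma energy_ge_pairing Om (eps : R) u phi : open Om -> bounded_set Om ->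
  0 < eps -> H1 Om u ->
  weak_derivative_in Om 2%:E ex (weak_derivative Om ex u) ->
  L1 mu (weak_derivative Om ex u \_ Om) -> L1 mu (weak_derivative Om ez u \_ Om) ->
  test_function Om phi -> (forall p, `|phi p| <= 1) ->
  ((flux_pairing (weak_derivative Om ex u \_ Om) (weak_derivative Om ez u \_ Om) phi)%:E
   <= energy Om eps u)%E.
Proof.
move=> oO bO eps0 [Lu Hux Huz] Huxx Lv Lw tphi phi1.
have wv := is_weak_derivative_restr (weak_derivativeP Hux).
have ww := is_weak_derivative_restr (weak_derivativeP Huz).
have wg := is_weak_derivative_restr (weak_derivativeP Huxx).
have mg := is_weak_derivative_measurable oO (weak_derivativeP Huxx).
have {}Lu := Lp2_L2 Lu; have {}Lv := weak_derivative_L2 oO bO Hux Lv.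
have {}Lw := weak_derivative_L2 oO bO Huz Lw.
rewrite /energy; set v := weak_derivative Om ex u in wv wg mg Lv *.
set w := weak_derivative Om ez u in ww Lw *; set g := weak_derivative Om ex v in wg mg *.
clearbody g w v.
pose A p := (w \_ Om) p - 2^-1 * (v \_ Om) p ^+ 2.
pose H p := eps^-1 * A p ^+ 2 + eps * (g \_ Om) p ^+ 2.
have [mv _] := Lv; have [mw _] := Lw.
have mA : measurable_fun setT (A : plane -> R).
  apply: measurable_funB; first exact: mw.
  by apply: measurable_funM; [exact: measurable_cst|exact: measurable_funX].
have mH : measurable_fun setT (H : plane -> R).
  apply: measurable_funD; apply: measurable_funM; try exact: measurable_cst.
    exact: measurable_funX.
  exact: measurable_funX.
have H0 p : 0 <= H p.
  by rewrite addr_ge0// mulr_ge0 ?sqr_ge0 ?invr_ge0// ltW.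
have -> : (\int[mu]_(p in Om) (eps^-1 * (w p - 2^-1 * v p ^+ 2) ^+ 2 +
    eps * g p ^+ 2)%:E = \int[mu]_p (H p)%:E)%E.
  rewrite integral_mkcond; apply: eq_integral => p _.
  rewrite /H /A; have [Op|nOp] := pselect (Om p).
    by rewrite !restr_in// patchE mem_set.
  by rewrite !restr_out// patchE memNset// !expr0n/= !mulr0 subr0 expr0n/= mulr0 addr0.
(* Infinite energy leaves nothing to prove; finite energy puts both [A] and [g] in L^2. *)
have [->|] := eqVneq (\int[mu]_p (H p)%:E)%E +oo%E.
  by rewrite gt0_muley ?leey// lte_fin invr_gt0.
rewrite -ltey => Hfin.
have LH : L1 mu H.
  apply/integrableP; split; first exact/measurable_EFinP.
  apply: le_lt_trans Hfin; rewrite le_eqVlt; apply/orP; left; apply/eqP.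
  by apply: eq_integral => p _ /=; rewrite ger0_norm.
have LA : L2 mu A.
  split => //; apply: (L1_dom _ (L1Z eps LH)); first exact: measurable_funX.
  move=> p; rewrite ger0_norm ?sqr_ge0// /H mulrDr mulVKf ?gt_eqF// lerDl.
  by have e0 := ltW eps0; apply: mulr_ge0 => //; apply: mulr_ge0 => //; exact: sqr_ge0.
have Lg : L2 mu (g \_ Om).
  split => //; apply: (L1_dom _ (L1Z eps^-1 LH)); first exact: measurable_funX.
  move=> p; rewrite ger0_norm ?sqr_ge0// /H mulrDr mulKf ?gt_eqF// lerDr.
  have e0 : 0 <= eps^-1 by rewrite invr_ge0 ltW.
  by apply: mulr_ge0 => //; apply: mulr_ge0 => //; exact: sqr_ge0.
(* v^2 = 2 (w - A): finite energy lifts [v] to L^4, as the entropy identity requires. *)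
have Lv2 : L2 mu (fun p => (v \_ Om) p ^+ 2).
  apply: eq_L2 (L2Z 2 (L2B Lw LA)) => p.
  by rewrite /A opprB addrCA subrr addr0 mulVKf.
rewrite /flux_pairing (entropy_identity oO Lu Lv Lw Lg Lv2 wv ww wg tphi) opprK.
have -> : (\int[mu]_p (H p)%:E = (rint mu H)%:E)%E.
  by rewrite /rint /Rintegral fineK//; exact: (integrable_fin_num measurableT LH).
rewrite -EFinM lee_fin -rintZ//.
have mphi := test_measurable tphi.
apply: rint_le.
- apply: eq_L1 (L2_L1M LA (L2_bddM mphi phi1 Lg)) => p; rewrite /A; ring.
- exact: L1Z.
move=> p; rewrite -/(A p) /H.
(* AM-GM for A and eps phi g, after multiplication of the claim by eps. *)
have H1 := sqr_ge0 (A p - eps * (phi p * (g \_ Om) p)).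
have H2 : phi p ^+ 2 <= 1 by rewrite -real_normK ?num_real// expr_le1.
rewrite -(ler_pM2l eps0).
have -> : eps * (2^-1 * (eps^-1 * A p ^+ 2 + eps * (g \_ Om) p ^+ 2)) =
  2^-1 * (A p ^+ 2 + eps ^+ 2 * (g \_ Om) p ^+ 2) by field; rewrite gt_eqF.
have H3 : (eps * (g \_ Om) p) ^+ 2 * phi p ^+ 2 <= (eps * (g \_ Om) p) ^+ 2 * 1.
  by rewrite ler_wpM2l ?sqr_ge0.
have -> : eps * (A p * (g \_ Om) p * phi p) = A p * (eps * (phi p * (g \_ Om) p)) by ring.
move: H1 H3; rewrite mulr1 sqrrB !exprMn => H1 H3; lra.
Qed.

End EnergyBound.

(** * Passage to the limit *)

Section FluxLimit.
Context {R : realType}.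
Local Notation plane := (measurableTypeR R * measurableTypeR R)%type.
Local Notation mu := (@leb2 R).
Implicit Types (Om : set (R * R)) (p q : R * R) (phi : R * R -> R).

Lemma Lnorm_cvg0_powR (r : R) (f_ : nat -> plane -> R) (eps : R) : 1 <= r ->
  (forall k, measurable_fun setT (f_ k)) ->
  'N[mu]_r%:E[EFin \o f_ k]%E @[k --> \oo] --> 0%E -> 0 < eps ->
  \forall k \near \oo, L1 mu (fun p => `|f_ k p| `^ r) /\
    rint mu (fun p => `|f_ k p| `^ r) <= eps.
Proof.
move=> r1 mf c0 eps0; have r0 : 0 < r by exact: lt_le_trans r1.
(* For x <= 1 and r >= 1, x^r <= x; hence the cap at 1. *)
pose del := Num.min 1 eps.
have del0 : 0 < del by rewrite lt_min ltr01.
have : \forall k \near \oo, ('N[mu]_r%:E[EFin \o f_ k] < del%:E)%E.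
  apply: (c0 [set x | x < del%:E]%E).
  apply: open_nbhs_nbhs; split; first exact: open_ereal_lt_ereal.
  by rewrite /= lte_fin.
apply: filterS => k Hk.
have N0 := Lnorm_ge0 mu r%:E (EFin \o f_ k).
have Nfin : 'N[mu]_r%:E[EFin \o f_ k]%E \is a fin_num.
  by rewrite ge0_fin_numE// (lt_trans Hk) ?ltry.
have E := poweR_Lnorm mu (EFin \o f_ k) (lt0r_neq0 r0).
rewrite -(fineK Nfin) poweR_EFin in E.
set x := fine _ in E.
have x0 : 0 <= x by exact: fine_ge0.
have xd : x < del by rewrite -lte_fin /x fineK.
have xr : x `^ r <= eps.
  move: x0; rewrite le_eqVlt => /orP[/eqP <-|x0].
    by rewrite powR0 ?gt_eqF// ltW.
  apply: (@le_trans _ _ x); last first.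
    by apply: (le_trans (ltW xd)); rewrite ge_min lexx orbT.
  apply: ge1r_powR => //; rewrite x0/=; apply: (le_trans (ltW xd)).
  by rewrite ge_min lexx.
have Ef : (\int[mu]_p (`|f_ k p| `^ r)%:E = (x `^ r)%:E)%E.
  by rewrite E; apply: eq_integral => p _; rewrite -poweR_EFin.
split; last by rewrite /rint /Rintegral Ef.
apply/integrableP; split.
  apply/measurable_EFinP; apply: (measurableT_comp (measurable_powR r)).
  exact: measurableT_comp.
apply: le_lt_trans (ltry (x `^ r)); rewrite -Ef le_eqVlt; apply/orP; left; apply/eqP.
by apply: eq_integral => p _ /=; rewrite ger0_norm ?powR_ge0.
Qed.

(** With y the square root of |e|, the L^(3/2) error becomes a cube, and the estimates turn
    polynomial. *)
Lemma powR32 (x : R) : 0 <= x -> x `^ (3 / 2) = Num.sqrt x ^+ 3.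
Proof.
move=> x0; rewrite -powR12_sqrt// -powR_mulrn ?powR_ge0// -powRrM.
by congr powR; field.
Qed.

(** Either x <= kap, or x <= kap^-2 x^3; the mixed term is at most the cube of its larger factor.
    The free parameter [kap] is a small cost per unit area, while the cubes carry a large factor but
    tend to 0 in the mean. *)
Lemma young_terms (kap d y : R) : 0 < kap <= 1 -> 0 <= d -> 0 <= y ->
  let S := kap + kap^-1 ^+ 2 * (d ^+ 3 + y ^+ 3) in
  [/\ d <= S, d ^+ 2 <= S, d ^+ 3 <= S, y ^+ 2 <= S & d * y ^+ 2 <= S].
Proof.
move=> /andP[k0 k1] d0 y0 /=; set S := _ + _.
have ki : 1 <= kap^-1 by rewrite invf_ge1.
have ki2 : 1 <= kap^-1 ^+ 2 by rewrite expr_ge1// (le_trans ler01).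
have ki20 : 0 <= kap^-1 ^+ 2 by exact: sqr_ge0.
have d3 : 0 <= d ^+ 3 by rewrite exprn_ge0.
have y3 : 0 <= y ^+ 3 by rewrite exprn_ge0.
have Sd : kap + kap^-1 ^+ 2 * d ^+ 3 <= S.
  by rewrite /S lerD2l ler_wpM2l// lerDl.
have Sy : kap + kap^-1 ^+ 2 * y ^+ 3 <= S.
  by rewrite /S lerD2l ler_wpM2l// lerDr.
have S3 : d ^+ 3 + y ^+ 3 <= S.
  apply: (@le_trans _ _ (kap^-1 ^+ 2 * (d ^+ 3 + y ^+ 3))).
    by rewrite ler_peMl// addr_ge0.
  by rewrite /S lerDr ltW.
have k2N : kap ^+ 2 != 0 by rewrite expf_neq0// gt_eqF.
have key1 (x : R) : 0 <= x -> x <= kap + kap^-1 ^+ 2 * x ^+ 3.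
  move=> x0; have [xk|xk] := leP x kap.
    by rewrite (le_trans xk)// lerDl mulr_ge0// exprn_ge0.
  rewrite (@le_trans _ _ (kap^-1 ^+ 2 * x ^+ 3))//; last by rewrite lerDr ltW.
  rewrite exprVn mulrC ler_pdivlMr ?exprn_gt0// [leRHS]exprS.
  by apply: ler_wpM2l => //; rewrite lerXn2r ?nnegrE ?(ltW xk) ?(ltW k0).
have key2 (x : R) : 0 <= x -> x ^+ 2 <= kap + kap^-1 ^+ 2 * x ^+ 3.
  move=> x0; have [xk|xk] := leP x kap.
    rewrite (@le_trans _ _ kap)//; last by rewrite lerDl mulr_ge0// exprn_ge0.
    apply: (le_trans _ xk); rewrite expr2 ler_piMr//; exact: le_trans xk k1.
  rewrite (@le_trans _ _ (kap^-1 ^+ 2 * x ^+ 3))//; last by rewrite lerDr ltW.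
  rewrite exprVn mulrC ler_pdivlMr ?exprn_gt0// [leRHS]exprSr.
  apply: ler_wpM2l; first exact: sqr_ge0.
  apply: (le_trans _ (ltW xk)); rewrite expr2 ler_piMr// ltW//.
split.
- exact: le_trans (key1 _ d0) Sd.
- exact: le_trans (key2 _ d0) Sd.
- by apply: le_trans S3; rewrite lerDl.
- exact: le_trans (key2 _ y0) Sy.
- apply: le_trans S3; have [dy|yd] := leP d y.
    rewrite (@le_trans _ _ (y ^+ 3))//; last by rewrite lerDr.
    by rewrite [leRHS]exprS ler_wpM2r// sqr_ge0.
  rewrite (@le_trans _ _ (d ^+ 3))//; last by rewrite lerDl.
  rewrite [leRHS]exprS; apply: ler_wpM2l => //.
  by rewrite lerXn2r// ?nnegrE// ltW.
Qed.

(** In the expansion at (a, b) every monomial contains d or e and is covered by [young_terms] with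
    y^2 = |e|. Only the base point is bounded: it will be the limit, the increments may be
    unbounded. The constant is generous. *)
Lemma flux_diff_bound (M a b d e kap : R) : `|a| <= M -> `|b| <= M -> 0 < kap <= 1 ->
  let S := kap + kap^-1 ^+ 2 * (`|d| ^+ 3 + Num.sqrt `|e| ^+ 3) in
  `|((a + d) * (b + e) - 6^-1 * (a + d) ^+ 3) - (a * b - 6^-1 * a ^+ 3)|
    <= (M ^+ 2 + 4 * M + 2) * S /\
  `|- (2^-1 * (a + d) ^+ 2) - - (2^-1 * a ^+ 2)| <= (M ^+ 2 + 4 * M + 2) * S.
Proof.
move=> aM bM kap01 S.
have M0 : 0 <= M by exact: le_trans aM.
have [] := young_terms kap01 (normr_ge0 d) (sqrtr_ge0 `|e|).
rewrite -/S sqr_sqrtr// => S1 S2 S3 S4 S5.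
have a0 := normr_ge0 a; have b0 := normr_ge0 b; have d0 := normr_ge0 d; have e0 := normr_ge0 e.
have S0 : 0 <= S by exact: le_trans d0 S1.
have T1 : `|a * e| <= M * S by rewrite normrM ler_pM.
have T2 : `|d * b| <= M * S by rewrite normrM mulrC ler_pM.
have T3 : `|d * e| <= S by rewrite normrM.
have T4 : `|a ^+ 2 * d| <= M ^+ 2 * S.
  by rewrite normrM normrX ler_pM// ?exprn_ge0// lerXn2r// nnegrE.
have T5 : `|a * d ^+ 2| <= M * S by rewrite normrM normrX ler_pM// exprn_ge0.
have T6 : `|d ^+ 3| <= S by rewrite normrX.
have T7 : `|a * d| <= M * S by rewrite normrM ler_pM.
have T8 : `|d ^+ 2| <= S by rewrite normrX.
have MS : 0 <= M * S by exact: mulr_ge0.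
have M2S : 0 <= M ^+ 2 * S by rewrite mulr_ge0// sqr_ge0.
split.
  have -> : ((a + d) * (b + e) - 6^-1 * (a + d) ^+ 3) - (a * b - 6^-1 * a ^+ 3) =
    a * e + d * b + d * e - (2^-1 * (a ^+ 2 * d) + 2^-1 * (a * d ^+ 2) + 6^-1 * d ^+ 3) by field.
  have -> : (M ^+ 2 + 4 * M + 2) * S = M ^+ 2 * S + 4 * (M * S) + 2 * S by ring.
  move: T1 T2 T3 T4 T5 T6; rewrite !ler_norml.
  move=> /andP[? ?] /andP[? ?] /andP[? ?] /andP[? ?] /andP[? ?] /andP[? ?].
  by apply/andP; split; lra.
have -> : - (2^-1 * (a + d) ^+ 2) - - (2^-1 * a ^+ 2) = - (a * d + 2^-1 * d ^+ 2) by field.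
have -> : (M ^+ 2 + 4 * M + 2) * S = M ^+ 2 * S + 4 * (M * S) + 2 * S by ring.
move: T7 T8; rewrite !ler_norml => /andP[? ?] /andP[? ?].
by apply/andP; split; lra.
Qed.

Lemma flux_pairing_cvg (v_ w_ : nat -> plane -> R) (v w : plane -> R) (M r : R) Om phi :
  (forall k, measurable_fun setT (v_ k)) -> (forall k, measurable_fun setT (w_ k)) ->
  measurable_fun setT v -> measurable_fun setT w ->
  (forall p, `|v p| <= M) -> (forall p, `|w p| <= M) ->
  (forall k p, ~ box r p -> [/\ v_ k p = 0, w_ k p = 0, v p = 0 & w p = 0]) ->
  (forall eps, 0 < eps -> \forall k \near \oo, L1 mu (fun p => `|v_ k p - v p| ^+ 3) /\
     rint mu (fun p => `|v_ k p - v p| ^+ 3) <= eps) ->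
  (forall eps, 0 < eps -> \forall k \near \oo, L1 mu (fun p => Num.sqrt `|w_ k p - w p| ^+ 3) /\
     rint mu (fun p => Num.sqrt `|w_ k p - w p| ^+ 3) <= eps) ->
  test_function Om phi ->
  flux_pairing (v_ k) (w_ k) phi @[k --> \oo] --> flux_pairing v w phi.
Proof.
move=> mv_ mw_ mv mw vM wM out cv cw tphi.
have hez : (ez : R * R) = ex \/ (ez : R * R) = ez by right.
have hex : (ex : R * R) = ex \/ (ex : R * R) = ez by left.
have tDx := test_D hex tphi; have tDz := test_D hez tphi.
have [N1 N10 HN1] := test_bound tDx; have [N2 N20 HN2] := test_bound tDz.
have mDx := test_measurable tDx; have mDz := test_measurable tDz.
pose N := N1 + N2.
have M0 : 0 <= M by exact: le_trans (normr_ge0 _) (vM 0).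
pose C0 := M ^+ 2 + 4 * M + 2.
have C00 : 0 < C0 by rewrite /C0 ltr_wpDl// addr_ge0 ?sqr_ge0// mulr_ge0.
pose F (a b : plane -> R) p := (a p * b p - 6^-1 * a p ^+ 3) * 'D_ex phi p +
                      - (2^-1 * a p ^+ 2) * 'D_ez phi p.
have mF (a b : plane -> R) : measurable_fun setT a -> measurable_fun setT b ->
    measurable_fun setT (F a b : plane -> R).
  move=> ma mb; apply: measurable_funD; apply: measurable_funM => //.
    apply: measurable_funB; first exact: measurable_funM.
    by apply: measurable_funM => //; exact: measurable_funX.
  apply: measurableT_comp => //.
  by apply: measurable_funM => //; exact: measurable_funX.
have bnd kap k p : 0 < kap <= 1 -> `|F (v_ k) (w_ k) p - F v w p| <=
    N * C0 * (kap * \1_(box r) p + kap^-1 ^+ 2 *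
      (`|v_ k p - v p| ^+ 3 + Num.sqrt `|w_ k p - w p| ^+ 3)).
  move=> kap01; have NC : 0 <= N * C0 by apply: mulr_ge0; [exact: addr_ge0|exact: ltW].
  have [bp|nbp] := pselect (box r p); last first.
    have [h1 h2 h3 h4] := out k p nbp.
    rewrite /F h1 h2 h3 h4 !subrr normr0 indicE memNset//= mulr0 add0r sqrtr0 expr0n/=.
    by rewrite addr0 !mulr0.
  rewrite indicE mem_set//= mulr1.
  have [H1 H2] := flux_diff_bound (v_ k p - v p) (w_ k p - w p) (vM p) (wM p) kap01.
  set S := kap + _ in H1 H2 *.
  have ev : v p + (v_ k p - v p) = v_ k p by rewrite addrCA subrr addr0.
  have ew : w p + (w_ k p - w p) = w_ k p by rewrite addrCA subrr addr0.
  rewrite ev ew -/C0 in H1 H2.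
  set X := (X in `|X| <= _) in H1; set Y := (X in `|X| <= _) in H2.
  have -> : F (v_ k) (w_ k) p - F v w p = X * 'D_ex phi p + Y * 'D_ez phi p.
    by rewrite /F /X /Y; ring.
  apply: (le_trans (ler_normD _ _)); rewrite !normrM /N.
  have -> : (N1 + N2) * C0 * S = C0 * S * N1 + C0 * S * N2 by ring.
  by apply: lerD; apply: ler_pM.
have LF : L1 mu (F v w).
  apply: (@bounded_L1 _ _ ((M * M + M ^+ 3) * N1 + M ^+ 2 * N2) r (mF _ _ mv mw)).
    move=> p; apply: (le_trans (ler_normD _ _)); rewrite !normrM.
    have H1 : `|v p * w p - 6^-1 * v p ^+ 3| <= M * M + M ^+ 3.
      apply: (le_trans (ler_normB _ _)); apply: lerD.
        by rewrite normrM ler_pM.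
      rewrite normrM normrX (@ger0_norm _ 6^-1)// -[leRHS]mul1r.
      by apply: ler_pM; [lra|exact: exprn_ge0|lra|rewrite lerXn2r// nnegrE].
    have H2 : `|- (2^-1 * v p ^+ 2)| <= M ^+ 2.
      rewrite normrN normrM normrX (@ger0_norm _ 2^-1)// -[leRHS]mul1r.
      by apply: ler_pM; [lra|exact: exprn_ge0|lra|rewrite lerXn2r// nnegrE].
    by apply: lerD; apply: ler_pM.
  move=> p nbp; have [h1 h2 h3 h4] := out 0%N p nbp.
  by rewrite /F h3 h4 expr0n/= !mulr0 subrr mul0r expr0n/= mulr0 oppr0 mul0r addr0.
have Li : L1 mu (\1_(box r) : plane -> R).
  exact: L1_indic (measurable_box r) (box_fin r).
pose m := rint mu (\1_(box r) : plane -> R).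
have m0 : 0 <= m by apply: rint_ge0 => p; have /andP[] := indic01 (box r) p.
have N0 : 0 <= N by exact: addr_ge0.
apply/cvgrPdist_le => eps eps0.
(* With both cubic integrals at most kap^3, the bound integrates to at most N C0 (kap m + 2 kap),
   hence to at most kap D. *)
pose D := N * C0 * m + N * C0 * 2 + 1.
have NC0 : 0 <= N * C0 by apply: mulr_ge0; [exact: N0|exact: ltW].
have D0 : 0 < D by rewrite /D ltr_wpDl// addr_ge0// mulr_ge0.
pose kap := Num.min 1 (eps / D).
have kap0 : 0 < kap by rewrite lt_min ltr01 divr_gt0.
have kap1 : kap <= 1 by rewrite ge_min lexx.
have kapD : kap * D <= eps by rewrite -ler_pdivlMr// ge_min lexx orbT.
have kap01 : 0 < kap <= 1 by rewrite kap0.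
have k30 : 0 < kap ^+ 3 by rewrite exprn_gt0.
near=> k.
have [L3 I3] : L1 mu (fun p => `|v_ k p - v p| ^+ 3) /\
     rint mu (fun p => `|v_ k p - v p| ^+ 3) <= kap ^+ 3 by near: k; exact: cv.
have [L32 I32] : L1 mu (fun p => Num.sqrt `|w_ k p - w p| ^+ 3) /\
     rint mu (fun p => Num.sqrt `|w_ k p - w p| ^+ 3) <= kap ^+ 3 by near: k; exact: cw.
have LB : L1 mu (fun p => N * C0 * (kap * \1_(box r) p + kap^-1 ^+ 2 *
      (`|v_ k p - v p| ^+ 3 + Num.sqrt `|w_ k p - w p| ^+ 3))).
  by apply: L1Z; apply: L1D; apply: L1Z => //; exact: L1D.
have LD : L1 mu (fun p => F (v_ k) (w_ k) p - F v w p).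
  apply: (L1_dom _ LB); first by apply: measurable_funB; exact: mF.
  by move=> p; exact: bnd.
have LFk : L1 mu (F (v_ k) (w_ k)).
  by apply: eq_L1 (L1D LF LD) => p; rewrite addrCA subrr addr0.
rewrite /flux_pairing -/(F _ _) -/(F _ _) opprK addrC -rintB//.
apply: (le_trans (rint_norm LD)).
apply: (le_trans (rint_le (L1_norm LD) LB (fun p => bnd kap k p kap01))).
rewrite rintZ; last by apply: L1D; apply: L1Z => //; exact: L1D.
rewrite rintD; [|exact: L1Z|by apply: L1Z; exact: L1D].
rewrite rintZ// rintZ; last exact: L1D.
rewrite rintD// -/m.
apply: le_trans kapD.
have H : kap^-1 ^+ 2 * (rint mu (fun p => `|v_ k p - v p| ^+ 3) +
    rint mu (fun p => Num.sqrt `|w_ k p - w p| ^+ 3)) <= 2 * kap.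
  apply: (@le_trans _ _ (kap^-1 ^+ 2 * (kap ^+ 3 + kap ^+ 3))).
    by apply: ler_wpM2l; [exact: sqr_ge0|exact: lerD].
  by rewrite le_eqVlt; apply/orP; left; apply/eqP; field; rewrite gt_eqF.
have H2 : N * C0 * (kap * m + kap^-1 ^+ 2 * (rint mu (fun p => `|v_ k p - v p| ^+ 3) +
    rint mu (fun p => Num.sqrt `|w_ k p - w p| ^+ 3))) <= N * C0 * (kap * m + 2 * kap).
  by apply: ler_wpM2l => //; rewrite lerD2l.
apply: (le_trans H2); rewrite /D.
have -> : kap * (N * C0 * m + N * C0 * 2 + 1) = N * C0 * (kap * m + 2 * kap) + kap by ring.
by rewrite lerDl ltW.
Unshelve. all: by end_near. Qed.

End FluxLimit.

(** * Blow-up at a jump point *)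

Section HalfPlaneIntegrals.
Context {R : realType}.
Local Notation plane := (measurableTypeR R * measurableTypeR R)%type.
Local Notation leb := (@lebesgue_measure R).
Implicit Types (p q : R * R).

Lemma continuous_is_derive (f df : R -> R) : (forall x : R, is_derive x 1 f (df x)) -> continuous f.
Proof.
move=> Df x; apply: differentiable_continuous; apply/derivable1_diffP.
by case: (Df x).
Qed.

Lemma FTC_support (f df : R -> R) (a b : R) : a < b ->
  (forall x : R, is_derive x 1 f (df x)) -> continuous df ->
  (\int[leb]_(x in `[a, b]) (df x)%:E = (f b - f a)%:E)%E.
Proof.
move=> ab Df cdf; have cf := continuous_is_derive Df.
rewrite (@continuous_FTC2 R df f a b ab) ?EFinB//.
- exact: continuous_subspaceT.
- split.
  + by move=> x _; case: (Df x).
  + by apply: cvg_at_right_filter; exact: cf.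
  + by apply: cvg_at_left_filter; exact: cf.
- by move=> x _; rewrite derive1E; case: (Df x).
Qed.

Section Support.
Variables (f df : R -> R) (B : R).
Hypotheses (Df : forall x : R, is_derive x 1 f (df x)) (cdf : continuous df).
Hypotheses (f0 : forall x, B <= `|x| -> f x = 0) (df0 : forall x, B <= `|x| -> df x = 0).

Lemma mdf : measurable_fun setT (EFin \o df : measurableTypeR R -> _).
Proof. by apply/measurable_EFinP; exact: continuous_measurable_fun. Qed.

(** The half-line is cut at a point b beyond [c] where [f] already vanishes, and the fundamental
    theorem applies on the rest. *)
Lemma integral_gt (c : R) :
  (\int[leb]_x (\1_[set x | c < x] x * df x)%:E = (- f c)%:E)%E.
Proof.
pose b : R := `|c| + `|B| + 1.
have cb : c < b by have := ler_norm c; rewrite /b; have := normr_ge0 B; lra.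
have bB : B <= `|b|.
  by rewrite ger0_norm /b ?addr_ge0//; have := ler_norm B; have := normr_ge0 c; lra.
transitivity (\int[leb]_(x in `]c, b]) (df x)%:E)%E.
  rewrite [RHS]integral_mkcond; apply: eq_integral => x _.
  rewrite patchE; have [xb|xb] := pselect (x \in `]c, b]).
    rewrite mem_set// indicE mem_set/= ?mul1r//.
    by move: xb; rewrite in_itv/= => /andP[].
  rewrite memNset//; have [cx|cx] := ltP c x; last first.
    by rewrite indicE memNset/= ?mul0r//; apply/negP; rewrite -leNgt.
  rewrite df0 ?mulr0//; have bx : b < x.
    by rewrite ltNge; apply/negP => bx; apply: xb; rewrite in_itv/= cx.
  by apply: (le_trans bB); rewrite !ger0_norm; [exact: ltW| |]; rewrite /b in bx *;
    have := normr_ge0 c; have := normr_ge0 B; lra.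
rewrite integral_itv_obnd_cbnd; last exact: measurable_funTS mdf.
by rewrite (FTC_support cb Df cdf) (f0 bB) sub0r.
Qed.

Lemma integral_lt (c : R) :
  (\int[leb]_x (\1_[set x | x < c] x * df x)%:E = (f c)%:E)%E.
Proof.
pose b : R := - (`|c| + `|B| + 1).
have cb : b < c by have := ler_norm (- c); rewrite normrN /b; have := normr_ge0 B; lra.
have bB : B <= `|b|.
  by rewrite /b normrN ger0_norm ?addr_ge0//; have := ler_norm B; have := normr_ge0 c; lra.
transitivity (\int[leb]_(x in `[b, c[) (df x)%:E)%E.
  rewrite [RHS]integral_mkcond; apply: eq_integral => x _.
  rewrite patchE; have [xb|xb] := pselect (x \in `[b, c[).
    rewrite mem_set// indicE mem_set/= ?mul1r//.
    by move: xb; rewrite in_itv/= => /andP[].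
  rewrite memNset//; have [cx|cx] := ltP x c; last first.
    by rewrite indicE memNset/= ?mul0r//; apply/negP; rewrite -leNgt.
  rewrite df0 ?mulr0//; have bx : x < b.
    by rewrite ltNge; apply/negP => bx; apply: xb; rewrite in_itv/= cx bx.
  by apply: (le_trans bB); rewrite !ler0_norm; [rewrite lerN2; exact: ltW| |]; rewrite /b in bx *;
    have := normr_ge0 c; have := normr_ge0 B; lra.
rewrite integral_itv_bndo_bndc; last exact: measurable_funTS mdf.
by rewrite (FTC_support cb Df cdf) (f0 bB) subr0.
Qed.

Lemma integral_all : (\int[leb]_x (df x)%:E = 0)%E.
Proof.
pose b : R := `|B| + 1.
have b0 : 0 < b by rewrite /b ltr_wpDl.
have bB : B <= `|b| by rewrite gtr0_norm// /b; have := ler_norm B; lra.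
transitivity (\int[leb]_(x in `[(- b)%R, b]) (df x)%:E)%E.
  rewrite [RHS]integral_mkcond; apply: eq_integral => x _.
  rewrite patchE; have [xb|xb] := pselect (x \in `[- b, b]); first by rewrite mem_set.
  rewrite memNset// df0//; apply: (le_trans bB); rewrite gtr0_norm//.
  by rewrite leNgt; apply/negP => /ltr_normlP[h1 h2]; apply: xb; rewrite in_itv/=; apply/andP; split; lra.
rewrite (FTC_support _ Df cdf); last by lra.
by rewrite !f0 ?subrr// normrN.
Qed.

End Support.

Lemma integral_scale (c : R) (g : measurableTypeR R -> \bar R) : 0 < c ->
  measurable_fun setT g -> (forall x, 0 <= g x)%E ->
  (c%:E * \int[leb]_x g (c * x)%R = \int[leb]_x g x)%E.
Proof.
move=> c0 mg g0.
pose k : {nonneg R} := NngNum (ltW c0).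
pose m1 : {measure set (measurableTypeR R) -> \bar R} :=
  measure_function_pushforward__canonical__measure_function_Measure leb (measurable_affine c 0).
transitivity (\int[mscale k m1]_x g x)%E.
  rewrite ge0_integral_mscale//; congr (_ * _)%E.
  have := @ge0_integral_pushforward _ _ _ _ R _ (measurable_affine c 0) leb setT g
    measurableT mg (fun x _ => g0 x).
  rewrite preimage_setT => ->; apply: eq_integral => x _ /=; by rewrite addr0.
apply: eq_measure_integral => A mA _.
exact: (lebesgue_measure_affine 0 c0 mA).
Qed.

Variables (k r : R).
Hypotheses (k0 : 0 < k) (r0 : 0 < r).

(** Radial profile as a function of s = |q|^2, zero for s >= r^2; a large [k] makes [eta 0] close to
    the indicator of the disc. *)
Definition eta (n : nat) (s : R) := flat n (k * (1 - s / r ^+ 2)).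
(** The x-derivative of the profile [eta 0]; the factor [eta 2] appears because [flat 2] is the
    derivative of [flat 0]. *)
Definition eta1 (x z : R) := - (2 * k * x / r ^+ 2) * eta 2 (x * x + z * z).

Lemma eta_out n s : r ^+ 2 <= s -> eta n s = 0.
Proof.
move=> rs; apply: flat0; rewrite pmulr_rle0// subr_le0 ler_pdivlMr ?exprn_gt0//.
by rewrite mul1r.
Qed.

Lemma eta_ge0 n s : 0 <= eta n s. Proof. exact: flat_ge0. Qed.

Lemma is_derive_eta (z x : R) : is_derive x 1 (fun x => eta 0 (x * x + z * z)) (eta1 x z).
Proof.
have d1 : is_derive x 1 (fun x : R => k * (1 - (x * x + z * z) / r ^+ 2)) (- (2 * k * x / r ^+ 2)).
  have H := is_deriveX 2 (is_derive_id x (1 : R)).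
  have := is_deriveD (is_deriveZ (- (k / r ^+ 2)) H) (is_derive_cst (k * (1 - z * z / r ^+ 2)) x (1 : R)).
  rewrite addr0 /GRing.scale/= expr1 mulr1 mulrA => {}H.
  have -> : - (2 * k * x / r ^+ 2) = - (k / r ^+ 2) * 2 * x by ring.
  have -> // : (fun x : R => k * (1 - (x * x + z * z) / r ^+ 2)) =
     (- (k / r ^+ 2) *: id ^+ 2 + cst (k * (1 - z * z / r ^+ 2)) : R -> R).
  by apply/funext => y; rewrite !fctE /GRing.scale/=; ring.
have := @is_derive1_comp R (flat 0) _ x _ _ (is_derive_flat 0 _) d1.
by rewrite mul0r subr0 => H; rewrite /eta1 [X in is_derive _ _ _ X]mulrC.
Qed.

Lemma continuous_eta n (f : R -> R) : continuous f -> continuous (fun x => eta n (f x)).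
Proof.
move=> cf x.
apply: (@continuous_comp _ _ _ (fun x => k * (1 - f x / r ^+ 2)) (flat n)); last exact: continuous_flat.
apply: cvgM; first exact: cvg_cst.
apply: cvgB; first exact: cvg_cst.
by apply: cvgM; [exact: cf|exact: cvg_cst].
Qed.

Lemma continuous_eta1 z : continuous (fun x => eta1 x z).
Proof.
move=> x; apply: cvgM.
  apply: cvgN; apply: cvgM; last exact: cvg_cst.
  by apply: cvgM; [exact: cvg_cst|exact: cvg_id].
apply: (@continuous_eta 2 (fun x => x * x + z * z)) => y.
by apply: cvgD; [apply: cvgM; exact: cvg_id|exact: cvg_cst].
Qed.

Lemma sqr_out (x z : R) : r <= `|x| -> r ^+ 2 <= x * x + z * z.
Proof.
move=> rx; have : r ^+ 2 <= x * x.
  by rewrite -expr2 -(real_normK (num_real x)) lerXn2r ?nnegrE// ltW.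
by move=> H; apply: (le_trans H); rewrite lerDl -expr2 sqr_ge0.
Qed.

Lemma eta1_out (x z : R) : r ^+ 2 <= x * x + z * z -> eta1 x z = 0.
Proof. by move=> H; rewrite /eta1 eta_out// mulr0. Qed.

(** Inside the disc |x| <= r, and [flat 2] is at most 2!; outside, the derivative is 0. *)
Lemma eta1_bound (x z : R) : `|eta1 x z| <= 4 * k / r.
Proof.
have r20 : 0 < r ^+ 2 by rewrite exprn_gt0.
have B0 : 0 <= 4 * k / r by rewrite divr_ge0 ?ltW// mulr_gt0.
have [/eta1_out ->|xr] := leP (r ^+ 2) (x * x + z * z); first by rewrite normr0.
have xr' : `|x| <= r.
  rewrite -(ler_pXn2r (ltn0Sn 1)) ?nnegrE ?(ltW r0)// real_normK ?num_real//.
  by apply: (le_trans _ (ltW xr)); rewrite -expr2 lerDl -expr2 sqr_ge0.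
rewrite /eta1 normrM normrN (ger0_norm (eta_ge0 _ _)).
have e2 : eta 2 (x * x + z * z) <= 2 by have := flat_le 2 (k * (1 - (x * x + z * z) / r ^+ 2)).
have -> : 4 * k / r = (2 * k * r / r ^+ 2) * 2 by field; rewrite gt_eqF.
apply: ler_pM => //; first exact: eta_ge0.
rewrite !normrM normfV (gtr0_norm k0) (gtr0_norm r20) (@ger0_norm _ 2)//.
apply: ler_wpM2r; first by rewrite invr_ge0 ltW.
by apply: ler_wpM2l => //; apply: mulr_ge0 => //; exact: ltW.
Qed.

(** The integral of the bump along a diameter; by [kappa_rescale] and [kappa_cvg] it is close to the
    length 2 r when [k] is large. *)
Definition kappa : R := \int[leb]_y eta 0 (y * y).

Lemma eta_L1 (s : R) : 0 < s -> L1 leb (fun y => eta 0 (y * y / s ^+ 2)).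
Proof.
move=> s0.
have s20 : 0 < s ^+ 2 by rewrite exprn_gt0.
have mi : measurable (`[- (s * r), s * r] : set (measurableTypeR R)) by exact: measurable_itv.
apply: (@L1_dom _ (measurableTypeR R) R leb _ (\1_(`[- (s * r), s * r]))).
- apply: continuous_measurable_fun.
  apply: (@continuous_eta 0 (fun y => y * y / s ^+ 2)) => y.
  by apply: cvgM; [apply: cvgM; exact: cvg_id|exact: cvg_cst].
- have fin : (lebesgue_measure ([set` `[(- (s * r))%R, (s * r)%R]] : set R) < +oo)%E.
    by rewrite lebesgue_measure_itv; case: ifP => _; rewrite -?EFinB ltry.
  exact: (L1_indic mi fin).
- move=> y; rewrite (ger0_norm (eta_ge0 _ _)) indicE.
  have [yi|yi] := pselect (y \in `[- (s * r), s * r]).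
    by rewrite mem_set//; exact: flat_lt1.
  rewrite memNset// eta_out// ler_pdivlMr// mulrC -exprMn -expr2 -(real_normK (num_real y)).
  have sr : 0 < s * r by rewrite mulr_gt0.
  apply: lerXn2r; rewrite ?nnegrE ?(ltW sr)// leNgt; apply/negP => /ltr_normlP[h1 h2].
  by apply: yi; rewrite in_itv/=; apply/andP; split; lra.
Qed.

Lemma kappa_scale (s : R) : 0 < s ->
  (\int[leb]_y (eta 0 (y * y / s ^+ 2))%:E = (s * kappa)%:E)%E.
Proof.
move=> s0.
have L1e := eta_L1 ltr01.
have e1 : (fun y : R => eta 0 (y * y / 1 ^+ 2)) = (fun y => eta 0 (y * y)).
  by apply/funext => y; rewrite expr1n divr1.
rewrite e1 in L1e.
have mE : measurable_fun setT (fun y : measurableTypeR R => (eta 0 (y * y))%:E).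
  by apply/measurable_EFinP; exact: L1_meas L1e.
have := @integral_scale s^-1 (fun y => (eta 0 (y * y))%:E) _ mE _.
rewrite invr_gt0 => /(_ s0 (fun x => _))H.
have {}H : ((s^-1)%:E * \int[leb]_x (eta 0 (s^-1 * x * (s^-1 * x)))%:E =
    \int[leb]_x (eta 0 (x * x))%:E)%E.
  by apply: H => x; rewrite lee_fin; exact: eta_ge0.
have K : (\int[leb]_x (eta 0 (x * x))%:E = kappa%:E)%E.
  by rewrite /kappa /Rintegral fineK//; exact: (integrable_fin_num measurableT L1e).
rewrite K in H; rewrite EFinM -H muleA -EFinM divff ?gt_eqF// mul1e.
by apply: eq_integral => y _; congr (EFin (eta 0 _)); field; rewrite gt_eqF.
Qed.

(** Row y meets the half-plane in a half-line with endpoint c = - y be / al, so the integral is the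
    profile at that endpoint up to sign; there c^2 + y^2 = y^2 / al^2, as (al, be) is a unit
    vector. *)
Lemma half_plane_inner (al be y : R) : al ^+ 2 + be ^+ 2 = 1 -> al != 0 ->
  (\int[leb]_x (\1_[set x | (0 < x * al + y * be)%R] x * eta1 x y)%:E =
   (- Num.sg al * eta 0 (y * y / `|al| ^+ 2))%:E)%E.
Proof.
move=> ab1 al0.
have Df := is_derive_eta y; have cdf := @continuous_eta1 y.
have f0 x : r <= `|x| -> eta 0 (x * x + y * y) = 0 by move=> rx; exact: eta_out (sqr_out y rx).
have df0 x : r <= `|x| -> eta1 x y = 0 by move=> rx; exact: eta1_out (sqr_out y rx).
pose c := - (y * be) / al.
have Ec : c * c + y * y = y * y / `|al| ^+ 2.
  rewrite real_normK ?num_real// /c.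
  have -> : - (y * be) / al * (- (y * be) / al) + y * y =
    y * y * (al ^+ 2 + be ^+ 2) / al ^+ 2 by field.
  by rewrite ab1 mulr1.
have [alp|aln|E] := ltgtP 0 al; last by rewrite -E eqxx in al0.
  rewrite gtr0_sg// mulN1r -Ec -(integral_gt Df cdf f0 df0 c).
  apply: eq_integral => x _; congr (EFin (_ * _)); congr (\1_ _ _).
  apply/seteqP; split => z /=; rewrite /c ltr_pdivrMr//; lra.
rewrite ltr0_sg// opprK mul1r -Ec -(integral_lt Df cdf f0 df0 c).
apply: eq_integral => x _; congr (EFin (_ * _)); congr (\1_ _ _).
apply/seteqP; split => z /=; rewrite /c ltr_ndivlMr//; lra.
Qed.

(** The divergence theorem on the half-plane, row by row: [kappa_scale] with s = |al| integrates the
    endpoint values, and the sign of al times |al| is al. For al = 0 each row lies inside or outside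
    and contributes 0. *)
Lemma half_plane_iterated (al be : R) : al ^+ 2 + be ^+ 2 = 1 ->
  (\int[leb]_y \int[leb]_x (\1_[set x | (0 < x * al + y * be)%R] x * eta1 x y)%:E =
   (- (al * kappa))%:E)%E.
Proof.
move=> ab1; have [->|al0] := eqVneq al 0.
  rewrite mul0r oppr0; apply: integral0_eq => y _.
  have Df := is_derive_eta y; have cdf := @continuous_eta1 y.
  have f0 x : r <= `|x| -> eta 0 (x * x + y * y) = 0 by move=> rx; exact: eta_out (sqr_out y rx).
  have df0 x : r <= `|x| -> eta1 x y = 0 by move=> rx; exact: eta1_out (sqr_out y rx).
  have [yb|yb] := ltP 0 (y * be).
    rewrite -[RHS](integral_all Df cdf f0 df0); apply: eq_integral => x _.
    by rewrite indicE mem_set/= ?mul1r// mulr0 add0r.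
  apply: integral0_eq => x _; rewrite indicE memNset/= ?mul0r//.
  by rewrite mulr0 add0r; apply/negP; rewrite -leNgt.
under eq_integral do rewrite half_plane_inner//.
have aln : 0 < `|al| by rewrite normr_gt0.
have LE := eta_L1 aln.
transitivity ((- Num.sg al)%:E * \int[leb]_y (eta 0 (y * y / `|al| ^+ 2))%:E)%E.
  by rewrite -integralZl//; apply: eq_integral => y _; rewrite EFinM.
by rewrite kappa_scale// -EFinM mulrA mulNr -numEsg mulNr.
Qed.

End HalfPlaneIntegrals.

(** * The radial bump and its derivatives over half-planes *)

Section RadialBump.
Context {R : realType}.
Local Notation plane := (measurableTypeR R * measurableTypeR R)%type.
Local Notation mu := (@leb2 R).
Implicit Types (p q nu : R * R).

Lemma dotp_ge0 p : 0 <= dotp p p.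
Proof. by rewrite /dotp -!expr2 addr_ge0 ?sqr_ge0. Qed.

Lemma enorm_sqr p : enorm p ^+ 2 = dotp p p.
Proof. by rewrite sqr_sqrtr ?dotp_ge0. Qed.

Lemma enorm_ge0 p : 0 <= enorm p. Proof. exact: sqrtr_ge0. Qed.

Lemma enorm_leE (r : R) p : 0 <= r -> (enorm p <= r) = (dotp p p <= r ^+ 2).
Proof. by move=> r0; rewrite -enorm_sqr ler_pXn2r// nnegrE// enorm_ge0. Qed.

Lemma enorm_ltE (r : R) p : 0 <= r -> (enorm p < r) = (dotp p p < r ^+ 2).
Proof. by move=> r0; rewrite -enorm_sqr ltr_pXn2r// nnegrE// enorm_ge0. Qed.

Lemma continuous_dotpp : continuous (fun p : R * R => dotp p p).
Proof.
by move=> p; apply: cvgD; apply: cvgM; first [exact: cvg_fst|exact: cvg_snd].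
Qed.

Lemma continuous_enorm : continuous (@enorm R).
Proof.
move=> p; apply: (continuous_comp (@continuous_dotpp p)).
exact: sqrt_continuous.
Qed.

Lemma closed_disc p (r : R) : closed [set q | enorm (q - p) <= r].
Proof.
have -> : [set q | enorm (q - p) <= r] = (fun q => enorm (q - p)) @^-1` [set x | x <= r] by [].
apply: closed_comp => [q _|]; last exact: closed_le.
apply: (@continuous_comp _ _ _ (fun q => q - p) (@enorm R)); last exact: continuous_enorm.
by apply: cvgB; [exact: cvg_id|exact: cvg_cst].
Qed.

Lemma disc_box p (r : R) : enorm p < r -> box r p.
Proof.
move=> pr; split; rewrite /ball/= sub0r normrN.
  by apply: le_lt_trans pr; have := fst_lip p 0; rewrite !subr0.
by apply: le_lt_trans pr; have := snd_lip p 0; rewrite !subr0.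
Qed.

Lemma compact_disc (r : R) : compact [set q : R * R | enorm q <= r].
Proof.
apply: (@subclosed_compact _ _ (`[- r, r] `*` `[- r, r])).
- by under eq_set do rewrite -[X in enorm X]subr0; exact: closed_disc.
- by apply: compact_setX; exact: segment_compact.
- move=> q /= qr; have := fst_lip q 0; have := snd_lip q 0; rewrite !subr0 => q2 q1.
  have /ler_normlP[? ?] := le_trans q1 qr; have /ler_normlP[? ?] := le_trans q2 qr.
  by split => /=; rewrite in_itv/=; apply/andP; split; lra.
Qed.

Variables (k r : R).
Hypotheses (k0 : 0 < k) (r0 : 0 < r).

Definition bump (q : R * R) : R := eta k r 0 (q.1 * q.1 + q.2 * q.2).

Lemma bump_smooth : smooth bump.
Proof.
move=> n; apply: (@Cn_flat_comp R n 0 (fun p => k * (1 - (p.1 * p.1 + p.2 * p.2) / r ^+ 2))) => m.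
apply: Cn_scale; apply: smooth_opp_shift => l.
under eq_fun do rewrite mulrC; apply: Cn_scale.
apply: (@Cn_add R l (fun p => p.1 * p.1) (fun p => p.2 * p.2)).
  exact: (Cn_mul (Cn_fst l) (Cn_fst l)).
exact: (Cn_mul (Cn_snd l) (Cn_snd l)).
Qed.

Lemma bump01 q : 0 <= bump q <= 1.
Proof. by rewrite /bump eta_ge0 flat_lt1. Qed.

Lemma bump_test (U : set (R * R)) : [set q | enorm q <= r] `<=` U -> test_function U bump.
Proof.
move=> rU; split; first exact: bump_smooth.
exists [set q | enorm q <= r]; first by split => //; exact: compact_disc.
move=> q /negP; rewrite -ltNge => rq; apply: eta_out => //.
by rewrite leNgt -[X in X < _]/(dotp q q) -enorm_ltE ?ltW// -leNgt ltW.
Qed.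

Lemma bump_Dex q : 'D_ex bump q = eta1 k r q.1 q.2.
Proof.
suff /@derive_val : is_derive q ex bump (eta1 k r q.1 q.2) by [].
apply: is_derive_line.
have /line_is_derive := is_derive_eta k r q.2 q.1.
by congr is_derive; apply/funext => t; rewrite /bump/= scaler1 scaler0 add0r.
Qed.

Lemma bump_Dez q : 'D_ez bump q = eta1 k r q.2 q.1.
Proof.
suff /@derive_val : is_derive q ez bump (eta1 k r q.2 q.1) by [].
apply: is_derive_line.
have /line_is_derive := is_derive_eta k r q.1 q.2.
by congr is_derive; apply/funext => t; rewrite /bump/= scaler1 scaler0 add0r addrC.
Qed.

Definition half nu : set (R * R) := [set q | 0 < dotp q nu].

Lemma open_half nu : open (half nu).
Proof.
have -> : half nu = (fun q => dotp q nu) @^-1` [set x | 0 < x] by [].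
apply: open_comp => [q _|]; last exact: open_gt.
by apply: cvgD; apply: cvgM; first [exact: cvg_fst|exact: cvg_snd|exact: cvg_cst].
Qed.

Lemma measurable_half nu : measurable (half nu : set plane).
Proof. by apply: open_measurable_plane; exact: open_half. Qed.

Lemma bump_D_L1 e : e = ex \/ e = ez -> L1 mu ('D_e bump).
Proof. by move=> he; apply: (@test_L1 _ setT); apply: test_D => //; exact: bump_test. Qed.

Lemma L1_indicl (A : set plane) f : measurable A -> L1 mu f -> L1 mu (fun p => \1_A p * f p).
Proof.
by move=> mA Lf; apply: eq_L1 (L1_indicM mA Lf) => p; rewrite mulrC.
Qed.

(** Fubini, with the direction of differentiation integrated first; for [ez] the two coordinates
    exchange roles. *)
Lemma half_plane_D e nu : e = ex \/ e = ez -> enorm nu = 1 ->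
  rint mu (fun q => \1_(half nu) q * 'D_e bump q) = - (dotp e nu * kappa k r).
Proof.
move=> he nu1; have nuE : nu.1 ^+ 2 + nu.2 ^+ 2 = 1.
  by have := enorm_sqr nu; rewrite nu1 /dotp -!expr2 expr1n.
have LD := L1_indicl (measurable_half nu) (bump_D_L1 he).
apply: EFin_inj.
have -> : ((rint mu (fun q => \1_(half nu) q * 'D_e bump q))%:E =
    \int[mu]_q (\1_(half nu) q * 'D_e bump q)%:E)%E.
  by rewrite /rint /Rintegral fineK//; exact: (integrable_fin_num measurableT LD).
case: he LD => -> LD.
  rewrite /dotp/= mul1r mul0r addr0.
  rewrite -(integral21_prod_meas1 LD) -(half_plane_iterated k0 r0 nuE).
  apply: eq_integral => y _; apply: eq_integral => x _.
  by rewrite /= bump_Dex/= !indicE.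
rewrite /dotp/= mul1r mul0r add0r.
rewrite addrC in nuE.
rewrite -(integral12_prod_meas1 LD) -(half_plane_iterated k0 r0 nuE).
apply: eq_integral => x _; apply: eq_integral => y _.
rewrite /= bump_Dez/= !indicE; congr (EFin ((nat_of_bool _)%:R * _)).
by apply: asbool_equiv_eq; rewrite /half/dotp/= addrC.
Qed.

End RadialBump.

(** * Replacing the gradient by its traces on half discs *)

Section BlowUp.
Context {R : realType}.
Local Notation plane := (measurableTypeR R * measurableTypeR R)%type.
Local Notation mu := (@leb2 R).
Implicit Types (p q nu a b : R * R).

(** Vertical sections are single points, unless [nu] is horizontal and the line is itself
    vertical. *)
Lemma line_null nu : enorm nu = 1 -> mu [set q | dotp q nu = 0] = 0%E.
Proof.
move=> nu1; have nuE : nu.1 ^+ 2 + nu.2 ^+ 2 = 1.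
  by have := enorm_sqr nu; rewrite nu1 /dotp -!expr2 expr1n.
have [n20|n20] := eqVneq nu.2 0.
  have n10 : nu.1 != 0.
    by apply: contra_eq_neq nuE => ->; rewrite n20 expr0n/= addr0 eq_sym oner_eq0.
  have -> : [set q : plane | dotp q nu = 0] = [set 0] `*` setT.
    apply/seteqP; split => q /=; rewrite /dotp n20 mulr0 addr0.
      by move=> /eqP; rewrite mulf_eq0 (negbTE n10) orbF => /eqP.
    by move=> [-> _]; rewrite mul0r.
  have -> : mu ([set 0] `*` setT) = (lebesgue_measure [set 0%R : R] *
      @lebesgue_measure R setT)%E by exact: product_measure1E.
  by rewrite lebesgue_measure_set1 mul0e.
rewrite /leb2/= /product_measure1/=.
apply: integral0_eq => x _ /=.
have -> : xsection [set q : plane | dotp q nu = 0] x = [set - (x * nu.1) / nu.2].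
  apply/seteqP; split => y; rewrite /xsection/= in_setE/= /dotp/=.
    by move=> H; apply: (mulIf n20); rewrite divfK//; lra.
  by move=> ->; field.
exact: lebesgue_measure_set1.
Qed.

Lemma Sigma_lipschitz (M : R) p a : `|p.1| <= M -> `|p.2| <= M -> `|a.1| <= M -> `|a.2| <= M ->
  `|(Sigma p).1 - (Sigma a).1| + `|(Sigma p).2 - (Sigma a).2| <=
  (2 * M + M ^+ 2) * (`|p.1 - a.1| + `|p.2 - a.2|).
Proof.
case: p => v w; case: a => a b; rewrite /Sigma/= => vM wM aM bM.
have M0 : 0 <= M by exact: le_trans vM.
set d1 := `|v - a|; set d2 := `|w - b|.
have d10 : 0 <= d1 by exact: normr_ge0.
have d20 : 0 <= d2 by exact: normr_ge0.
have H1 : `|v * w - 6^-1 * v ^+ 3 - (a * b - 6^-1 * a ^+ 3)| <=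
    M * d2 + M * d1 + 2^-1 * M ^+ 2 * d1.
  have -> : v * w - 6^-1 * v ^+ 3 - (a * b - 6^-1 * a ^+ 3) =
    v * (w - b) + b * (v - a) + - (6^-1 * (v ^+ 2 + v * a + a ^+ 2) * (v - a)) by field.
  apply: (le_trans (ler_normD _ _)); apply: lerD.
    apply: (le_trans (ler_normD _ _)); apply: lerD; rewrite normrM; apply: ler_pM => //; exact: normr_ge0.
  rewrite normrN (normrM _ (v - a)); apply: ler_pM => //.
  rewrite normrM ger0_norm ?invr_ge0//.
  have T : `|v ^+ 2 + v * a + a ^+ 2| <= 3 * M ^+ 2.
    have e1 : `|v ^+ 2| <= M ^+ 2 by rewrite normrX lerXn2r ?nnegrE.
    have e2 : `|v * a| <= M ^+ 2 by rewrite normrM expr2; apply: ler_pM.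
    have e3 : `|a ^+ 2| <= M ^+ 2 by rewrite normrX lerXn2r ?nnegrE.
    have := ler_normD (v ^+ 2 + v * a) (a ^+ 2); have := ler_normD (v ^+ 2) (v * a); lra.
  have : 6^-1 * `|v ^+ 2 + v * a + a ^+ 2| <= 6^-1 * (3 * M ^+ 2) by rewrite ler_wpM2l ?invr_ge0.
  lra.
have H2 : `|- (2^-1 * v ^+ 2) - - (2^-1 * a ^+ 2)| <= M * d1.
  have -> : - (2^-1 * v ^+ 2) - - (2^-1 * a ^+ 2) = - (2^-1 * (v + a) * (v - a)) by field.
  rewrite normrN (normrM _ (v - a)); apply: ler_pM => //.
  rewrite normrM ger0_norm ?invr_ge0//.
  have := ler_normD v a; lra.
have M20 : 0 <= M ^+ 2 by exact: sqr_ge0.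
apply: (le_trans (lerD H1 H2)).
have : 0 <= M ^+ 2 * d1 by exact: mulr_ge0.
have : 0 <= M ^+ 2 * d2 by exact: mulr_ge0.
have : 0 <= M * d2 by exact: mulr_ge0.
lra.
Qed.

Lemma kappa_rescale (k r : R) : 0 < k -> 0 < r -> kappa k r = r * kappa k 1.
Proof.
move=> k0 r0; apply: EFin_inj; rewrite -(kappa_scale k0 ltr01 r0).
have LE := eta_L1 k0 r0 ltr01.
have -> : kappa k r = rint (@lebesgue_measure R) (fun y => eta k r 0 (y * y / 1 ^+ 2)).
  by rewrite /kappa; apply: eq_Rintegral => y _; rewrite expr1n divr1.
rewrite /rint /Rintegral fineK; last exact: (integrable_fin_num measurableT LE).
by apply: eq_integral => y _; rewrite /eta !expr1n !divr1.
Qed.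

(** The profiles converge to the indicator of the interval from -1 to 1, whose length is 2. *)
Lemma kappa_cvg : kappa k.+1%:R 1 @[k --> \oo] --> (2 : R).
Proof.
pose I : set (measurableTypeR R) := [set` `](-1 : R), 1[].
have mI : measurable I by exact: measurable_itv.
have IE : (@lebesgue_measure R I = 2%:E)%E.
  by rewrite /I lebesgue_measure_itv/= lte_fin (_ : -1 < 1)// -EFinB opprK.
have LI : L1 (@lebesgue_measure R) (\1_I : measurableTypeR R -> R).
  have fI : (@lebesgue_measure R I < +oo)%E by rewrite IE ltry.
  exact: (L1_indic mI fI).
have IP y : (y \in I) = (y * y < 1).
  rewrite -expr2 -(real_normK (num_real y)) -[X in _ < X](expr1n _ 2) ltr_pXn2r ?nnegrE//.
  by rewrite /I mem_setE in_itv/= ltr_norml.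
have [||||_] := @rint_dominated_cvg _ (measurableTypeR R) R (@lebesgue_measure R)
  (fun k y => eta k.+1%:R 1 0 (y * y)) (\1_I) (\1_I).
- move=> k; have k0 : 0 < k.+1%:R :> R by [].
  have /L1_meas := eta_L1 k0 ltr01 ltr01.
  by congr measurable_fun; apply/funext => y; rewrite expr1n divr1.
- exact: LI.
- move=> k y; rewrite (ger0_norm (eta_ge0 _ _ _ _)) indicE IP; case: ltP => // H.
    exact: flat_lt1.
  by rewrite eta_out// expr1n.
- move=> y; rewrite indicE IP; case: ltP => H.
    rewrite /eta; apply: cvg_flat_pos; by rewrite expr1n divr1 subr_gt0.
  rewrite (_ : (fun k => _) = cst 0); first exact: cvg_cst.
  by apply/funext => k; rewrite eta_out// expr1n.
have -> // : rint (@lebesgue_measure R) (\1_I : measurableTypeR R -> R) = 2.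
rewrite /rint /Rintegral integral_indic// setIT; exact: (congr1 fine IE).
Qed.

Variables (k r : R).
Hypotheses (k0 : 0 < k) (r0 : 0 < r).
Variables (M : R) (v w : plane -> R).
Hypotheses (mv : measurable_fun setT v) (mw : measurable_fun setT w).
Hypotheses (vM : forall q, `|v q| <= M) (wM : forall q, `|w q| <= M).

Definition flux q : R := (Sigma (v q, w q)).1 * 'D_ex (bump k r) q +
  (Sigma (v q, w q)).2 * 'D_ez (bump k r) q.

Lemma half_ball0 nu (s : R) : half_ball 0 nu s = [set q | enorm q < s] `&` half nu.
Proof. by apply/seteqP; split => q; rewrite /half_ball/= subr0. Qed.

Lemma measurable_half_ball nu (s : R) : measurable (half_ball 0 nu s : set plane).
Proof.
rewrite half_ball0; apply: measurableI; last exact: measurable_half.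
apply: open_measurable_plane.
have -> : [set q : plane | enorm q < s] = (@enorm R) @^-1` [set x | x < s] by [].
by apply: open_comp => [q _|]; [exact: continuous_enorm|exact: open_lt].
Qed.

Lemma measurable_Sigma : measurable_fun setT (fun q : plane => (Sigma (v q, w q)).1) /\
  measurable_fun setT (fun q : plane => (Sigma (v q, w q)).2).
Proof.
rewrite /Sigma/=; split.
  apply: (@measurable_funB _ plane R _ (fun q => v q * w q) (fun q => 6^-1 * v q ^+ 3)).
    exact: measurable_funM.
  by apply: measurable_funM => //; exact: measurable_funX.
apply: (@measurable_funN _ plane R _ (fun q => 2^-1 * v q ^+ 2)).
by apply: measurable_funM => //; exact: measurable_funX.
Qed.

Lemma bump_D_bound e q : e = ex \/ e = ez -> `|'D_e (bump k r) q| <= 4 * k / r.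
Proof.
by case => ->; rewrite ?bump_Dex ?bump_Dez; exact: eta1_bound.
Qed.

Lemma bump_D_out e q : e = ex \/ e = ez -> r <= enorm q -> 'D_e (bump k r) q = 0.
Proof.
move=> he rq; have H : r ^+ 2 <= q.1 * q.1 + q.2 * q.2.
  by rewrite leNgt -[X in X < _]/(dotp q q) -enorm_ltE ?ltW// -leNgt.
by case: he => ->; rewrite ?bump_Dex ?bump_Dez; apply: eta1_out => //; rewrite addrC.
Qed.

Lemma L1_deviation nu a : `|a.1| <= M -> `|a.2| <= M ->
  L1 mu (fun q => \1_(half_ball 0 nu r) q * (`|v q - a.1| + `|w q - a.2|)).
Proof.
move=> aM bM.
set g := (X in L1 _ X).
apply: (@bounded_L1 _ g (4 * M) r).
- apply: measurable_funM; first exact: measurable_indic (measurable_half_ball _ _).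
  by apply: measurable_funD; apply: measurableT_comp => //; exact: measurable_funB.
- move=> q; rewrite /g normrM (@ger0_norm _ (_ + _)) ?addr_ge0//.
  have /andP[i0 i1] := indic01 (half_ball 0 nu r) q.
  rewrite ger0_norm//; apply: (@le_trans _ _ (`|v q - a.1| + `|w q - a.2|)).
    by rewrite ler_piMl ?addr_ge0.
  have := ler_normB (v q) a.1; have := ler_normB (w q) a.2.
  have := vM q; have := wM q; lra.
- move=> q nb; rewrite /g indicE memNset ?mul0r// half_ball0 => -[/= qr _].
  exact: nb (disc_box qr).
Qed.

(** For the constant state [a] the half-plane integral is known exactly. The error is the gradient
    bound 4 k / r times the Lipschitz constant of [Sigma] times the deviation from [a], which at a
    trace is o(r^2), so the error is o(r). *)
Lemma half_deviation nu a : `|a.1| <= M -> `|a.2| <= M -> enorm nu = 1 ->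
  L1 mu (fun q => \1_(half nu) q * flux q) /\
  `|rint mu (fun q => \1_(half nu) q * flux q) + kappa k r * dotp (Sigma a) nu| <=
  4 * k / r * (2 * M + M ^+ 2) *
  rint mu (fun q => \1_(half_ball 0 nu r) q * (`|v q - a.1| + `|w q - a.2|)).
Proof.
move=> aM bM nu1; set L := 2 * M + M ^+ 2; set C := 4 * k / r.
have M0 : 0 <= M by exact: le_trans aM.
have L0 : 0 <= L by rewrite addr_ge0 ?sqr_ge0// mulr_ge0.
have C0 : 0 <= C by rewrite divr_ge0 ?ltW// mulr_gt0.
pose g := fun q : plane => \1_(half_ball 0 nu r) q * (`|v q - a.1| + `|w q - a.2|).
have Lg : L1 mu g by exact: L1_deviation.
have [mS1 mS2] := measurable_Sigma.
have LDx := bump_D_L1 k0 r0 (or_introl erefl).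
have LDz := bump_D_L1 k0 r0 (or_intror erefl).
pose A q := \1_(half nu) q * ((Sigma a).1 * 'D_ex (bump k r) q + (Sigma a).2 * 'D_ez (bump k r) q).
have LHx := L1_indicl (measurable_half nu) LDx.
have LHz := L1_indicl (measurable_half nu) LDz.
have AE q : A q = (Sigma a).1 * (\1_(half nu) q * 'D_ex (bump k r) q) +
    (Sigma a).2 * (\1_(half nu) q * 'D_ez (bump k r) q).
  rewrite /A; move: (\1_(half nu) q) ('D_ex (bump k r) q) ('D_ez (bump k r) q) (Sigma a) => i x z S.
  by rewrite mulrDr !(mulrCA i).
have LA : L1 mu A.
  by have := L1D (L1Z (Sigma a).1 LHx) (L1Z (Sigma a).2 LHz); apply: eq_L1 => q; rewrite AE.
have IA : rint mu A = - (kappa k r * dotp (Sigma a) nu).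
  have -> : rint mu A = rint mu (fun q => (Sigma a).1 * (\1_(half nu) q * 'D_ex (bump k r) q) +
      (Sigma a).2 * (\1_(half nu) q * 'D_ez (bump k r) q)).
    by apply: eq_rint => q; exact: AE.
  have E1 := rintD (L1Z (Sigma a).1 LHx) (L1Z (Sigma a).2 LHz).
  have E2 := rintZ (Sigma a).1 LHx.
  have E3 := rintZ (Sigma a).2 LHz.
  rewrite (half_plane_D k0 r0 (or_introl erefl) nu1) in E2.
  rewrite (half_plane_D k0 r0 (or_intror erefl) nu1) in E3.
  have dx : dotp ex nu = nu.1 by rewrite /dotp mul1r mul0r addr0.
  have dz : dotp ez nu = nu.2 by rewrite /dotp mul1r mul0r add0r.
  rewrite dx in E2; rewrite dz in E3.
  apply: (etrans E1); apply: (etrans (congr2 +%R E2 E3)).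
  rewrite /dotp; move: (Sigma a) (kappa k r) => S K; ring.
pose d q := \1_(half nu) q * flux q - A q.
have dB q : `|d q| <= C * L * g q.
  rewrite /d /A /g /flux -mulrBr.
  have [rq|qr] := leP r (enorm q).
    rewrite (bump_D_out (or_introl erefl) rq) (bump_D_out (or_intror erefl) rq).
    rewrite !mulr0 addr0 subr0 mulr0 normr0.
    apply: mulr_ge0; first exact: mulr_ge0.
    by apply: mulr_ge0; [case/andP: (indic01 (half_ball 0 nu r) q)|exact: addr_ge0].
  rewrite normrM; have /andP[i0 i1] := indic01 (half nu) q.
  rewrite (ger0_norm i0).
  have -> : \1_(half_ball 0 nu r) q = \1_(half nu) q :> R.
    rewrite !indicE; congr ((nat_of_bool _)%:R); apply: asbool_equiv_eq.
    by rewrite half_ball0; split => // -[].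
  have -> : C * L * (\1_(half nu) q * (`|v q - a.1| + `|w q - a.2|)) =
    \1_(half nu) q * (C * (L * (`|v q - a.1| + `|w q - a.2|))).
    by rewrite mulrCA !mulrA.
  apply: ler_wpM2l => //.
  have -> : (Sigma (v q, w q)).1 * 'D_ex (bump k r) q + (Sigma (v q, w q)).2 * 'D_ez (bump k r) q -
   ((Sigma a).1 * 'D_ex (bump k r) q + (Sigma a).2 * 'D_ez (bump k r) q) =
   'D_ex (bump k r) q * ((Sigma (v q, w q)).1 - (Sigma a).1) +
   'D_ez (bump k r) q * ((Sigma (v q, w q)).2 - (Sigma a).2).
    move: ('D_ex (bump k r) q) ('D_ez (bump k r) q) (Sigma a) (Sigma _) => x z S T.
    by rewrite opprD addrACA -!mulrBl !(mulrC (_ - _)).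
  apply: (le_trans (ler_normD _ _)); rewrite !normrM.
  have S := @Sigma_lipschitz M (v q, w q) a (vM q) (wM q) aM bM.
  apply: le_trans (ler_wpM2l C0 S); rewrite mulrDr.
  by apply: lerD; apply: ler_wpM2r => //; apply: bump_D_bound; [left|right].
have mflux : measurable_fun setT (flux : plane -> R).
  exact: (measurable_funD (measurable_funM mS1 (L1_meas LDx)) (measurable_funM mS2 (L1_meas LDz))).
have Ld : L1 mu d.
  apply: (@L1_dom _ plane R mu d (fun q => C * L * g q)) => //; last exact: L1Z.
  apply: measurable_funB; last exact: L1_meas LA.
  by apply: measurable_funM => //; exact: measurable_indic (measurable_half _).
have LF : L1 mu (fun q => \1_(half nu) q * flux q).
  by apply: eq_L1 (L1D Ld LA) => q; rewrite /d subrK.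
split => //; rewrite -[X in _ + X]opprK -IA -rintB//.
apply: (le_trans (rint_norm Ld)); rewrite -rintZ//.
by apply: rint_le => //; [exact: L1_norm|exact: L1Z].
Qed.

Lemma flux_split nu : enorm nu = 1 ->
  rint mu flux = rint mu (fun q => \1_(half nu) q * flux q) +
    rint mu (fun q => \1_(half (- nu)) q * flux q).
Proof.
move=> nu1; have M0 : 0 <= M by exact: le_trans (normr_ge0 _) (vM 0).
have nuN : enorm (- nu) = 1 by rewrite /enorm /dotp/= !mulrNN.
have h0 : `|(0 : R * R).1| <= M by rewrite normr0.
(* The state 0 serves to obtain integrability on the half-plane. *)
have [L1a _] := @half_deviation nu 0 h0 h0 nu1.
have [L1b _] := @half_deviation (- nu) 0 h0 h0 nuN.
rewrite -(rintD L1a L1b).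
rewrite /rint /Rintegral; congr fine; apply: ae_eq_integral => //.
- have [mS1 mS2] := measurable_Sigma; apply/measurable_EFinP.
  have LDx := bump_D_L1 k0 r0 (or_introl erefl).
  have LDz := bump_D_L1 k0 r0 (or_intror erefl).
  exact: (measurable_funD (measurable_funM mS1 (L1_meas LDx)) (measurable_funM mS2 (L1_meas LDz))).
- apply/measurable_EFinP; exact: (measurable_funD (L1_meas L1a) (L1_meas L1b)).
exists [set q | dotp q nu = 0]; split.
- have -> : [set q : plane | dotp q nu = 0] = ~` (half nu `|` half (- nu)).
    apply/seteqP; split => q; rewrite /half/=; have -> : dotp q (- nu) = - dotp q nu by rewrite /dotp/=; ring.
      by move=> -> []; rewrite ?oppr0 ltxx.
    by move=> /not_orP[/negP h1 /negP h2]; rewrite oppr_gt0 -!leNgt in h1 h2; apply/eqP; rewrite eq_le h1 h2.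
  by apply: measurableC; apply: measurableU; exact: measurable_half.
- exact: line_null.
- move=> q /= H; apply: contrapT => /eqP dq; apply: H => _; congr EFin.
  have dN : dotp q (- nu) = - dotp q nu by rewrite /dotp/=; ring.
  rewrite !indicE; have [H|H|/eqP] := ltgtP 0 (dotp q nu); last by rewrite eq_sym (negbTE dq).
    rewrite mem_set// memNset/= ?mul1r ?mul0r ?addr0// /half/= dN oppr_gt0.
    by apply/negP; rewrite -leNgt ltW.
  rewrite memNset/=; last by apply/negP; rewrite -leNgt ltW.
  by rewrite mem_set/= ?mul1r ?mul0r ?add0r// /half/= dN oppr_gt0.
Qed.

End BlowUp.

(** * Linearity of the pairing and its size near a jump point *)

Section JumpBlowUp.
Context {R : realType}.
Local Notation plane := (measurableTypeR R * measurableTypeR R)%type.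
Local Notation mu := (@leb2 R).
Implicit Types (p q nu a b : R * R).

Section Pairing.
Variables (M : R) (v w : plane -> R).
Hypotheses (mv : measurable_fun setT v) (mw : measurable_fun setT w).
Hypotheses (vM : forall q, `|v q| <= M) (wM : forall q, `|w q| <= M).

Definition fluxd (v w : plane -> R) (phi : R * R -> R) q : R :=
  (v q * w q - 6^-1 * v q ^+ 3) * 'D_ex phi q + - (2^-1 * v q ^+ 2) * 'D_ez phi q.

Lemma fluxd_L1 Om phi : test_function Om phi -> L1 mu (fluxd v w phi).
Proof.
move=> tphi; have [mS1 mS2] := measurable_Sigma mv mw.
have Dx := test_L1 (test_D (or_introl erefl) tphi).
have Dz := test_L1 (test_D (or_intror erefl) tphi).
have h0 : `|(0 : R * R).1| <= M by rewrite normr0; exact: le_trans (normr_ge0 _) (vM 0).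
pose C := (2 * M + M ^+ 2) * (M + M).
have B q : `|(Sigma (v q, w q)).1| + `|(Sigma (v q, w q)).2| <= C.
  have := @Sigma_lipschitz _ M (v q, w q) 0 (vM q) (wM q) h0 h0.
  have -> : Sigma (0 : R * R) = 0 by rewrite /Sigma/= mul0r expr0n/= expr0n/= !mulr0 oppr0 addr0.
  rewrite !subr0 => H; apply: (le_trans H); apply: ler_wpM2l; last by apply: lerD; [exact: vM|exact: wM].
  by rewrite addr_ge0 ?sqr_ge0// mulr_ge0//; exact: le_trans (normr_ge0 _) (vM 0).
have B1 q : `|(Sigma (v q, w q)).1| <= C by apply: le_trans (B q); rewrite lerDl.
have B2 q : `|(Sigma (v q, w q)).2| <= C by apply: le_trans (B q); rewrite lerDr.
have key (S D : plane -> R) : measurable_fun setT S -> (forall q, `|S q| <= C) -> L1 mu D ->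
    L1 mu (fun q => S q * D q).
  move=> mS SC LD; apply: (@L1_dom _ plane R mu _ (fun q => C * `|D q|)).
  - exact: measurable_funM mS (L1_meas LD).
  - by apply: L1Z; exact: L1_norm.
  - by move=> q; rewrite normrM ler_wpM2r.
exact: (L1D (key _ _ mS1 B1 Dx) (key _ _ mS2 B2 Dz)).
Qed.

Lemma flux_pairing_scale Om phi (s : R) : test_function Om phi ->
  flux_pairing v w (fun q => s * phi q) = s * flux_pairing v w phi.
Proof.
move=> tphi; rewrite /flux_pairing mulrN; congr (- _).
rewrite -(rintZ s (fluxd_L1 tphi)); apply: eq_rint => q.
have H e : e = ex \/ e = ez -> 'D_e (fun q => s * phi q) q = s * 'D_e phi q.
  by move=> he; have [_ E] := is_deriveZ s (smooth_is_derive q he (test_smooth tphi)).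
rewrite (H _ (or_introl erefl)) (H _ (or_intror erefl)) /fluxd.
by move: (v q) (w q) ('D_ex phi q) ('D_ez phi q) => x y z t; ring.
Qed.

Lemma flux_pairing_add Om phi psi : test_function Om phi -> test_function Om psi ->
  flux_pairing v w (fun q => phi q + psi q) = flux_pairing v w phi + flux_pairing v w psi.
Proof.
move=> tphi tpsi; rewrite /flux_pairing -opprD; congr (- _).
rewrite -(rintD (fluxd_L1 tphi) (fluxd_L1 tpsi)); apply: eq_rint => q.
have H e : e = ex \/ e = ez -> 'D_e (fun q => phi q + psi q) q = 'D_e phi q + 'D_e psi q.
  by move=> he; have [_ E] := is_deriveD (smooth_is_derive q he (test_smooth tphi))
    (smooth_is_derive q he (test_smooth tpsi)).
rewrite (H _ (or_introl erefl)) (H _ (or_intror erefl)) /fluxd.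
by move: (v q) (w q) ('D_ex phi q) ('D_ez phi q) ('D_ex psi q) ('D_ez psi q) => *; ring.
Qed.

End Pairing.

Lemma flux_pairing_shift (M : R) (v w : plane -> R) Om phi p :
  measurable_fun setT v -> measurable_fun setT w ->
  (forall q, `|v q| <= M) -> (forall q, `|w q| <= M) -> test_function Om phi ->
  flux_pairing v w (fun q => phi (q + p)) =
  flux_pairing (fun q => v (q - p)) (fun q => w (q - p)) phi.
Proof.
move=> mv mw vM wM tphi; apply: (congr1 -%R).
have mv' : measurable_fun setT (fun q : plane => v (q - p)).
  by apply: measurableT_comp => //; exact: measurable_shift.
have mw' : measurable_fun setT (fun q : plane => w (q - p)).
  by apply: measurableT_comp => //; exact: measurable_shift.
have L := @fluxd_L1 M _ _ mv' mw' (fun q => vM _) (fun q => wM _) _ _ tphi.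
rewrite -(rint_shift p L); apply: eq_rint => q; rewrite /fluxd addrK.
have st := test_smooth tphi.
by rewrite (derive_shift_dir p q (or_introl erefl) st) (derive_shift_dir p q (or_intror erefl) st).
Qed.

(** [one_sided_trace] in real terms: a comparison with r^2, the order of the area of the half disc,
    replaces the average, and the sum of the components replaces the Euclidean norm. *)
Definition mean_trace (v w : plane -> R) p nu a := forall eps : R, 0 < eps ->
  exists2 r0 : R, 0 < r0 & forall r, 0 < r -> r < r0 ->
  rint mu (fun q => \1_(half_ball p nu r) q * (`|v q - a.1| + `|w q - a.2|)) <= eps * r ^+ 2.

Lemma blowup_origin (M : R) (v w : plane -> R) nu a b (c : R) :
  measurable_fun setT v -> measurable_fun setT w ->
  (forall q, `|v q| <= M) -> (forall q, `|w q| <= M) -> enorm nu = 1 ->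
  mean_trace v w 0 nu a -> mean_trace v w 0 (- nu) b ->
  c < `|dotp (Sigma a - Sigma b) nu| ->
  exists2 r0 : R, 0 < r0 & forall r, 0 < r -> r < r0 -> exists phi,
    [/\ test_function [set q | enorm q <= r] phi, forall q, `|phi q| <= 1 &
        2 * r * c <= flux_pairing v w phi].
Proof.
move=> mv mw vM0 wM0 nu1 Ta Tb cJ; set J := dotp _ _ in cJ.
pose N := M + `|a.1| + `|a.2| + `|b.1| + `|b.2|.
have M0 : 0 <= M by exact: le_trans (normr_ge0 _) (vM0 0).
have ha1 := normr_ge0 a.1; have ha2 := normr_ge0 a.2.
have hb1 := normr_ge0 b.1; have hb2 := normr_ge0 b.2.
have vM q : `|v q| <= N by apply: (le_trans (vM0 q)); rewrite /N; lra.
have wM q : `|w q| <= N by apply: (le_trans (wM0 q)); rewrite /N; lra.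
have a1 : `|a.1| <= N by rewrite /N; lra.
have a2 : `|a.2| <= N by rewrite /N; lra.
have b1 : `|b.1| <= N by rewrite /N; lra.
have b2 : `|b.2| <= N by rewrite /N; lra.
have N0 : 0 <= N by exact: le_trans a1.
have nuN : enorm (- nu) = 1 by rewrite /enorm /dotp/= !mulrNN.
(* [c] lies strictly below the jump and [kappa] tends to 2, so a sharp enough bump leaves a margin.
   The sharpness is fixed before r shrinks. *)
have [K kJ] : exists K : nat, 2 * c < kappa K.+1%:R 1 * `|J|.
  have H : kappa K.+1%:R 1 * `|J| @[K --> \oo] --> 2 * `|J|.
    by apply: cvgM; [exact: kappa_cvg|exact: cvg_cst].
  have [K _ /(_ K (leqnn K)) HK] : \forall K \near \oo, 2 * c < kappa K.+1%:R 1 * `|J|.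
    by apply: (cvgr_gt _ H); rewrite ltr_pM2l.
  by exists K.
set k : R := K.+1%:R in kJ; have k0 : 0 < k by rewrite /k.
pose L := 2 * N + N ^+ 2.
have L0 : 0 <= L by rewrite addr_ge0 ?sqr_ge0// mulr_ge0.
pose D := kappa k 1 * `|J| - 2 * c.
have D0 : 0 < D by rewrite subr_gt0.
have C0 : 0 < 8 * k * L + 1 by apply: ltr_wpDl => //; apply: mulr_ge0 => //; apply: mulr_ge0 => //; exact: ltW.
(* The two half discs deviate by 4 k / r L 2 eps r^2 = r 8 k L eps in total, which the margin r D
   absorbs. *)
pose eps := D / (8 * k * L + 1).
have eps0 : 0 < eps by exact: divr_gt0.
have [ra ra0 Ha] := Ta _ eps0; have [rb rb0 Hb] := Tb _ eps0.
exists (Num.min ra rb); first by rewrite lt_min ra0.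
move=> r r0; rewrite lt_min => /andP[rra rrb].
have [La da] := half_deviation k0 r0 mv mw vM wM a1 a2 nu1.
have [Lb db] := half_deviation k0 r0 mv mw vM wM b1 b2 nuN.
have tb : test_function [set q | enorm q <= r] (bump k r) by exact: bump_test.
have FS := flux_split k0 r0 mv mw vM wM nu1.
(* The sign that turns the pairing into an approximation of the absolute value of the jump. *)
pose s : R := if 0 <= J then 1 else -1.
have sJ : s * J = `|J| by rewrite /s; case: ger0P; rewrite ?mul1r ?mulN1r.
have s1 : `|s| = 1 by rewrite /s; case: ifP; rewrite ?normrN1 ?normr1.
exists (fun q => s * bump k r q); split.
- exact: test_scale.
- move=> q; rewrite normrM s1 mul1r; have /andP[x y] := bump01 k r q; by rewrite ger0_norm.
rewrite (flux_pairing_scale mv mw vM wM s tb).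
have -> : flux_pairing v w (bump k r) = - rint mu (flux k r v w) by [].
have {}Ha := Ha r r0 rra; have {}Hb := Hb r r0 rrb.
set Ia := rint _ _ in Ha da; set Ib := rint _ _ in Hb db.
have dJ : dotp (Sigma a) nu + dotp (Sigma b) (- nu) = J.
  rewrite /J /dotp/=; move: (Sigma a) (Sigma b) => S T; rewrite /=; ring.
set Fa := rint _ _ in La da FS; set Fb := rint _ _ in Lb db FS.
have E : `|rint mu (flux k r v w) + kappa k r * J| <= 4 * k / r * L * (2 * (eps * r ^+ 2)).
  have -> : rint mu (flux k r v w) + kappa k r * J =
     (Fa + kappa k r * dotp (Sigma a) nu) + (Fb + kappa k r * dotp (Sigma b) (- nu)).
    by rewrite FS -dJ mulrDr addrACA.
  apply: (le_trans (ler_normD _ _)); apply: (le_trans (lerD da db)).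
  rewrite -mulrDr -/L; apply: ler_wpM2l.
    by apply: mulr_ge0 => //; apply: divr_ge0; [apply: mulr_ge0 => //|]; exact: ltW.
  by rewrite mulr2n mulrDl mul1r; exact: lerD.
have Er : 4 * k / r * L * (2 * (eps * r ^+ 2)) = r * (8 * k * L * eps).
  by field; rewrite gt_eqF.
have De : 8 * k * L * eps <= D.
  by rewrite /eps mulrA ler_pdivrMr// mulrC; apply: ler_wpM2l; [exact: ltW|lra].
have Kr := kappa_rescale k0 r0.
rewrite Er in E.
have F1 : r * `|J| * kappa k 1 - s * - rint mu (flux k r v w) <= r * D.
  apply: (@le_trans _ _ (r * (8 * k * L * eps))); last by rewrite ler_pM2l.
  apply: le_trans E; rewrite -sJ Kr.
  have -> : r * (s * J) * kappa k 1 - s * - rint mu (flux k r v w) =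
     s * (rint mu (flux k r v w) + r * kappa k 1 * J) by ring.
  by apply: (le_trans (ler_norm _)); rewrite normrM s1 mul1r.
have -> : 2 * r * c = r * `|J| * kappa k 1 - r * D by rewrite /D; ring.
lra.
Qed.

Lemma blowup (M : R) (v w : plane -> R) p nu a b (c : R) :
  measurable_fun setT v -> measurable_fun setT w ->
  (forall q, `|v q| <= M) -> (forall q, `|w q| <= M) -> enorm nu = 1 ->
  mean_trace v w p nu a -> mean_trace v w p (- nu) b ->
  c < `|dotp (Sigma a - Sigma b) nu| ->
  exists2 r0 : R, 0 < r0 & forall r, 0 < r -> r < r0 -> exists phi,
    [/\ test_function [set q | enorm (q - p) <= r] phi, forall q, `|phi q| <= 1 &
        2 * r * c <= flux_pairing v w phi].
Proof.
move=> mv mw vM wM nu1 Ta Tb cJ.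
pose v' q := v (q + p); pose w' q := w (q + p).
have mv' : measurable_fun setT (v' : plane -> R).
  by apply: measurableT_comp => //; exact: measurable_shift.
have mw' : measurable_fun setT (w' : plane -> R).
  by apply: measurableT_comp => //; exact: measurable_shift.
have T n x : mean_trace v w p n x -> mean_trace v' w' 0 n x.
  move=> H e /H[r0 r00 {}H]; exists r0 => // r rp rr; apply: le_trans (H r rp rr).
  rewrite le_eqVlt; apply/orP; left; apply/eqP.
  pose N := M + `|x.1| + `|x.2|.
  have M0 : 0 <= M by exact: le_trans (normr_ge0 _) (vM 0).
  have x1 := normr_ge0 x.1; have x2 := normr_ge0 x.2.
  have L := @L1_deviation R r N v' w' mv' mw' _ _ n x.
  have {}L : L1 mu (fun q => \1_(half_ball 0 n r) q * (`|v' q - x.1| + `|w' q - x.2|)).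
    by apply: L => [q|q||]; rewrite /v' /w' /N; [have := vM (q + p)|have := wM (q + p)| |]; lra.
  rewrite -(rint_shift (- p) L); apply: eq_rint => q.
  rewrite /v' /w' subrK; congr (_ * _); rewrite !indicE; congr ((nat_of_bool _)%:R).
  by apply: asbool_equiv_eq; rewrite /half_ball/= subr0.
have [r0 r00 H] := blowup_origin mv' mw' (fun q => vM _) (fun q => wM _) nu1 (T _ _ Ta) (T _ _ Tb) cJ.
exists r0 => // r rp rr; have [phi [tphi phi1 Hphi]] := H r rp rr.
exists (fun q => phi (q + - p)); split.
- by apply: (@test_shift _ [set q | enorm q <= r] _ phi (- p)) => // q; rewrite opprK/= addrK.
- by move=> q.
rewrite (flux_pairing_shift (- p) mv mw vM wM tphi).
by under eq_fun do rewrite opprK; under [X in flux_pairing _ X _]eq_fun do rewrite opprK.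
Qed.

End JumpBlowUp.

(** * Vitali covering *)

Section Covering.
Context {R : realType}.
Implicit Types (p q : R * R) (A U : set (R * R)) (d : (R * R) * R).

Lemma enormD p q : enorm (p + q) <= enorm p + enorm q.
Proof.
rewrite enorm_leE ?addr_ge0 ?enorm_ge0// sqrrD !enorm_sqr.
have cs : dotp p q <= enorm p * enorm q.
  rewrite /enorm -sqrtrM ?dotp_ge0//; apply: (le_trans (ler_norm _)).
  rewrite -sqrtr_sqr ler_wsqrtr// /dotp.
  have := sqr_ge0 (p.1 * q.2 - p.2 * q.1); lra.
have -> : dotp (p + q) (p + q) = dotp p p + 2 * dotp p q + dotp q q by rewrite /dotp/=; ring.
by rewrite -mulr_natl; lra.
Qed.

Lemma enormN p : enorm (- p) = enorm p.
Proof. by rewrite /enorm /dotp/= !mulrNN. Qed.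

Definition disc p (r : R) : set (R * R) := [set q | enorm (q - p) <= r].

Lemma disc_ediam p (r : R) : 0 <= r -> (ediam (disc p r) <= (2 * r)%:E)%E.
Proof.
move=> r0; rewrite /ediam ge_max lee_fin mulr_ge0//=.
apply: ge_ereal_sup => _ [[x y] [/= px py] <-]; rewrite lee_fin.
have -> : x - y = (x - p) + - (y - p) by rewrite opprB addrA subrK.
by apply: (le_trans (enormD _ _)); rewrite enormN mulr_natl mulr2n lerD.
Qed.

(** * Greedy choice of discs for an additive functional *)

Section Vitali.
Variables (A U : set (R * R)) (Lam : (R * R -> R) -> R) (t c del : R).
Hypotheses (t0 : 0 < t) (del0 : 0 < del).
Hypothesis Lam0 : Lam (fun=> 0) = 0.
Hypothesis LamD : forall phi psi, test_function U phi -> test_function U psi ->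
  Lam (fun q => phi q + psi q) = Lam phi + Lam psi.
Hypothesis Lamc : forall phi, test_function U phi -> (forall q, `|phi q| <= 1) -> Lam phi <= c.
Hypothesis oU : open U.
Hypothesis AU : A `<=` U.
Hypothesis blow : forall p, A p -> exists2 r0 : R, 0 < r0 & forall r, 0 < r -> r < r0 ->
  exists phi, [/\ test_function (disc p r) phi, forall q, `|phi q| <= 1 & 2 * r * t <= Lam phi].

(** With radius below [del / 6], the disc enlarged three times still has diameter at most [del], as
    [delta_cover] asks. *)
Definition fine_disc d := [/\ 0 < d.2, d.2 < del / 6, A d.1, disc d.1 d.2 `<=` U &
  exists phi, [/\ test_function (disc d.1 d.2) phi, forall q, `|phi q| <= 1 & 2 * d.2 * t <= Lam phi]].

Definition avail (l : seq ((R * R) * R)) d :=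
  fine_disc d /\ forall e, e \in l -> disc d.1 d.2 `&` disc e.1 e.2 = set0.

(** The factor 2 leads to the enlargement 3 = 1 + 2 in [fine_cover]. *)
Definition greedy l d := avail l d /\ forall e, avail l e -> e.2 < 2 * d.2.

(** Radii of available discs are bounded by [del / 6]; a disc whose radius exceeds half of their
    supremum will do. *)
Lemma greedy_ex l : (exists d, avail l d) -> exists d, greedy l d.
Proof.
move=> [d0 ad0]; pose S := [set d.2 | d in avail l].
have S0 : S !=set0 by exists d0.2; exists d0.
have ubS : has_ubound S by exists (del / 6) => _ [d [[_ dd _ _ _] _] <-]; exact: ltW.
have hS : has_sup S by [].
have d0S : d0.2 <= sup S by apply: ub_le_sup => //; exists d0.
have d00 : 0 < d0.2 by case: ad0 => -[].
have S2 : 0 < sup S / 2 by rewrite divr_gt0// (lt_le_trans d00).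
have [_ [d ad <-] Hd] := sup_adherent S2 hS.
exists d; split => // e ae; apply: (@le_lt_trans _ _ (sup S)); last by lra.
by apply: ub_le_sup => //; exists e.
Qed.

(* A disc of negative radius is empty: it stands for "no disc left". *)
Definition next l := xget (0, -1) (greedy l).

Fixpoint chosen n := if n is m.+1 then next (chosen m) :: chosen m else [::].

(** The placeholder of radius -1 counts as 0, so the sums of radii remain correct after the choice
    has stopped. *)
Definition rad n := Num.max 0 (next (chosen n)).2.

Lemma nextP l : avail l (next l) /\ (forall e, avail l e -> e.2 < 2 * (next l).2) \/
  next l = (0, -1) /\ forall e, ~ avail l e.
Proof.
rewrite /next; case: xgetP => [d _ [ad Hd]|none]; first by left.
by right; split => // e ae; have [|d gd] := @greedy_ex l; [exists e|exact: none gd].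
Qed.

(** The bumps of disjoint discs are added: the bound 1 persists and the pairings accumulate.
    Vanishing off the discs is the clause that the induction needs to combine the old sum with a new
    bump. *)
Lemma chosen_test n : exists phi, [/\ test_function U phi, forall q, `|phi q| <= 1,
  forall q, (forall e, e \in chosen n -> ~ disc e.1 e.2 q) -> phi q = 0 &
  2 * t * \sum_(i < n) rad i <= Lam phi].
Proof.
elim: n => [|n [phi [tphi phi1 phi0 Hphi]]].
  exists (fun=> 0); split => //; first exact: test_0.
    by move=> q; rewrite normr0.
  by rewrite big_ord0 mulr0 Lam0.
rewrite /= big_ord_recr/=.
have [[[[r0 rd Ad dU [psi [tpsi psi1 Hpsi]]] disj] _]|[E _]] := nextP (chosen n); last first.
  exists phi; split => //.
    by move=> q H; apply: phi0 => e el; apply: H; rewrite inE el orbT.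
  by rewrite /rad E/= max_l ?addr0// lerN10.
have psiU : test_function U psi by exact: test_sub_dom tpsi.
have psi0 q : ~ disc (next (chosen n)).1 (next (chosen n)).2 q -> psi q = 0.
  by case: tpsi => _ [K [_ Kd] K0] nd; apply: K0 => /Kd.
exists (fun q => phi q + psi q); split.
- exact: test_add.
- move=> q; have [dq|/psi0 ->] := pselect (disc (next (chosen n)).1 (next (chosen n)).2 q); last by rewrite addr0.
  rewrite phi0 ?add0r// => e el eq.
  by have := disj e el; apply/eqP/set0P; exists q.
- move=> q H; rewrite phi0; last by move=> e el; apply: H; rewrite inE el orbT.
  by rewrite psi0 ?addr0//; apply: H; rewrite inE eqxx.
rewrite LamD// mulrDr lerD// /rad max_r ?(ltW r0)//; apply: le_trans Hpsi.
by rewrite -!mulrA (mulrC t).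
Qed.

Lemma rad_ge0 n : 0 <= rad n. Proof. by rewrite /rad le_max lexx. Qed.

(** The combined bump is admissible, so its pairing, at least 2 t times the sum of radii, cannot
    exceed [c]. *)
Lemma rad_sum n : 2 * \sum_(i < n) rad i <= c / t.
Proof.
have [phi [tphi phi1 _ H]] := chosen_test n.
by rewrite ler_pdivlMr// mulrAC (le_trans H)// Lamc.
Qed.

Lemma chosenS n m : (n <= m)%N -> {subset chosen n <= chosen m}.
Proof.
elim: m => [|m IH]; first by rewrite leqn0 => /eqP ->.
rewrite leq_eqVlt => /orP[/eqP -> //|]; rewrite ltnS => /IH H e /H el.
by rewrite /= inE el orbT.
Qed.

Lemma mem_chosen n e : e \in chosen n -> exists2 i, (i < n)%N & e = next (chosen i).
Proof.
elim: n => [//|n IH]; rewrite /= inE => /orP[/eqP ->|/IH[i ni ->]]; first by exists n.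
by exists i => //; exact: ltnW.
Qed.

(** A point outside finitely many closed discs has positive distance from each of them. *)
Lemma far_disc p (l : seq ((R * R) * R)) : ~ (exists2 e, e \in l & disc e.1 e.2 p) ->
  exists2 s : R, 0 < s & forall r, r < s -> forall e, e \in l -> disc p r `&` disc e.1 e.2 = set0.
Proof.
elim: l => [|e l IH] H; first by exists 1.
have [|s s0 Hs] := IH.
  by move=> [f fl fp]; apply: H; exists f => //; rewrite inE fl orbT.
have ep : e.2 < enorm (p - e.1).
  by rewrite ltNge; apply/negP => ep; apply: H; exists e => //; rewrite inE eqxx.
exists (Num.min s (enorm (p - e.1) - e.2)); first by rewrite lt_min s0 subr_gt0.
move=> r; rewrite lt_min => /andP[rs re] f; rewrite inE => /orP[/eqP ->|fl]; last exact: Hs.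
rewrite -subset0 => q [/= qp qe].
have := enormD (p - q) (q - e.1); rewrite addrA subrK -(enormN (p - q)) opprB.
rewrite /disc/= in qp qe; lra.
Qed.

(** A small disc around [p] is available at stage N but not forever. The chosen disc that first
    blocks it meets it and has more than half its radius r, so [p] is within r + rad < 3 rad of its
    centre. *)
Lemma fine_cover N p : A p -> (exists2 i, (i < N)%N & disc (next (chosen i)).1 (next (chosen i)).2 p) \/
  exists2 i, (N <= i)%N & disc (next (chosen i)).1 (3 * rad i) p.
Proof.
move=> Ap; have [[e eN ep]|nB] := pselect (exists2 e, e \in chosen N & disc e.1 e.2 p).
  by left; have [i iN E] := mem_chosen eN; exists i => //; rewrite -E.
right; have [s s0 Hs] := far_disc nB; have [r1 r10 Hr1] := blow Ap.
have /nbhs_ballP[r2 /= r20 Hr2] : nbhs p U by apply: open_nbhs_nbhs; split => //; exact: AU.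
pose r := Num.min (Num.min s r1) (Num.min r2 (del / 6)) / 2.
have m0 : 0 < Num.min (Num.min s r1) (Num.min r2 (del / 6)).
  by rewrite !lt_min s0 r10 r20/= divr_gt0.
have r0 : 0 < r by rewrite divr_gt0.
have : r < Num.min (Num.min s r1) (Num.min r2 (del / 6)) by rewrite /r; lra.
rewrite !lt_min => /andP[/andP[rs rr1] /andP[rr2 rdel]].
have av : avail (chosen N) (p, r).
  split; last by move=> e; exact: Hs.
  split => //=; last exact: Hr1.
  move=> q qr; apply: Hr2; rewrite /disc/= in qr.
  have := fst_lip q p; have := snd_lip q p => q2 q1.
  by split; rewrite /ball/= distrC; lra.
(* By [rad_sum] the radii cannot all exceed r / 2 from N on. *)
have [n Nn rn] : exists2 n, (N <= n)%N & 2 * rad n <= r.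
  apply: contrapT => Hn; have big n : (N <= n)%N -> r < 2 * rad n.
    by move=> Nn; rewrite ltNge; apply/negP => H; apply: Hn; exists n.
  have Hsum m : m%:R * r <= 2 * \sum_(i < N + m) rad i.
    elim: m => [|m IHm].
      by rewrite mul0r; apply: mulr_ge0 => //; apply: sumr_ge0 => i _; exact: rad_ge0.
    rewrite addnS big_ord_recr/= mulrDr -natr1 mulrDl mul1r; apply: lerD => //.
    by apply: ltW; apply: big; rewrite leq_addr.
  have [m Hm] : exists m : nat, c / t / r < m%:R.
    exists (Num.bound `|c / t / r|); apply: le_lt_trans (ler_norm _) _.
    exact: archi_boundP.
  have := le_trans (Hsum m) (rad_sum (N + m)); rewrite -ler_pdivlMr// leNgt.
  by rewrite Hm.
have nav : ~ avail (chosen n) (p, r).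
  have [[[fd _] H]|[_ H]] := nextP (chosen n); last exact: H.
  move=> /H/=; apply/negP; rewrite -leNgt; apply: le_trans rn.
  by rewrite ler_wpM2l// /rad le_max lexx orbT.
(* The first stage at which the disc is no longer available; the disc chosen just before is the one
   that blocks it. *)
have [m /asboolP mav mmin] : exists2 m, ~~ `[< avail (chosen m) (p, r) >] &
    forall k, (k < m)%N -> avail (chosen k) (p, r).
  have ex : exists m, ~~ `[< avail (chosen m) (p, r) >] by exists n; apply/negP => /asboolP.
  case: (ex_minnP ex) => m mav mmin; exists m => // k km.
  apply: contrapT => Hk; have : (m <= k)%N by apply: mmin; apply/negP => /asboolP.
  by rewrite leqNgt km.
have Nm : (N < m)%N.
  rewrite ltnNge; apply/negP => mN; apply: mav; split; first by case: av.
  by move=> e /(chosenS mN) el; case: av => _; apply.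
case: m => // m in mav mmin Nm *.
exists m => //; have am := mmin m (ltnSn m).
have [[_ H]|[_ H]] := nextP (chosen m); last by case: (H _ am).
have {}H := H _ am; rewrite /= in H.
have [q [qp qd]] : disc p r `&` disc (next (chosen m)).1 (next (chosen m)).2 !=set0.
  apply: contrapT => /nonemptyPn E; apply: mav; split; first by case: av.
  move=> e; rewrite /= inE => /orP[/eqP -> //|el]; by case: am => _; apply.
have rE : (next (chosen m)).2 = rad m by rewrite /rad max_r//; lra.
rewrite /disc/= rE in qp qd H *.
have := enormD (p - q) (q - (next (chosen m)).1); rewrite addrA subrK -(enormN (p - q)) opprB.
lra.
Qed.

(** The first N chosen discs enter the cover at their true size, whose diameters are paid for by the
    pairing; only the remaining ones are enlarged. *)
Lemma vitali_hausdorff : (t%:E * hausdorff1_delta del A <= c%:E)%E.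
Proof.
pose S n := \sum_(i < n) rad i.
have ndS : nondecreasing_seq S.
  by apply/nondecreasing_seqP => n; rewrite /S big_ord_recr/= lerDl rad_ge0.
have ubS : has_ubound (range S).
  exists (c / t / 2) => _ [n _ <-]; have := rad_sum n; rewrite -/(S n); lra.
have cS := nondecreasing_cvgn ndS ubS; set s := sup _ in cS.
have Ss n : S n <= s by apply: ub_le_sup => //; exists n.
rewrite -[leLHS]muleC -lee_pdivlMr//.
apply/lee_addgt0Pr => e e0.
have [N _ /(_ N (leqnn N)) HN] : \forall N \near \oo, s - e / 4 < S N.
  by apply: (cvgr_gt _ cS); rewrite ltrBlDr ltrDl divr_gt0.
pose V i := if (i < N)%N then disc (next (chosen i)).1 (next (chosen i)).2
            else disc (next (chosen i)).1 (3 * rad i).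
have rad_lt i : 6 * rad i <= del.
  rewrite /rad; have [[[[r0 rd _ _ _] _] _]|[-> _]] := nextP (chosen i).
    by rewrite max_r ?ltW//; lra.
  by rewrite /= max_l ?lerN10// mulr0 ltW.
(* The excess of the tail, 4 (S n - S N), is at most [e] because N was chosen with s - e / 4 < S
   N. *)
pose b i := if (i < N)%N then 2 * rad i else 6 * rad i.
have dV i : (ediam (V i) <= (b i)%:E)%E.
  rewrite /V /b; case: ifP => _; last first.
    apply: (le_trans (disc_ediam _ _)); first by rewrite mulr_ge0 ?rad_ge0.
    rewrite lee_fin; lra.
  have [r0|r0] := leP 0 (next (chosen i)).2.
    by rewrite /rad max_r//; exact: disc_ediam.
  rewrite (_ : disc _ _ = set0) ?ediam0 ?lee_fin ?mulr_ge0 ?rad_ge0//.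
  by rewrite -subset0 => q /= qd; have := enorm_ge0 (q - (next (chosen i)).1); rewrite /disc/= in qd; lra.
have coverV : delta_cover del A V.
  split=> [p Ap|i].
    have [[i iN ip]|[i iN ip]] := fine_cover N Ap.
      by exists i => //; rewrite /V iN.
    by exists i => //; rewrite /V ltnNge iN.
  apply: (le_trans (dV i)); rewrite lee_fin /b; have := rad_lt i; have := rad_ge0 i.
  by case: ifP => _; lra.
apply: (@le_trans _ _ (\sum_(i <oo) ediam (V i))%E).
  by apply: ereal_inf_lbound; exists V.
apply: lime_le; first by apply: is_cvg_nneseries => *; exact: ediam_ge0.
near=> n; rewrite big_mkord.
apply: (@le_trans _ _ (\sum_(i < n) (b i)%:E)%E); first by apply: lee_sum.
rewrite sumEFin -EFinD lee_fin.
have bsum : \sum_(i < n) b i <= 2 * S n + 4 * Num.max 0 (S n - S N).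
  elim: (n) => [|m IHm].
    by rewrite big_ord0 /S big_ord0 mulr0 add0r mulr_ge0// le_max lexx.
  rewrite big_ord_recr/= /b; case: ifPn => mN.
    have E1 : S m - S N <= 0 by rewrite subr_le0 ndS// ltnW.
    have E2 : S m.+1 - S N <= 0 by rewrite subr_le0 ndS.
    rewrite max_l// in IHm; rewrite max_l//.
    by rewrite /S big_ord_recr/= -/(S m) in E2 *; rewrite /b in IHm; lra.
  rewrite -leqNgt in mN.
  have E1 : 0 <= S m - S N by rewrite subr_ge0 ndS.
  have E2 : 0 <= S m.+1 - S N by rewrite subr_ge0 ndS// ltnW.
  rewrite max_r// in IHm; rewrite max_r//.
  by rewrite /S !big_ord_recr/= -/(S m) -/(S N) in E2 *; rewrite /b in IHm; lra.
apply: (le_trans bsum); have := rad_sum n; rewrite -/(S n) => H1.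
have H2 : Num.max 0 (S n - S N) <= e / 4.
  by rewrite ge_max divr_ge0 ?(ltW e0)//=; have := Ss n; lra.
lra.
Unshelve. all: by end_near. Qed.

End Vitali.

End Covering.

(** * Inner regularity and the lower bound on the jump set *)

Section Regularity.
Context {R : realType}.
Local Notation plane := (measurableTypeR R * measurableTypeR R)%type.
Variable m : {measure set plane -> \bar R}.
Hypothesis finm : (m setT < +oo)%E.
Implicit Types (A F : set plane).

Definition inner_regular A := measurable A /\ forall e : R, 0 < e ->
  exists F : set (R * R), [/\ closed F, F `<=` A & (m (A `\` F) <= e%:E)%E].

Lemma closed_measurable_plane (F : set (R * R)) : closed F -> measurable (F : set plane).
Proof.
move=> cF; rewrite -[F]setCK; apply: (@measurableC _ plane).
by apply: open_measurable_plane; exact: closed_openC.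
Qed.

(** Continuity from above along the differences, which decrease to the empty set; here finiteness of
    the measure enters. *)
Lemma cvg_mu_setD (A : set plane) (F_ : nat -> set (R * R)) : measurable A ->
  (forall n, closed (F_ n)) -> nondecreasing_seq F_ -> A = \bigcup_n F_ n ->
  forall e : R, 0 < e -> exists n, (m (A `\` F_ n) <= e%:E)%E.
Proof.
move=> mA cF ndF AF e e0; pose D n := A `\` F_ n : set plane.
have mD n : measurable (D n) by apply: measurableD => //; exact: closed_measurable_plane.
have D0 : \bigcap_n D n = set0.
  rewrite -subset0 => p Dp; have : A p by case: (Dp 0%N Logic.I).
  by rewrite AF => -[n _ Fp]; case: (Dp n Logic.I).
have := @nonincreasing_cvg_mu _ plane R m D.
rewrite D0 measure0 => /(_ _ mD measurable0) H.
have {}H : (m \o D) @ \oo --> 0%E.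
  apply: H; first by apply: le_lt_trans finm; apply: le_measure; rewrite ?inE.
  by move=> i j ij; apply/subsetPset => p [Ap Fp]; split => // /(subsetPset _ _ (ndF _ _ ij)).
have [n _ /(_ n (leqnn n)) Hn] : \forall n \near \oo, (m (D n) < e%:E)%E.
  apply: (H [set x | x < e%:E]%E); apply: open_nbhs_nbhs; split; first exact: open_ereal_lt_ereal.
  by rewrite /= lte_fin.
by exists n; exact: ltW.
Qed.

Lemma mu_bigcup_eps (D_ : nat -> set plane) (e : R) : 0 <= e -> (forall n, measurable (D_ n)) ->
  (forall n, m (D_ n) <= (e / (2 ^ n.+1)%:R)%:E)%E -> (m (\bigcup_n D_ n) <= e%:E)%E.
Proof.
move=> e0 mD De.
apply: (@le_trans _ _ (\sum_(n <oo) m (D_ n))%E).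
  by apply: measure_sigma_subadditive => //; exact: bigcup_measurable.
apply: le_trans (epsilon_trick0 xpredT e0).
by apply: lee_nneseries => // n _.
Qed.

(** What the intersection of the closed sets loses lies in the union of the individual losses. *)
Lemma inner_regular_bigcap (A_ : nat -> set plane) :
  (forall n, inner_regular (A_ n)) -> inner_regular (\bigcap_n A_ n).
Proof.
move=> IA; split; first by apply: bigcapT_measurable => n; case: (IA n).
move=> e e0.
have en n : 0 < e / (2 ^ n.+1)%:R by rewrite divr_gt0// ltr0n expn_gt0.
pose P n (F : set (R * R)) := [/\ closed F, F `<=` A_ n & (m (A_ n `\` F) <= (e / (2 ^ n.+1)%:R)%:E)%E].
have [F HF] : {F : nat -> set (R * R) & forall n, P n (F n)}.
  by apply: (@choice _ _ P) => n; case: (IA n) => _; exact.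
have mF n : measurable (F n : set plane) by apply: closed_measurable_plane; case: (HF n).
have mA n : measurable (A_ n) by case: (IA n).
exists (\bigcap_n F n); split.
- by apply: closed_bigI => n _; case: (HF n).
- by move=> p Fp n _; case: (HF n) => _ + _; apply; exact: Fp.
apply: (@le_trans _ _ (m (\bigcup_n (A_ n `\` F n)))).
  apply: le_measure; rewrite ?inE.
  - by apply: measurableD; [exact: bigcapT_measurable|exact: (bigcapT_measurable mF)].
  - by apply: bigcup_measurable => n _; exact: measurableD.
  - move=> p [Ap nFp]; apply: contrapT => H; apply: nFp => n _.
    by apply: contrapT => nF; apply: H; exists n => //; split => //; exact: Ap.
apply: mu_bigcup_eps; [exact: ltW|by move=> n; exact: measurableD|].
by move=> n; case: (HF n).
Qed.

(** A countable union of closed sets need not be closed: half of the error covers the individual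
    losses, half the truncation to a finite union. *)
Lemma inner_regular_bigcup (A_ : nat -> set plane) :
  (forall n, inner_regular (A_ n)) -> inner_regular (\bigcup_n A_ n).
Proof.
move=> IA; split; first by apply: bigcup_measurable => n _; case: (IA n).
move=> e0' e0'0; pose e := e0' / 2; have e0 : 0 < e by rewrite divr_gt0.
have en n : 0 < e / (2 ^ n.+1)%:R by rewrite divr_gt0// ltr0n expn_gt0.
pose P n (F : set (R * R)) := [/\ closed F, F `<=` A_ n & (m (A_ n `\` F) <= (e / (2 ^ n.+1)%:R)%:E)%E].
have [F HF] : {F : nat -> set (R * R) & forall n, P n (F n)}.
  by apply: (@choice _ _ P) => n; case: (IA n) => _; exact.
have mF n : measurable (F n : set plane) by apply: closed_measurable_plane; case: (HF n).
have mA n : measurable (A_ n) by case: (IA n).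
pose G n := \bigcup_(i in `I_n) F i.
have cG n : closed (G n) by apply: closed_bigcup => // i _; case: (HF i).
have mUF : measurable (\bigcup_n F n : set plane) by exact: bigcup_measurable.
have [N HN] : exists n, (m (\bigcup_n F n `\` G n) <= e%:E)%E.
  apply: cvg_mu_setD => //.
  - move=> i j ij; apply/subsetPset => p [k /= ki Fk]; exists k => //=; exact: leq_trans ij.
  - apply/seteqP; split => [p [n _ Fp]|p [n _ [i _ Fp]]]; last by exists i.
    by exists n.+1 => //; exists n => /=.
exists (G N); split => //.
  by move=> p [i _ Fp]; exists i => //; case: (HF i) => _ + _; apply.
have mD : measurable (\bigcup_n (A_ n `\` F n)) by apply: bigcup_measurable => n _; exact: measurableD.
have mE : measurable (\bigcup_n F n `\` G N : set plane).
  by apply: measurableD => //; exact: closed_measurable_plane.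
apply: (@le_trans _ _ (m (\bigcup_n (A_ n `\` F n) `|` (\bigcup_n F n `\` G N)))).
  apply: le_measure; rewrite ?inE.
  - apply: measurableD; [exact: bigcup_measurable|exact: closed_measurable_plane].
  - exact: measurableU.
  - move=> p [[n _ Ap] nG]; have [[k _ Fp]|nF] := pselect ((\bigcup_n F n) p).
      by right; split => //; exists k.
    by left; exists n => //; split => // Fp; apply: nF; exists n.
apply: (le_trans (measureU2 _ _ _)) => //.
have -> : e0' = e + e by rewrite /e; lra.
rewrite EFinD; apply: leeD => //.
apply: mu_bigcup_eps; [exact: ltW|by move=> n; exact: measurableD|].
by move=> n; case: (HF n).
Qed.

(** The open superlevel set is the increasing union of the closed sets where a + 1/(n+1) <= f; its
    complement is already closed. *)
Lemma inner_regular_lt (f : R * R -> R) (a : R) : continuous f ->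
  inner_regular [set p | a < f p] /\ inner_regular (~` [set p | a < f p]).
Proof.
move=> cf.
have cl (b : R) : closed [set p | b <= f p].
  have -> : [set p | b <= f p] = f @^-1` [set x | b <= x] by [].
  by apply: closed_comp => [q _|]; [exact: cf|exact: closed_ge].
have op : open [set p | a < f p].
  have -> : [set p | a < f p] = f @^-1` [set x | a < x] by [].
  by apply: open_comp => [q _|]; [exact: cf|exact: open_gt].
have mo : measurable ([set p | a < f p] : set plane) by exact: open_measurable_plane.
split; split => //; last 2 first.
- exact: measurableC.
- move=> e e0; exists (~` [set p | a < f p]); split => //; first exact: open_closedC.
  by rewrite setDv measure0 lee_fin ltW.
move=> e e0; pose F_ (n : nat) := [set p : R * R | a + n.+1%:R^-1 <= f p].
have [|||n Hn] := @cvg_mu_setD [set p | a < f p] F_ mo _ _ _ e e0.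
- by move=> n; exact: cl.
- move=> i j ij; apply/subsetPset => p /= H; apply: le_trans H.
  by rewrite lerD2l lef_pV2 ?posrE// ler_nat ltnS.
- apply/seteqP; split => [p /= /ltr_add_invr[k Hk]|p [k _ /= Hk]].
    by exists k => //=; exact: ltW.
  by apply: lt_le_trans Hk; rewrite ltrDl.
exists (F_ n); split => //; first exact: cl.
by move=> p /= H; apply: lt_le_trans H; rewrite ltrDl.
Qed.

(** Inner approximation of a set says nothing about its complement, so the induction carries both;
    under complements, unions become intersections. *)
Lemma finite_measure_inner_regular A : measurable A -> inner_regular A.
Proof.
move=> mA; suff [] : inner_regular A /\ inner_regular (~` A) by [].
move: A mA; apply: plane_sigma_ind.
- have H F : closed (F : set (R * R)) -> inner_regular F.
    move=> cF; split; first exact: closed_measurable_plane.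
    move=> e e0; exists F; split => //.
    by rewrite setDv measure0 lee_fin ltW.
  by split; apply: H; [exact: closed0|rewrite setC0; exact: closedT].
- by move=> A [IA IC]; rewrite setCK.
- move=> F H; rewrite setC_bigcup; split.
    by apply: inner_regular_bigcup => n; case: (H n).
  by apply: inner_regular_bigcap => n; case: (H n).
- by move=> a; apply: (@inner_regular_lt fst); move=> p; exact: cvg_fst.
- by move=> a; apply: (@inner_regular_lt snd); move=> p; exact: cvg_snd.
Qed.

End Regularity.

Import HBNNSimple.

(** * From level sets to the integral over the jump set *)

Section LowerBound.
Context {R : realType}.
Local Notation plane := (measurableTypeR R * measurableTypeR R)%type.
Implicit Types (p q : R * R) (A F U : set (R * R)).
Variables (Om J : set (R * R)) (Lam : (R * R -> R) -> R) (g : R * R -> R).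
Hypothesis oOm : open Om.
Hypothesis JOm : J `<=` Om.
Hypothesis Lam0 : Lam (fun=> 0) = 0.
Hypothesis LamD : forall phi psi, test_function Om phi -> test_function Om psi ->
  Lam (fun q => phi q + psi q) = Lam phi + Lam psi.
Hypothesis blow : forall p (c : R), J p -> c < g p ->
  exists2 r0 : R, 0 < r0 & forall r, 0 < r -> r < r0 ->
  exists phi, [/\ test_function (disc p r) phi, forall q, `|phi q| <= 1 & 2 * r * c <= Lam phi].

Definition Lam_le U (c : R) :=
  forall phi, test_function U phi -> (forall q, `|phi q| <= 1) -> Lam phi <= c.

Lemma Lam_le_ge0 U (c : R) : Lam_le U c -> 0 <= c.
Proof.
move=> H; rewrite -Lam0; apply: H => [|q]; [exact: test_0|by rewrite normr0].
Qed.

(** [blow] works strictly below [g], so the covering bound is first obtained for every s < t. *)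
Lemma hausdorff1_level A U (t c : R) : open U -> U `<=` Om -> A `<=` U -> A `<=` J -> 0 < t ->
  (forall p, A p -> t <= g p) -> Lam_le U c -> (t%:E * hausdorff1 A <= c%:E)%E.
Proof.
move=> oU UO AU AJ t0 tg Uc; have c0 := Lam_le_ge0 Uc.
have H s : 0 < s -> s < t -> (hausdorff1 A <= (c / s)%:E)%E.
  move=> s0 st; apply: ge_ereal_sup => _ [d /= d0 <-].
  have := @vitali_hausdorff R A U Lam s c d s0 d0 Lam0.
  have -> : (c / s)%:E = (c%:E * (s^-1)%:E)%E by rewrite EFinM.
  rewrite lee_pdivlMr// muleC; apply => //.
  - move=> phi psi tphi tpsi; apply: LamD; exact: test_sub_dom UO _.
  - by move=> p Ap; apply: blow; [exact: AJ|exact: lt_le_trans st (tg _ Ap)].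
have t20 : 0 < t / 2 by rewrite divr_gt0.
have t2t : t / 2 < t by lra.
have fin : hausdorff1 A \is a fin_num.
  by rewrite ge0_fin_numE ?hausdorff1_ge0//; apply: le_lt_trans (H _ t20 t2t) _; exact: ltry.
have h0 := hausdorff1_ge0 A.
move: H h0; rewrite -(fineK fin); set h := fine _ => H; rewrite lee_fin => h0.
rewrite -EFinM lee_fin leNgt; apply/negP => cth.
have hp : 0 < h.
  by rewrite lt_def h0 andbT; apply: contraTneq cth => ->; rewrite mulr0 -leNgt.
(* If t h exceeded [c], this s would lie strictly between c / h and t and contradict the bound. *)
pose s := (c / h + t) / 2.
have cht : c / h < t by rewrite ltr_pdivrMr.
have ch0 : 0 <= c / h by exact: divr_ge0.
have s0 : 0 < s by rewrite divr_gt0//; lra.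
have st : s < t by rewrite /s; lra.
have := H s s0 st; rewrite lee_fin ler_pdivlMr// => hs.
have : c < h * s by rewrite mulrC -ltr_pdivrMr// /s; lra.
by rewrite ltNge hs.
Qed.

(** [c2] is the supremum of [Lam] over V2. Admissible functions with disjoint supports add up to an
    admissible one on [U], so c - c2 remains for V1. *)
Lemma Lam_split U V1 V2 (c : R) : U `<=` Om -> Lam_le U c -> V1 `<=` U -> V2 `<=` U ->
  V1 `&` V2 = set0 -> exists c2 : R, Lam_le V2 c2 /\ Lam_le V1 (c - c2).
Proof.
move=> UO Uc V1U V2U V120.
pose S := [set Lam phi | phi in [set phi | test_function V2 phi /\ forall q, `|phi q| <= 1]].
have ubS : has_ubound S.
  exists c => _ [phi [tphi phi1] <-]; apply: Uc => //; exact: test_sub_dom tphi.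
have S0 : S !=set0.
  exists (Lam (fun=> 0)), (fun=> 0) => //; split; first exact: test_0.
  by move=> q; rewrite normr0.
exists (sup S); split.
  by move=> phi tphi phi1; apply: ub_le_sup => //; exists phi.
move=> phi tphi phi1; rewrite lerBrDr addrC -lerBrDr; apply: ge_sup => // _ [psi [tpsi psi1] <-].
have tphiU := test_sub_dom V1U tphi; have tpsiU := test_sub_dom V2U tpsi.
rewrite lerBrDr -LamD; [|exact: test_sub_dom UO _|exact: test_sub_dom UO _].
apply: Uc; first exact: test_add.
move=> q; case: tphi => _ [K1 [_ KV1] K10]; case: tpsi => _ [K2 [_ KV2] K20].
have [K1q|nK1] := pselect (K1 q); last by rewrite K10// addr0.
rewrite [X in X + _]K20 ?add0r// => K2q.
have : (V1 `&` V2) q by split; [exact: KV1|exact: KV2].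
by rewrite V120.
Qed.

(** Induction on the list: normality of the plane separates one closed set from the union of the
    others, and [Lam_split] divides the budget [c] between the two neighbourhoods. *)
Lemma hausdorff1_sum (s : seq R) (F : R -> set (R * R)) U (c : R) : uniq s ->
  (forall t, t \in s -> 0 < t) -> (forall t, t \in s -> closed (F t)) ->
  (forall t t', t \in s -> t' \in s -> t != t' -> F t `&` F t' = set0) ->
  (forall t p, t \in s -> F t p -> [/\ U p, J p & t <= g p]) ->
  open U -> U `<=` Om -> Lam_le U c ->
  (\sum_(t <- s) t%:E * hausdorff1 (F t) <= c%:E)%E.
Proof.
elim: s U c => [|t s IH] U c; first by move=> *; rewrite big_nil lee_fin; exact: (@Lam_le_ge0 U).
move=> /= /andP[ts us] s0 cF disj FJ oU UO Uc.
pose G := \big[setU/set0]_(x <- s) F x.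
have GE : G = [set p | exists2 x, x \in s & F x p].
  rewrite /G; elim: (s) => [|x l IHl].
    by rewrite big_nil; apply/seteqP; split => p //= [].
  rewrite big_cons IHl; apply/seteqP; split => p /=.
    case=> [Fp|[y yl Fp]]; first by exists x; rewrite // inE eqxx.
    by exists y => //; rewrite inE yl orbT.
  by case=> y; rewrite inE => /orP[/eqP ->|yl] Fp; [left|right; exists y].
have cG : closed G.
  have : forall x, x \in s -> closed (F x) by move=> x xs; apply: cF; rewrite inE xs orbT.
  rewrite /G; elim: (s) => [|x l IHl] Hl; first by rewrite big_nil; exact: closed0.
  rewrite big_cons; apply: closedU; first by apply: Hl; rewrite inE eqxx.
  by apply: IHl => y yl; apply: Hl; rewrite inE yl orbT.
have tt : t \in t :: s by rewrite inE eqxx.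
have ss x : x \in s -> x \in t :: s by move=> xs; rewrite inE xs orbT.
have FG : F t `&` G = set0.
  rewrite GE -subset0 => p [Ftp [x xs Fxp]].
  have tx : t != x by apply: contraNneq ts => ->.
  by have : (F t `&` F x) p by []; rewrite (disj _ _ tt (ss _ xs) tx).
have [V1 [V2 [oV1 oV2 FV1 GV2 V120]]] :=
  (@normal_openP R (R * R)%type).1 (@pseudometric_normal R (R * R)%type) _ _ (cF _ tt) cG FG.
have V120' : (U `&` V1) `&` (U `&` V2) = set0 by rewrite setIACA V120 setI0.
have [c2 [H2 H1]] := Lam_split UO Uc (@subIsetl _ U V1) (@subIsetl _ U V2) V120'.
rewrite big_cons; have -> : c%:E = ((c - c2)%:E + c2%:E)%E by rewrite -EFinD subrK.
apply: leeD.
  apply: (@hausdorff1_level _ (U `&` V1)) => //.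
  - exact: openI.
  - by move=> p [/UO].
  - by move=> p Fp; split; [case: (FJ t p tt Fp)|exact: FV1].
  - by move=> p Fp; case: (FJ t p tt Fp).
  - exact: s0.
  - by move=> p Fp; case: (FJ t p tt Fp).
apply: (IH (U `&` V2)) => //.
- by move=> x /ss/s0.
- by move=> x /ss/cF.
- by move=> x y /ss xs /ss ys; exact: disj.
- move=> x p xs Fp; have [Up Jp xp] := FJ x p (ss _ xs) Fp; split => //; split => //.
  by apply: GV2; rewrite GE; exists x.
- exact: openI.
- by move=> p [/UO].
Qed.

(** Restricted to a set of finite H^1 measure, [hausdorff1] is a finite Borel measure, to which
    inner regularity applies. *)
Lemma inner_closed A (e : R) : measurable (A : set plane) -> (hausdorff1 A < +oo)%E -> 0 < e ->
  exists F : set (R * R), [/\ closed F, F `<=` A & (hausdorff1 A <= hausdorff1 F + e%:E)%E].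
Proof.
move=> mA finA e0.
pose m : {measure set plane -> \bar R} := mrestr (@hausdorff1_measure R) mA.
have finm : (m setT < +oo)%E.
  by rewrite /m/= /mrestr setTI.
have [_ /(_ e e0)[F [cF FA mF]]] := finite_measure_inner_regular finm mA.
exists F; split => //.
have AE : A = F `|` (A `\` F) by rewrite setDUK.
apply: (@le_trans _ _ (hausdorff1 F + hausdorff1 (A `\` F))%E).
  rewrite {1}AE; exact: outer_measureU2.
apply: leeD2l; move: mF; rewrite /m/= /mrestr.
by rewrite (_ : (A `\` F) `&` A = A `\` F)//; apply/seteqP; split => p [] //= [].
Qed.

Lemma integral_hausdorff1_le (c : R) : (forall p, J p -> 0 <= g p) -> Lam_le Om c ->
  (\int[@hausdorff1_measure R]_(p in J) (g p)%:E <= c%:E)%E.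
Proof.
move=> g0 Oc; rewrite ge0_integralE; last by move=> p Jp; rewrite lee_fin; exact: g0.
apply: ge_ereal_sup => _ [h /= hg <-].
have finh : finite_set (range h) by exact: fimfunP.
rewrite sintegralE fsbig_finite//=; set s : seq R := finmap.enum_fset _.
pose A t : set (R * R) := h @^-1` [set t].
(* The simple function lies below [g] extended by 0, so a positive value occurs only in [J]. *)
have AJ t p : 0 < t -> A t p -> J p /\ t <= g p.
  move=> t0 /= hp; have := hg p; rewrite patchE hp.
  case: ifPn => [|_]; first by rewrite inE lee_fin.
  by rewrite lee_fin leNgt t0.
(* [inner_closed] asks for finiteness; the covering bound on the whole of [Om] provides it. *)
have finA t : 0 < t -> (hausdorff1 (A t) < +oo)%E.
  move=> t0; have := @hausdorff1_level (A t) Om t c oOm (fun p h => h) _ _ t0 _ Oc.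
  move=> /(_ (fun p h => JOm (AJ t p t0 h).1) (fun p h => (AJ t p t0 h).1) (fun p h => (AJ t p t0 h).2)).
  by rewrite muleC -lee_pdivlMr// => /le_lt_trans; apply; rewrite -EFinM ltry.
have mA t : measurable (A t : set plane) by exact: measurable_sfunP.
(* The level 0, whose set need not lie in [J], contributes nothing. *)
pose s' := [seq t <- s | 0 < t].
have -> : (\sum_(t <- s) t%:E * hausdorff1 (A t) = \sum_(t <- s') t%:E * hausdorff1 (A t))%E.
  rewrite big_filter [RHS]big_mkcond/=; rewrite big_seq [RHS]big_seq.
  apply: eq_bigr => t; rewrite /s (in_fset_set finh) inE => -[p _ <-].
  case: ifPn => //; rewrite -leNgt => hp; have /eqP -> : h p == 0 by rewrite eq_le hp fun_ge0.
  by rewrite mul0e.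
have s'0 t : t \in s' -> 0 < t by rewrite mem_filter => /andP[].
apply/lee_addgt0Pr => e e0.
pose T := \sum_(t <- s') t.
have T0 : 0 <= T by rewrite /T big_seq; apply: sumr_ge0 => t /s'0 /ltW.
(* Each level t loses t d, in total T d <= e. *)
pose d := e / (T + 1); have d0 : 0 < d by rewrite divr_gt0// ltr_wpDl.
pose P t (F : set (R * R)) := 0 < t ->
  [/\ closed F, F `<=` A t & (hausdorff1 (A t) <= hausdorff1 F + d%:E)%E].
have [F HF] : {F : R -> set (R * R) & forall t, P t (F t)}.
  apply: (@choice _ _ P) => t; have [t0|t0] := ltP 0 t; last first.
    by exists set0 => /lt_le_trans/(_ t0); rewrite ltxx.
  have [F HF] := inner_closed (mA t) (finA t t0) d0.
  by exists F => _.
apply: (@le_trans _ _ (\sum_(t <- s') (t%:E * hausdorff1 (F t) + (t * d)%:E))%E).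
  rewrite big_seq [leRHS]big_seq; apply: lee_sum => t /s'0 t0.
  have [_ _ H] := HF t t0.
  rewrite EFinM -muleDr//; last first.
    by apply: ge0_adde_def; rewrite inE ?lee_fin ?(ltW d0)//; exact: hausdorff1_ge0.
  by apply: lee_wpmul2l => //; rewrite lee_fin ltW.
rewrite big_split/=; apply: leeD.
  apply: (@hausdorff1_sum s' F Om c) => //.
  - by rewrite filter_uniq// finmap.fset_uniq.
  - by move=> t /s'0 t0; case: (HF t t0).
  - move=> t t' /s'0 t0 /s'0 t'0 tt'; rewrite -subset0 => p [Fp F'p].
    have [_ H _] := HF t t0; have [_ H' _] := HF t' t'0.
    have := H _ Fp; have := H' _ F'p; rewrite /A/= => -> E.
    by rewrite E eqxx in tt'.
  - move=> t p /s'0 t0 Fp; have [_ H _] := HF t t0.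
    by have [Jp tp] := AJ t p t0 (H _ Fp); split => //; exact: JOm.
rewrite sumEFin lee_fin -mulr_suml -/T /d mulrCA ler_piMr ?(ltW e0)//.
by rewrite ler_pdivrMr; lra.
Qed.

End LowerBound.

(** * Traces and truncation *)

Section Traces.
Context {R : realType}.
Local Notation plane := (measurableTypeR R * measurableTypeR R)%type.
Local Notation mu := (@leb2 R).
Implicit Types (p q nu a b : R * R).

Lemma L1_ae (f g : plane -> R) : measurable_fun setT f -> L1 mu g ->
  {ae mu, forall p, f p = g p} -> L1 mu f /\ rint mu f = rint mu g.
Proof.
move=> mf Lg fg; have mg := L1_meas Lg; split; last first.
  rewrite /rint /Rintegral; congr fine; apply: ae_eq_integral => //.
  - exact/measurable_EFinP.
  - exact/measurable_EFinP.
  - by apply: ae_imp fg => p -> _.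
have /integrableP[_ fing] := Lg.
apply/integrableP; split; first exact/measurable_EFinP.
apply: le_lt_trans fing; rewrite le_eqVlt; apply/orP; left; apply/eqP.
apply: ae_eq_integral => //.
- by apply: measurableT_comp => //; exact/measurable_EFinP.
- by apply: measurableT_comp => //; exact/measurable_EFinP.
- by apply: ae_imp fg => p /= -> _.
Qed.

(** The essential bound fails on a null set, where [f] is replaced by 0 so that pointwise estimates
    apply; zeros of [f] are kept, hence the vanishing outside the domain. *)
Lemma truncation (f : plane -> R) : f \in Lfun mu +oo%E ->
  exists2 M : R, 0 <= M & exists f' : plane -> R, [/\ measurable_fun setT f',
    forall p, `|f' p| <= M, forall p, f p = 0 -> f' p = 0 & {ae mu, forall p, f p = f' p}].
Proof.
move=> Hf; have mf : measurable_fun setT f by have := sub_Lfun_mfun Hf; rewrite inE.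
have fin : ('N[mu]_+oo[EFin \o f] < +oo)%E.
  by move: Hf; rewrite inE => /andP[_]; rewrite inE.
have [M aeM] : exists M : R, {ae mu, forall p, `|f p| <= M}.
  move: fin; rewrite unlock; case: ifPn => [_|].
    move=> fin; have H := ess_sup_ge mu (abse \o (EFin \o f)).
    case E : (ess_sup mu (abse \o (EFin \o f))) fin H => [M| |]// _ H.
      by exists M; apply: ae_imp H => p /=; rewrite lee_fin.
    by exists 0; apply: ae_imp H => p /=; rewrite leeNy_eq.
  rewrite -leNgt => mu0 _; exists 0; exists setT; split => //.
  by apply/eqP; rewrite eq_le mu0/=.
exists `|M| => //; pose A : set plane := [set p | `|f p| <= M].
have mA : measurable A.
  have mnf : measurable_fun setT (fun p : plane => `|f p|) by exact: measurableT_comp.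
  rewrite (_ : A = setT `&` (fun p : plane => `|f p|) @^-1` [set` `]-oo, M]]).
    exact: mnf.
  by rewrite setTI; apply/seteqP; split => p /=; rewrite in_itv.
exists (fun p => f p * \1_A p); split.
- by apply: measurable_funM => //; exact: measurable_indic.
- move=> p; rewrite indicE; have [pA|pA] := pselect (A p).
    by rewrite mem_set// mulr1; apply: le_trans pA _; exact: ler_norm.
  by rewrite memNset//= mulr0 normr0.
- by move=> p ->; rewrite mul0r.
- by apply: ae_imp aeM => p pM; rewrite indicE mem_set// mulr1.
Qed.

Lemma half_ball_shift p nu (r : R) q : half_ball p nu r (q + p) <-> half_ball 0 nu r q.
Proof. by rewrite /half_ball/= addrK subr0. Qed.

Lemma measurable_half_ballp p nu (r : R) : measurable (half_ball p nu r : set plane).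
Proof.
have -> : half_ball p nu r = (fun q : plane => (q + - p : plane)) @^-1` half_ball 0 nu r.
  apply/seteqP; split => q /=.
    by move=> H; apply/(half_ball_shift p); rewrite subrK.
  by move=> /(half_ball_shift p); rewrite subrK.
rewrite -[X in measurable X]setTI; apply: (measurable_shift (- p)) => //.
exact: measurable_half_ball.
Qed.

Lemma half_ball_leb2 p nu (r : R) : 0 < r -> (mu (half_ball p nu r) <= (4 * r ^+ 2)%:E)%E.
Proof.
move=> r0; have mh := measurable_half_ballp p nu r.
have mh0 := measurable_half_ball nu r.
rewrite -(leb2_shift p mh).
have -> : (fun q : plane => (q + p : plane)) @^-1` half_ball p nu r = half_ball 0 nu r.
  by apply/seteqP; split => q /= /half_ball_shift.
have B : (lebesgue_measure (ball (0%R : R) r) = (2 * r)%:E)%E.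
  rewrite ball_itv lebesgue_measure_itv/= lte_fin ifT; last lra.
  by rewrite -EFinB; congr EFin; lra.
have E : mu (box r) = (4 * r ^+ 2)%:E.
  have mb : measurable (ball (0 : R) r : set (measurableTypeR R)).
    by apply: open_measurable; exact: ball_open.
  have -> : mu (box r) = (lebesgue_measure (ball 0%R r) *
    lebesgue_measure (ball 0%R r))%E by exact: product_measure1E.
  by rewrite B -EFinM; congr EFin; ring.
rewrite -E; apply: le_measure; rewrite ?inE//; first exact: measurable_box.
by rewrite half_ball0 => q [/= /disc_box].
Qed.

(** Traces are averages, so they pass from the gradient to representatives that agree with it almost
    everywhere, once the half ball lies in [Om]. *)
Lemma one_sided_mean_trace (Om : set (R * R)) (V : R * R -> R * R) (f1 f2 v w : plane -> R) (M : R) p nu a :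
  open Om -> Om p -> measurable_fun setT f1 -> measurable_fun setT f2 ->
  measurable_fun setT v -> measurable_fun setT w ->
  (forall q, `|v q| <= M) -> (forall q, `|w q| <= M) ->
  (forall q, Om q -> V q = (f1 q, f2 q)) ->
  {ae mu, forall q, f1 q = v q} -> {ae mu, forall q, f2 q = w q} ->
  one_sided_trace V p nu a -> mean_trace v w p nu a.
Proof.
move=> oO Op mf1 mf2 mv mw vM wM Vf ae1 ae2 tr e e0.
(* 8 = 2 * 4: the sum of components is at most twice the norm, and the half ball has area at most 4
   r^2. *)
have e80 : 0 < e / 8 by rewrite divr_gt0.
have [r1 /= r10 Hr1] : \forall r \near 0^'+,
    ((mu (half_ball p nu r))^-1 * \int[mu]_(q in half_ball p nu r) (enorm (V q - a))%:E < (e / 8)%:E)%E.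
  apply: (tr [set x | x < (e / 8)%:E]%E); apply: open_nbhs_nbhs; split; first exact: open_ereal_lt_ereal.
  by rewrite /= lte_fin.
have /nbhs_ballP[r2 /= r20 Hr2] : nbhs p Om by apply: open_nbhs_nbhs.
exists (Num.min r1 r2); first by rewrite lt_min r10.
move=> r r0; rewrite lt_min => /andP[rr1 rr2].
have {}Hr1 := Hr1 r; rewrite /= sub0r normrN gtr0_norm// in Hr1.
have {}Hr1 := Hr1 rr1 r0.
set HB : set plane := half_ball p nu r in Hr1 *.
have mHB : measurable HB by exact: measurable_half_ballp.
have HBO : HB `<=` Om.
  move=> q [qr _]; apply: Hr2; have := fst_lip q p; have := snd_lip q p => q2 q1.
  by split; rewrite /ball/= distrC; lra.
have leHB := half_ball_leb2 p nu r0; rewrite -/HB in leHB.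
have finHB : mu HB \is a fin_num by rewrite ge0_fin_numE//; apply: le_lt_trans leHB _; exact: ltry.
pose h := fine (mu HB); have hE : mu HB = h%:E by rewrite /h fineK.
have h0 : 0 <= h by rewrite -lee_fin -hE.
have h4 : h <= 4 * r ^+ 2 by rewrite -lee_fin -hE.
pose S q := `|v q - a.1| + `|w q - a.2|.
pose C := 2 * M + `|a.1| + `|a.2|.
have S0 q : 0 <= S q by exact: addr_ge0.
have SC q : S q <= C.
  have := ler_normB (v q) a.1; have := ler_normB (w q) a.2; have := vM q; have := wM q.
  rewrite /S /C; lra.
have mS : measurable_fun setT (S : plane -> R).
  by apply: measurable_funD; apply: measurableT_comp => //; exact: measurable_funB.
have LHB : L1 mu (\1_HB) by apply: L1_indic => //; rewrite hE ltry.
have L : L1 mu (fun q => \1_HB q * S q).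
  apply: (@L1_dom _ plane R mu _ (fun q => C * \1_HB q)).
  - by apply: measurable_funM => //; exact: measurable_indic.
  - exact: L1Z.
  - move=> q; have /andP[i0 _] := indic01 HB q.
    by rewrite normrM (ger0_norm i0) (ger0_norm (S0 q)) mulrC ler_wpM2r.
have rintHB : rint mu (\1_HB) = h by rewrite /rint /Rintegral integral_indic// setIT.
rewrite -/HB -[X in X <= _]/(rint mu (fun q => \1_HB q * S q)).
(* The average divides by the area, so the value 0 is treated apart. *)
have [h00|hn0] := eqVneq h 0.
  apply: (@le_trans _ _ (rint mu (fun q => C * \1_HB q))).
    apply: rint_le => //; first exact: L1Z.
    by move=> q; rewrite mulrC ler_wpM2r//; have /andP[] := indic01 HB q.
  by rewrite rintZ// rintHB h00 mulr0 mulr_ge0 ?ltW ?exprn_gt0.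
have hp : 0 < h by rewrite lt_def hn0.
rewrite hE inver (negbTE hn0) lte_pdivrMl// in Hr1.
have [mv' mw'] : measurable_fun setT (fun q : plane => enorm (v q - a.1, w q - a.2)) /\
   measurable_fun setT (fun q : plane => enorm (f1 q - a.1, f2 q - a.2)).
  have key (x y : plane -> R) : measurable_fun setT x -> measurable_fun setT y ->
     measurable_fun setT (fun q : plane => enorm (x q - a.1, y q - a.2)).
    move=> mx my; rewrite /enorm /dotp/=.
    have ms : measurable_fun setT (Num.sqrt : measurableTypeR R -> measurableTypeR R).
      by apply: continuous_measurable_fun; exact: sqrt_continuous.
    apply: (measurableT_comp ms).
    by apply: measurable_funD; apply: measurable_funM; exact: measurable_funB.
  by split; exact: key.
have IE : (\int[mu]_(q in HB) (enorm (V q - a))%:E =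
    \int[mu]_(q in HB) (enorm (v q - a.1, w q - a.2))%:E)%E.
  transitivity (\int[mu]_(q in HB) (enorm (f1 q - a.1, f2 q - a.2))%:E)%E.
    by apply: eq_integral => q; rewrite inE => /HBO/Vf ->.
  apply: ae_eq_integral => //.
  - by apply/measurable_EFinP; exact: measurable_funTS.
  - by apply/measurable_EFinP; exact: measurable_funTS.
  - have := @filterI _ _ (ae_filter_ringOfSetsType mu) _ _ ae1 ae2.
    by apply: ae_imp => q [-> ->] _.
rewrite IE in Hr1.
rewrite -lee_fin.
have -> : ((rint mu (fun q => \1_HB q * S q))%:E = \int[mu]_(q in HB) (S q)%:E)%E.
  rewrite /rint /Rintegral fineK; last exact: (integrable_fin_num measurableT L).
  rewrite [RHS]integral_mkcond; apply: eq_integral => q _.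
  rewrite patchE indicE; case: (q \in HB) => /=; by rewrite ?mul1r ?mul0r.
apply: (@le_trans _ _ (\int[mu]_(q in HB) (2 * enorm (v q - a.1, w q - a.2))%:E)%E).
  apply: ge0_le_integral => //.
  - by move=> q _; rewrite lee_fin.
  - by apply/measurable_EFinP; exact: measurable_funTS.
  - by apply/measurable_EFinP; apply: measurable_funM => //; exact: measurable_funTS.
  - move=> q _; rewrite lee_fin /S mulr_natl mulr2n; apply: lerD.
      have := fst_lip (v q - a.1, w q - a.2) 0; by rewrite !subr0.
    have := snd_lip (v q - a.1, w q - a.2) 0; by rewrite !subr0.
under eq_integral do rewrite EFinM.
rewrite ge0_integralZl//; last 2 first.
- by apply/measurable_EFinP; exact: measurable_funTS.
- by move=> q _; rewrite lee_fin; exact: enorm_ge0.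
apply: (@le_trans _ _ (2%:E * (h%:E * (e / 8)%:E))%E).
  by apply: lee_wpmul2l => //; exact: ltW.
rewrite -!EFinM lee_fin.
have : h * e <= 4 * r ^+ 2 * e by rewrite ler_wpM2r// ltW.
lra.
Qed.

Lemma le_limn_einf (x_ : nat -> R) (l : R) (u_ : nat -> \bar R) :
  (forall n, ((x_ n)%:E <= u_ n)%E) -> x_ n @[n --> \oo] --> l -> (l%:E <= limn_einf u_)%E.
Proof.
move=> xu cx; rewrite limn_einf_lim; apply/lee_subgt0Pr => e e0.
apply: lime_ge; first exact: is_cvg_einfs.
have H : \forall n \near \oo, l - e < x_ n by apply: (cvgr_gt _ cx); rewrite ltrBlDr ltrDl.
case: H => N _ HN; near=> n; apply: le_ereal_inf_tmp => _ [k /= nk <-].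
apply: le_trans (xu k); rewrite -EFinB lee_fin ltW//; apply: HN => /=.
by apply: leq_trans nk; near: n; exists N.
Unshelve. all: by end_near. Qed.

End Traces.

(** On a set inside a box, |f| <= 1 + |f|^r is an integrable bound. *)
Lemma Lp_L1 {R : realType} (Om : set (R * R)) (r s : R) (f : R * R -> R) :
  1 <= r -> Om `<=` box s -> Lp Om r%:E f -> L1 leb2 (f \_ Om).
Proof.
move=> r1 Os Lf; have r0 : 0 < r by exact: lt_le_trans r1.
have [mf Lr] := Lfun_powR r0 Lf.
have LB : L1 leb2 (\1_(box s) : _ -> R) by apply: L1_indic; [exact: measurable_box|exact: box_fin].
apply: (L1_dom mf (L1D LB Lr)) => p.
have [Op|nOp] := pselect (Om p); last first.
  by rewrite restr_out// normr0 addr_ge0 ?powR_ge0//; have /andP[] := indic01 (box s) p.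
rewrite indicE mem_set/=; last exact: Os.
set x := `|_|; have x0 : 0 <= x by exact: normr_ge0.
have [x1|x1] := leP x 1; first by apply: (le_trans x1); rewrite lerDl powR_ge0.
apply: (@le_trans _ _ (x `^ r)); last by rewrite lerDr.
by rewrite -[leLHS]powRr1//; apply: ler_powR => //; exact: ltW.
Qed.

Section PowerMeasurability.
Context {R : realType}.
Local Notation plane := (measurableTypeR R * measurableTypeR R)%type.
Variables f g : plane -> R.
Hypotheses (mf : measurable_fun setT f) (mg : measurable_fun setT g).

Lemma measurable_dist3 : measurable_fun setT (fun p => `|f p - g p| ^+ 3).
Proof.
by apply: measurable_funX; apply: measurableT_comp => //; exact: measurable_funB.
Qed.

Lemma measurable_sqrt_dist3 : measurable_fun setT (fun p => Num.sqrt `|f p - g p| ^+ 3).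
Proof.
have ms : measurable_fun setT (Num.sqrt : measurableTypeR R -> measurableTypeR R).
  by apply: continuous_measurable_fun; exact: sqrt_continuous.
apply: measurable_funX; apply: (measurableT_comp ms).
by apply: measurableT_comp => //; exact: measurable_funB.
Qed.

End PowerMeasurability.

Theorem theorem4p3 (R : realType) (Om : set (R * R))
    (eps : nat -> R) (u_ : nat -> R * R -> R) (u : R * R -> R)
    (gradp gradm nu : R * R -> R * R) :
  bounded_domain Om ->
  (forall n, 0 < eps n) ->
  nonincreasing_seq eps ->
  eps n @[n --> \oo] --> 0 ->
  (forall n, H1 Om (u_ n)) ->
  (forall n, weak_derivative_in Om 2%:E ex (weak_derivative Om ex (u_ n))) ->
  H1 Om u ->
  Lp_cvg Om 3%:E (fun n => weak_derivative Om ex (u_ n))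
    (weak_derivative Om ex u) ->
  Lp_cvg Om (3 / 2)%:E (fun n => weak_derivative Om ez (u_ n))
    (weak_derivative Om ez u) ->
  Lp Om +oo%E (weak_derivative Om ex u) ->
  Lp Om +oo%E (weak_derivative Om ez u) ->
  BV Om (weak_derivative Om ex u) ->
  BV Om (weak_derivative Om ez u) ->
  (forall p, jump_set Om (weak_gradient Om u) p ->
    is_jump Om (weak_gradient Om u) p (gradp p) (gradm p) (nu p)) ->
  (\int[hausdorff1_measure]_(p in jump_set Om (weak_gradient Om u))
     `|dotp (Sigma (gradp p) - Sigma (gradm p)) (nu p)|%:E
   <= limn_einf (fun n => energy Om (eps n) (u_ n)))%E.
Proof.
pose plane := (measurableTypeR R * measurableTypeR R)%type.
move=> [oO _ _ bO] eps0 _ _ Hu_ Hxx Hu [Lv_ _ cv] [Lw_ _ cw] Lv Lw _ _ Hjump.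
have [s s0 Os] := bounded_set_box bO.
have r3 : (1 : R) <= 3 by lra.
have r32 : (1 : R) <= 3 / 2 by lra.
pose v := weak_derivative Om ex u \_ Om; pose w := weak_derivative Om ez u \_ Om.
pose v_ n := weak_derivative Om ex (u_ n) \_ Om; pose w_ n := weak_derivative Om ez (u_ n) \_ Om.
have [_ Hux Huz] := Hu.
have mv := is_weak_derivative_measurable oO (weak_derivativeP Hux).
have mw := is_weak_derivative_measurable oO (weak_derivativeP Huz).
have mv_ n : measurable_fun setT (v_ n).
  by have [_ H _] := Hu_ n; exact: is_weak_derivative_measurable oO (weak_derivativeP H).
have mw_ n : measurable_fun setT (w_ n).
  by have [_ _ H] := Hu_ n; exact: is_weak_derivative_measurable oO (weak_derivativeP H).
(* The gradient of [u] is bounded only almost everywhere; the limit pairing is taken with versions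
   [v'] and [w'] that are bounded everywhere. *)
have [M1 M10 [v' [mv' v'M1 v'0 vv']]] := truncation Lv.
have [M2 M20 [w' [mw' w'M2 w'0 ww']]] := truncation Lw.
pose M := M1 + M2.
have v'M q : `|v' q| <= M by apply: (le_trans (v'M1 q)); rewrite lerDl.
have w'M q : `|w' q| <= M by apply: (le_trans (w'M2 q)); rewrite lerDr.
have restrB (f g : R * R -> R) q : ((f \- g)%R \_ Om) q = (f \_ Om) q - (g \_ Om) q.
  by rewrite !patchE; case: ifP => // _; rewrite subr0.
have cvg_v e : 0 < e -> \forall k \near \oo, L1 leb2 (fun p => `|v_ k p - v' p| ^+ 3) /\
    rint leb2 (fun p => `|v_ k p - v' p| ^+ 3) <= e.
  move=> e0.
  have md k : measurable_fun setT ((weak_derivative Om ex (u_ k) \- weak_derivative Om ex u)%R \_ Om : plane -> R).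
    have -> : (weak_derivative Om ex (u_ k) \- weak_derivative Om ex u)%R \_ Om = (fun q => v_ k q - v q).
      by apply/funext => q; exact: restrB.
    exact: measurable_funB (mv_ k) mv.
  have := Lnorm_cvg0_powR r3 md cv e0; apply: filterS => k [Lk Ik].
  have [||L E] := @L1_ae R (fun p => `|v_ k p - v' p| ^+ 3) _ _ Lk.
  - exact: measurable_dist3 (mv_ k) mv'.
  - by apply: ae_imp vv' => p E; rewrite powR_mulrn// restrB -/(v_ k) E.
  by rewrite E.
have cvg_w e : 0 < e -> \forall k \near \oo, L1 leb2 (fun p => Num.sqrt `|w_ k p - w' p| ^+ 3) /\
    rint leb2 (fun p => Num.sqrt `|w_ k p - w' p| ^+ 3) <= e.
  move=> e0.
  have md k : measurable_fun setT ((weak_derivative Om ez (u_ k) \- weak_derivative Om ez u)%R \_ Om : plane -> R).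
    have -> : (weak_derivative Om ez (u_ k) \- weak_derivative Om ez u)%R \_ Om = (fun q => w_ k q - w q).
      by apply/funext => q; exact: restrB.
    exact: measurable_funB (mw_ k) mw.
  have := Lnorm_cvg0_powR r32 md cw e0; apply: filterS => k [Lk Ik].
  have [||L E] := @L1_ae R (fun p => Num.sqrt `|w_ k p - w' p| ^+ 3) _ _ Lk.
  - exact: measurable_sqrt_dist3 (mw_ k) mw'.
  - by apply: ae_imp ww' => p E; rewrite powR32// restrB -/(w_ k) E.
  by rewrite E.
have out k p : ~ box s p -> [/\ v_ k p = 0, w_ k p = 0, v' p = 0 & w' p = 0].
  move=> nb; have nO : ~ Om p by move=> /Os.
  by split; rewrite /v_ /w_ ?v'0 ?w'0 ?restr_out.
set L := limn_einf _.
have key phi : test_function Om phi -> (forall q, `|phi q| <= 1) ->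
    ((flux_pairing v' w' phi)%:E <= L)%E.
  move=> tphi phi1.
  have C := flux_pairing_cvg mv_ mw_ mv' mw' v'M w'M out cvg_v cvg_w tphi.
  apply: le_limn_einf C => n.
  exact: (energy_ge_pairing oO bO (eps0 n) (Hu_ n) (Hxx n)
    (Lp_L1 r3 Os (Lv_ n)) (Lp_L1 r32 Os (Lw_ n)) tphi phi1).
have t0 : test_function Om (fun=> 0 : R) by exact: test_0.
have Lam0 : flux_pairing v' w' (fun=> 0) = 0.
  have <- : (fun q => 0 * (fun=> 0) q) = (fun=> 0) :> (R * R -> R) by apply/funext => q; rewrite mul0r.
  by rewrite (flux_pairing_scale mv' mw' v'M w'M 0 t0) mul0r.
have L0 : (0 <= L)%E by rewrite -[0%E]/(0%R%:E) -Lam0; apply: key => // q; rewrite normr0.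
(* The zero test function excludes a lower limit of -oo, and for +oo the claim is trivial. *)
case EL : L L0 => [l| |]// _; last by rewrite leey.
have Vf q : Om q -> weak_gradient Om u q = (v q, w q).
  by move=> Oq; congr pair; apply/esym; exact: restr_in.
have blow p (c : R) : jump_set Om (weak_gradient Om u) p ->
    c < `|dotp (Sigma (gradp p) - Sigma (gradm p)) (nu p)| ->
  exists2 r0 : R, 0 < r0 & forall r, 0 < r -> r < r0 ->
  exists phi, [/\ test_function (disc p r) phi, forall q, `|phi q| <= 1 &
    2 * r * c <= flux_pairing v' w' phi].
  move=> /Hjump[Op _ nu1 Ta Tb]; apply: (blowup mv' mw' v'M w'M nu1).
    exact: (one_sided_mean_trace oO Op mv mw mv' mw' v'M w'M Vf vv' ww' Ta).
  exact: (one_sided_mean_trace oO Op mv mw mv' mw' v'M w'M Vf vv' ww' Tb).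
apply: (@integral_hausdorff1_le R Om _ (flux_pairing v' w')
  (fun p => `|dotp (Sigma (gradp p) - Sigma (gradm p)) (nu p)|)) => //.
- by move=> p [a [b [n []]]].
- by move=> phi psi; exact: flux_pairing_add mv' mw' v'M w'M _ _ _.
- by move=> phi tphi phi1; rewrite -lee_fin -EL; exact: key.
Qed.
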